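(* Let $x_0\ge 0$ be deterministic, and let $G,g\colon[0,\infty)\to\mathbb{R}$ be such that the mappings $\overline{G}=G+\frac12 g'g$ and $g$ are of class $\mathcal{C}^2$ on $[0,\infty)$ with bounded first and second order derivatives and $\overline{G}(0)=g(0)=0$. Let $(\mathbf{X}(t))_{t\ge 0}$ be the solution, with values in $[0,\infty)$, of the Stratonovich stochastic differential equation $$\mathrm{d}\mathbf{X}(t)=G(\mathbf{X}(t))\,\mathrm{d}t+g(\mathbf{X}(t))\circ\mathrm{d}B(t),\qquad \mathbf{X}(0)=x_0,$$ and, for $T\in(0,\infty)$, $N\in\mathbb{N}$ and $\tau=T/N$, let $(\mathbf{X}_n)_{0\le n\le N}$ be defined by $\mathbf{X}_0=x_0$ and, for $n\in\{0,\ldots,N-1\}$, $$\mathbf{X}_{n+1}=\exp\Bigl(F(\mathbf{X}_n)\tau+f(\mathbf{X}_n)\delta B_n+\tfrac12 (f'g)(\mathbf{X}_n)\,\delta B_n^2\Bigr)\mathbf{X}_n .$$ For all $T\in(0,\infty)$ and $p\in[1,\infty)$, there exist $C_p(T,x_0)\in(0,\infty)$ and $\tau_p\in(0,1)$ such that for any time-step size $\tau=T/N$, with $N\in\mathbb{N}$, which satisfies $\tau\le\tau_p$, one has $$\sup_{0\le n\le N}\bigl(\mathbb{E}\bigl[|\mathbf{X}_n-\mathbf{X}(t_n)|^{2p}\bigr]\bigr)^{\frac{1}{2p}}\le C_p(T,x_0)\,\tau .$$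
   Context: $(\Omega,\mathcal{F},\mathbb{P})$ is a probability space equipped with a filtration $(\mathcal{F}_t)_{t\ge 0}$, and $(B(t))_{t\ge 0}$ is a standard real-valued $(\mathcal{F}_t)$-Wiener process. $\mathbb{N}$ denotes the positive integers. For $T\in(0,\infty)$ and $N\in\mathbb{N}$: $\tau=T/N$, $t_n=n\tau$, $\delta B_n=B(t_{n+1})-B(t_n)$. The Stratonovich equation is understood through its equivalent It\^o formulation $\mathrm{d}\mathbf{X}(t)=\overline{G}(\mathbf{X}(t))\,\mathrm{d}t+g(\mathbf{X}(t))\,\mathrm{d}B(t)$, $\mathbf{X}(0)=x_0$. The functions $F,f\colon[0,\infty)\to\mathbb{R}$ are defined by $F(x)=\int_0^1 G'(\theta x)\,\mathrm{d}\theta$ and $f(x)=\int_0^1 g'(\theta x)\,\mathrm{d}\theta$, so that $G(x)=xF(x)$ and $g(x)=xf(x)$. Products such as $f'g$ and $g'g$ are pointwise products of functions. Constants may depend on $G$ and $g$ but not on $N$. *)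

(* Defs.v *)
From HB Require Import structures.
From mathcomp Require Import all_boot all_order all_algebra.
From mathcomp Require Import all_classical all_reals all_analysis.

Set Implicit Arguments.
Unset Strict Implicit.
Unset Printing Implicit Defensive.

Import Order.TTheory GRing.Theory Num.Theory.
Import numFieldNormedType.Exports.

Local Open Scope classical_set_scope.
Local Open Scope ring_scope.

Section half_line_calculus.
Context {R : realType}.
Implicit Types (h : R -> R) (x : R).

(* A function [0, +oo[ -> R is represented by a function R -> R whose values
   at negative reals are irrelevant. Difference quotients are therefore only
   taken along points y of [0, +oo[ with y != x: this is the usual two-sided
   derivative when x > 0 and the right derivative when x = 0. *)
Definition half_quotient_at h x : set_system R :=
  (fun y => (h y - h x) / (y - x)) @ within `[0, +oo[ x^'.

Definition derivable_half h x : Prop := cvg (half_quotient_at h x).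

Definition derive_half h : R -> R := fun x => lim (half_quotient_at h x).

Definition bounded_on_half h : Prop :=
  exists M : R, forall x, 0 <= x -> `|h x| <= M.

Definition C2_bounded_derivatives h : Prop :=
  [/\ forall x, 0 <= x -> derivable_half h x,
      forall x, 0 <= x -> derivable_half (derive_half h) x,
      {within `[0, +oo[, continuous (derive_half (derive_half h))},
      bounded_on_half (derive_half h) &
      bounded_on_half (derive_half (derive_half h))].

Definition ito_drift (G g : R -> R) : R -> R :=
  fun x => G x + 2^-1 * (derive_half g x * g x).

(* F = mean_derive G and f = mean_derive g *)
Definition mean_derive h : R -> R := fun x =>
  \int[lebesgue_measure]_(theta in `[0, 1]) derive_half h (theta * x).

End half_line_calculus.

Section stochastic.
Context {R : realType} {d : measure_display} {Omega : measurableType d}.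
Variable P : probability Omega R.

(* Processes are indexed by R; only the times t >= 0 matter. *)

Definition is_filtration (F : R -> set (set Omega)) : Prop :=
  [/\ forall t, 0 <= t -> sigma_algebra setT (F t),
      forall t, 0 <= t -> F t `<=` measurable &
      forall s t, 0 <= s -> s <= t -> F s `<=` F t].

Definition measurable_wrt (S : set (set Omega)) (Y : Omega -> R) : Prop :=
  forall A : set R, measurable A -> S (Y @^-1` A).

Definition adapted (F : R -> set (set Omega)) (Y : R -> Omega -> R) : Prop :=
  forall t, 0 <= t -> measurable_wrt (F t) (Y t).

Definition continuous_paths (Y : R -> Omega -> R) : Prop :=
  {ae P, forall w, {within `[0, +oo[, continuous (fun t : R => Y t w)}}.

Definition is_wiener (F : R -> set (set Omega)) (B : R -> Omega -> R) : Prop :=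
  [/\ adapted F B,
      continuous_paths B,
      {ae P, forall w, B 0 w = 0},
      forall (s t : R) (A : set R), 0 <= s -> s < t -> measurable A ->
        P ((B t \- B s)%R @^-1` A) = normal_prob 0 (Num.sqrt (t - s)) A &
      forall (s t : R) (E : set Omega) (A : set R), 0 <= s -> s < t ->
        F s E -> measurable A ->
        P (E `&` (B t \- B s)%R @^-1` A) = (P E * P ((B t \- B s)%R @^-1` A))%E].

(* Convergence to 0 in probability of nonnegative Y_n. The events {Y_n >= e}
   are only required to be covered by measurable events of vanishing
   probability, because they need not be measurable themselves: no
   completeness is assumed and path properties only hold almost surely. For
   measurable Y_n this is the usual notion. *)
Definition cvg0_in_probability (Y : nat -> Omega -> \bar R) : Prop :=
  forall e : R, 0 < e -> exists A : nat -> set Omega,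
    [/\ forall n, measurable (A n),
        forall n, [set w | (e%:E <= Y n w)%E] `<=` A n &
        P (A n) @[n --> \oo] --> 0%E].

(* The simple process \sum_(i < sp_size) sp_val i * 1_{]sp_time i, sp_time i.+1]} *)
Record simple_process (F : R -> set (set Omega)) := SimpleProcess {
  sp_size : nat ;
  sp_time : nat -> R ;
  sp_val : nat -> Omega -> R ;
  sp_time_ge0 : forall i, 0 <= sp_time i ;
  sp_time_mono : forall i, sp_time i <= sp_time i.+1 ;
  sp_val_meas : forall i, measurable_wrt (F (sp_time i)) (sp_val i) ;
  sp_val_bounded : forall i, exists M : R, forall w, `|sp_val i w| <= M }.

Definition sp_eval F (S : simple_process F) (s : R) (w : Omega) : R :=
  \sum_(i < sp_size S)
    sp_val S i w * \1_(`]sp_time S i, sp_time S i.+1]) s.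

Definition sp_integral F (S : simple_process F) (B : R -> Omega -> R)
    (t : R) (w : Omega) : R :=
  \sum_(i < sp_size S) sp_val S i w *
    (B (Num.min (sp_time S i.+1) t) w - B (Num.min (sp_time S i) t) w).

(* I is a version of the Ito integral of H over [0, t] with respect to B: the
   limit in probability of the integrals of simple processes S n such that
   \int_0^t (S n - H)^2 ds tends to 0 in probability. Meant for adapted
   integrands H with almost surely continuous paths. *)
Definition is_ito_integral (F : R -> set (set Omega)) (B H : R -> Omega -> R)
    (t : R) (I : Omega -> R) : Prop :=
  exists S : nat -> simple_process F,
    cvg0_in_probability (fun n w =>
      (\int[lebesgue_measure]_(s in `[0%R, t])
         ((sp_eval (S n) s w - H s w) ^+ 2)%:E)%E) /\
    cvg0_in_probability (fun n w => `|sp_integral (S n) B t w - I w|%:E).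

(* Solution with values in [0, +oo[ of dX = G(X) dt + g(X) o dB, X(0) = x0,
   in its Ito form dX = (G + g'g/2)(X) dt + g(X) dB. *)
Definition stratonovich_solution (F : R -> set (set Omega))
    (B : R -> Omega -> R) (G g : R -> R) (x0 : R) (X : R -> Omega -> R) : Prop :=
  [/\ forall (t : R) w, 0 <= t -> 0 <= X t w,
      adapted F X,
      continuous_paths X,
      {ae P, forall w, X 0 w = x0} &
      forall t : R, 0 <= t -> exists2 I : {RV P >-> R},
        is_ito_integral F B (fun s w => g (X s w)) t I &
        {ae P, forall w, X t w = x0 +
           (\int[lebesgue_measure]_(s in `[0, t]) ito_drift G g (X s w)) + I w}].

Fixpoint exp_scheme (B : R -> Omega -> R) (G g : R -> R) (x0 tau : R)
    (n : nat) (w : Omega) : R :=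
  if n is m.+1 then
    let x := exp_scheme B G g x0 tau m w in
    let dB := B (m.+1%:R * tau) w - B (m%:R * tau) w in
    let F := mean_derive G in
    let f := mean_derive g in
    expR (F x * tau + f x * dB + 2^-1 * (derive_half f x * g x) * dB ^+ 2) * x
  else x0.

End stochastic.

(* Main.v *)
(* The odd extensions a, b of the Ito drift and of g are globally Lipschitz. The
   exponential step agrees, up to one-step errors of the order of
   h (1 + x^2), with the derivative-free Milstein step
     y + a(y) h + b(y) dB + (b(y + sqrt h b(y)) - b(y)) / (2 sqrt h) (dB^2 - h),
   which, unlike the Milstein step itself, is stable in L^q under perturbations
   although b' b need not be Lipschitz. Here q is an even integer above 2p, and a
   one-step error consists of a part bounded by h and of a centred part
   bounded by sqrt h, so that E e^q grows by a factor 1 + C h and a discrete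
   Gronwall inequality applies. The same argument bounds by O(h) the effect
   of halving the step, hence, summing a geometric series, of any number of
   halvings. Only explicit Gaussian integrals are involved so far.
   The solution enters through a qualitative statement: the derivative-free
   Milstein scheme with step t/M converges in probability to X(t). Indeed
   Riemann sums converge to the Ito integral, so X solves the Euler recursion
   up to a uniformly small defect, and this perturbed Euler recursion is
   compared in L^2 with the scheme. Moments of the error are truncated to
   pass to the limit in probability. *)
Require Import Defs.
From HB Require Import structures.
From mathcomp Require Import all_boot all_order all_algebra.
From mathcomp Require Import all_classical all_reals all_analysis.
From mathcomp Require Import measurable_realfun zify ring lra.
Import Order.TTheory GRing.Theory Num.Theory.
Import numFieldNormedType.Exports.
Local Open Scope classical_set_scope.
Local Open Scope ring_scope.

Set Implicit Arguments.
Unset Strict Implicit.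
Unset Printing Implicit Defensive.

(** * Integrals of nonnegative real functions *)

(** The Milstein step resists a stability estimate because the Lipschitz constant of [b' b] may grow
    like [1 + |x|]: the difference of two trajectories then meets an unbounded factor and its
    moments do not close. A difference quotient of step [sqrt h] cures this: [sqrt h] times the
    quotient is Lipschitz uniformly in [h], which is the size allowed for a centred part. The local
    errors become quadratic in the state, so that moments of order [2 * q] of the schemes are needed
    for errors in L^q. The odd extension of a C^2 function is in general only C^1 with a Lipschitz
    derivative, hence expansions of the coefficients have a second order remainder and no more. The
    solution is given through limits in probability, with neither moments nor an isometry at hand.
    All rates are therefore proved between schemes, and no rate is asked of the convergence towards
    the solution. The exponent of the scheme contains [dB ^+ 2], whose exponential moments are
    finite only for small steps; this restricts [tau_p]. *)

Section ge0_real_integrals.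
Context {R : realType} {d : measure_display} {T : measurableType d}.
Variable m : {measure set T -> \bar R}.
Implicit Types f g : T -> R.

Lemma le_intE f g : measurable_fun [set: T] f -> measurable_fun [set: T] g ->
  (forall x, 0 <= f x) -> (forall x, f x <= g x) ->
  (\int[m]_x (f x)%:E <= \int[m]_x (g x)%:E)%E.
Proof.
move=> mf mg f0 fg; apply: ge0_le_integral => //.
- by move=> x _; rewrite lee_fin.
- exact/measurable_EFinP.
- exact/measurable_EFinP.
- by move=> x _; rewrite lee_fin.
Qed.

Lemma intEZ f (k : R) : measurable_fun [set: T] f -> (forall x, 0 <= f x) ->
  0 <= k -> (\int[m]_x (k * f x)%:E = k%:E * \int[m]_x (f x)%:E)%E.
Proof.
move=> mf f0 k0; rewrite -ge0_integralZl_EFin //.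
- by move=> x _; rewrite lee_fin.
- exact/measurable_EFinP.
Qed.

Lemma intED f g : measurable_fun [set: T] f -> measurable_fun [set: T] g ->
  (forall x, 0 <= f x) -> (forall x, 0 <= g x) ->
  (\int[m]_x (f x + g x)%:E = \int[m]_x (f x)%:E + \int[m]_x (g x)%:E)%E.
Proof.
move=> mf mg f0 g0; rewrite -ge0_integralD //.
- by move=> x _; rewrite lee_fin.
- exact/measurable_EFinP.
- by move=> x _; rewrite lee_fin.
- exact/measurable_EFinP.
Qed.

Lemma intE_ge0 f : (forall x, 0 <= f x) -> (0 <= \int[m]_x (f x)%:E)%E.
Proof. by move=> f0; apply: integral_ge0 => x _; rewrite lee_fin. Qed.

Lemma intE_cst (k : R) : m setT = 1%E -> (\int[m]_(x in [set: T]) (k)%:E = k%:E)%E.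
Proof. by move=> m1; rewrite integral_cst// m1 mule1. Qed.

End ge0_real_integrals.

Section measurable_compositions.
Context {R : realType} {d : measure_display} {T : measurableType d}.
Implicit Types f : T -> R.

Lemma measurable_fun_norm f : measurable_fun [set: T] f ->
  measurable_fun [set: T] (fun x => `|f x|).
Proof. by move=> mf; exact (measurableT_comp (@normr_measurable R setT) mf). Qed.

Lemma measurable_fun_expR f : measurable_fun [set: T] f ->
  measurable_fun [set: T] (fun x => expR (f x)).
Proof. by move=> mf; exact (measurableT_comp (@measurable_expR R) mf). Qed.

Lemma measurable_fun_opp f : measurable_fun [set: T] f ->
  measurable_fun [set: T] (fun x => - f x).
Proof. by move=> mf; exact (measurableT_comp (@oppr_measurable R setT) mf). Qed.

Lemma measurable_norm_gt f (e : R) : measurable_fun [set: T] f ->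
  measurable [set x | e < `|f x|].
Proof.
move=> mf; rewrite (_ : [set x | _] = (fun x => `|f x|) @^-1` `]e, +oo[).
  by rewrite -[X in measurable X]setTI; apply: measurable_fun_norm.
by apply/seteqP; split => x /=; rewrite in_itv/= andbT.
Qed.

End measurable_compositions.

Ltac mfun := cbv beta; first [ assumption | lazymatch goal with
  | |- measurable_fun _ (fun x => (@?f x + @?g x)%R) => apply: measurable_funD; mfun
  | |- measurable_fun _ (fun x => (- @?f x)%R) => apply: measurable_fun_opp; mfun
  | |- measurable_fun _ (fun x => (@?f x * @?g x)%R) => apply: measurable_funM; mfun
  | |- measurable_fun _ (fun x => (@?f x ^+ ?n)%R) => apply: measurable_funX; mfun
  | |- measurable_fun _ (fun x => `|@?f x|%R) => apply: measurable_fun_norm; mfun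
  | |- measurable_fun _ (fun x => expR (@?f x)) => apply: measurable_fun_expR; mfun
  | |- measurable_fun _ (fun x => x) => exact: measurable_id
  | |- measurable_fun _ (fun x => ?c) => exact: measurable_cst
  | |- measurable_fun _ (fun x => fst (@?f x)) =>
      first [exact: measurable_fst | refine (measurableT_comp measurable_fst _); mfun]
  | |- measurable_fun _ (fun x => snd (@?f x)) =>
      first [exact: measurable_snd | refine (measurableT_comp measurable_snd _); mfun]
  | |- measurable_fun _ (fun x => (@?f x, @?g x)) =>
     apply: measurable_fun_pair; mfun
  | |- _ => solve [done | eassumption]
  end ].

(** * Gaussian integrals *)

Section gaussian.
Context {R : realType}.
Local Notation mu := (@lebesgue_measure R).

(** The image of Lebesgue measure under [x -> s * x], multiplied by [s], gives every interval its
    length, hence is Lebesgue measure. *)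
Lemma ge0_integral_lebesgue_scale (s : R) (f : R -> \bar R) : 0 < s ->
  measurable_fun [set: R] f -> (forall x, (0 <= f x)%E) ->
  (\int[mu]_x f x = s%:E * \int[mu]_x f (s * x)%R)%E.
Proof.
move=> s0 mf f0.
pose ph : R -> measurableTypeR R := fun x => s * x.
have mph : measurable_fun setT ph by exact: measurable_funM.
pose nu0 := mscale (NngNum (ltW s0)) (pushforward mu ph); pose nu := nu0 mph.
have E A : measurable A -> mu A = nu A.
  apply: lebesgue_measure_unique => _ [[a b]] _ <- /=.
  rewrite /nu /nu0 /mscale/= /pushforward.
  have -> : ph @^-1` `]a, b] = `](a / s), (b / s)]%classic.
    apply/seteqP; split => x /=; rewrite !in_itv/= ltr_pdivrMr// ler_pdivlMr//;
      by rewrite /ph mulrC.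
  rewrite !lebesgue_measure_itv/= !lte_fin ltr_pM2r ?invr_gt0//.
  case: ifPn; last by rewrite mule0.
  move=> ab; rewrite -!EFinB -EFinM; congr EFin; field.
  by rewrite gt_eqF.
rewrite (@eq_measure_integral _ _ _ _ nu) /=; last by move=> A mA _; exact: E.
by rewrite ge0_integral_mscale//= ge0_integral_pushforward//=.
Qed.

(** The change of measure involves an abstract Radon-Nikodym derivative; it equals [normal_pdf]
    almost everywhere since both have the same integral over every measurable set. *)
Lemma ge0_integral_normal_prob (s : R) (f : R -> \bar R) : s != 0 ->
  measurable_fun [set: R] f -> (forall x, (0 <= f x)%E) ->
  (\int[normal_prob 0 s]_x f x = \int[mu]_x (f x * (normal_pdf 0 s x)%:E))%E.
Proof.
move=> s0 mf f0.
rewrite -(Radon_Nikodym_SigmaFinite.change_of_variables (normal_prob_dominates 0 s))//.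
apply: ge0_ae_eq_integral => //=.
- apply: emeasurable_funM => //.
  exact: measurable_int (Radon_Nikodym_SigmaFinite.f_integrable (normal_prob_dominates 0 s)).
- apply: emeasurable_funM => //; apply/measurable_EFinP; exact: measurable_normal_pdf.
- move=> x _; rewrite mule_ge0//; apply: Radon_Nikodym_SigmaFinite.f_ge0; exact: normal_prob_dominates.
- move=> x _; rewrite mule_ge0// lee_fin normal_pdf_ge0//.
have : ae_eq mu setT (Radon_Nikodym_SigmaFinite.f (normal_prob 0 s) mu)
   (EFin \o normal_pdf 0 s).
  apply: integral_ae_eq => //=.
  - apply: Radon_Nikodym_SigmaFinite.f_integrable; exact: normal_prob_dominates.
  - apply/measurable_EFinP; exact: measurable_normal_pdf.
  - move=> A _ mA; rewrite -Radon_Nikodym_SigmaFinite.f_integral//.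
    exact: normal_prob_dominates.
by move=> [A [mA A0 AE]]; exists A; split => // x H; apply: AE => H'; apply: H => _;
  rewrite H'.
Qed.

End gaussian.

Section gaussian.
Context {R : realType}.
Local Notation mu := (@lebesgue_measure R).
Local Notation gamma := (normal_prob (0 : R) 1).

Lemma normal_pdf_scale (s x : R) : 0 < s ->
  normal_pdf 0 1 x = s * normal_pdf 0 s (s * x).
Proof.
move=> s0; rewrite !normal_pdfE ?gt_eqF//= /normal_peak /normal_fun !subr0 mulrA.
congr (_ * _).
  rewrite expr1n mul1r -mulrnAr sqrtrM ?sqr_ge0// sqrtr_sqr gtr0_norm//.
  by rewrite invfM mulrA divff ?gt_eqF// mul1r.
congr expR; rewrite expr1n; field.
by rewrite gt_eqF.
Qed.

Lemma ge0_integral_normal_probE (s : R) (f : R -> \bar R) : 0 < s ->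
  measurable_fun [set: R] f -> (forall x, (0 <= f x)%E) ->
  (\int[normal_prob 0 s]_x f x = \int[gamma]_x f (s * x)%R)%E.
Proof.
move=> s0 mf f0.
have mfs : measurable_fun [set: R] (fun x => f (s * x)).
  exact (measurableT_comp mf (@mulrl_measurable R setT s)).
rewrite [RHS](ge0_integral_normal_prob (oner_neq0 R) mfs (fun=> f0 _)).
rewrite (ge0_integral_normal_prob (lt0r_neq0 s0) mf f0).
have mp : measurable_fun [set: R] (fun x => f x * (normal_pdf 0 s x)%:E)%E.
  by apply: emeasurable_funM => //; apply/measurable_EFinP; exact: measurable_normal_pdf.
rewrite (ge0_integral_lebesgue_scale s0 mp); last first.
  by move=> x; rewrite mule_ge0// lee_fin normal_pdf_ge0.
rewrite -ge0_integralZl_EFin//=; last 3 first.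
- by move=> x _; rewrite mule_ge0// lee_fin normal_pdf_ge0.
- apply: emeasurable_funM => //; apply/measurable_EFinP.
  exact (measurableT_comp (measurable_normal_pdf 0 s) (@mulrl_measurable R setT s)).
- exact: ltW.
by apply: eq_integral => x _; rewrite (normal_pdf_scale x s0) EFinM muleCA.
Qed.

Lemma ge0_integral_gaussN (f : R -> \bar R) :
  measurable_fun [set: R] f -> (forall x, (0 <= f x)%E) ->
  (\int[gamma]_x f (- x)%R = \int[gamma]_x f x)%E.
Proof.
move=> mf f0.
have mN : measurable_fun setT (-%R : R -> measurableTypeR R) by exact: oppr_measurable.
have mfN : measurable_fun [set: R] (fun x => f (- x)) by exact: measurableT_comp.
rewrite [RHS](ge0_integral_normal_prob (oner_neq0 R) mf f0).
rewrite (ge0_integral_normal_prob (oner_neq0 R) mfN (fun=> f0 _)).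
have mp : measurable_fun [set: R] (fun x => f x * (normal_pdf 0 1 x)%:E)%E.
  by apply: emeasurable_funM => //; apply/measurable_EFinP; exact: measurable_normal_pdf.
transitivity (\int[pushforward mu (-%R : R -> measurableTypeR R)]_x
   (f x * (normal_pdf 0 1 x)%:E)%E)%E.
  rewrite ge0_integral_pushforward; [|exact mN|by []|exact mp|].
    rewrite (preimage_setT (-%R : R -> measurableTypeR R)).
    apply: eq_integral => x _; congr (_ * _%:E)%E.
    by rewrite !(normal_pdfE _ (oner_neq0 R)) /= /normal_fun !subr0 sqrrN.
  by move=> x _; rewrite mule_ge0 ?f0// lee_fin normal_pdf_ge0.
by apply: eq_measure_integral => A mA _; exact: lebesgue_measureN.
Qed.

(** Multiplied by the standard density, the integrand is [s^-1] times the normal density of standard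
    deviation [s^-1]. *)
Lemma integral_gauss_expR (s : R) : 0 < s ->
  (\int[gamma]_x (expR ((1 - s ^+ 2) * x ^+ 2 / 2))%:E = (s^-1)%:E)%E.
Proof.
move=> s0.
have mx : measurable_fun [set: R] (fun x : R => expR ((1 - s ^+ 2) * x ^+ 2 / 2)).
  by apply: measurableT_comp => //; apply: measurable_funM => //; apply: measurable_funM.
rewrite (ge0_integral_normal_prob (oner_neq0 R)); last 2 first.
- exact/measurable_EFinP.
- by move=> x; rewrite lee_fin expR_ge0.
have sn : s^-1 != 0 by rewrite gt_eqF// invr_gt0.
transitivity (\int[mu]_x ((s^-1)%:E * (normal_pdf 0 s^-1 x)%:E))%E; last first.
  rewrite ge0_integralZl_EFin//.
  - by rewrite integral_normal_pdf mule1.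
  - by move=> x _; rewrite lee_fin normal_pdf_ge0.
  - by apply/measurable_EFinP; exact: measurable_normal_pdf.
  - by rewrite invr_ge0 ltW.
apply: eq_integral => x _; rewrite -!EFinM; congr EFin.
rewrite !normal_pdfE ?oner_eq0//= /normal_peak /normal_fun !subr0.
rewrite expr1n mul1r -mulrnAr (sqrtrM (pi *+ 2)) ?sqr_ge0// sqrtr_sqr.
rewrite ger0_norm ?invr_ge0 ?(ltW s0)// invfM invrK.
rewrite mulrCA -expRD [in RHS]mulrA [in RHS]mulrA mulVf ?gt_eqF// mul1r.
congr (_ * expR _); field.
by rewrite gt_eqF.
Qed.

Lemma gauss_integrable (f : R -> R) (K : R) : measurable_fun [set: R] f ->
  (forall x, `|f x| <= K * expR (x ^+ 2 / 4)) ->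
  gamma.-integrable setT (EFin \o f).
Proof.
move=> mf fK; apply/integrableP; split; first exact/measurable_EFinP.
have K0 : 0 <= K.
  by have := le_trans (normr_ge0 _) (fK 0); rewrite expr0n/= mul0r expR0 mulr1.
(* The case [s ^+ 2 = 2^-1] of [integral_gauss_expR] is the integral of [expR (x ^+ 2 / 4)], safely
   below the critical exponent [x ^+ 2 / 2]. *)
have s20 : 0 < Num.sqrt (2^-1 : R) by rewrite sqrtr_gt0 invr_gt0.
have mx : measurable_fun [set: R] (fun x : R => (expR (x ^+ 2 / 4))%:E).
  apply/measurable_EFinP/measurableT_comp => //; apply: measurable_funM => //.
apply: (@le_lt_trans _ _ (K%:E * \int[gamma]_x (expR (x ^+ 2 / 4))%:E)%E).
  rewrite -ge0_integralZl_EFin//.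
  apply: ge0_le_integral => //=.
  - by apply/measurable_EFinP; exact: measurableT_comp.
  - by apply: emeasurable_funM.
  - by move=> x _; rewrite -EFinM lee_fin.
have := integral_gauss_expR s20.
under eq_integral.
  move=> x _; rewrite sqr_sqrtr ?invr_ge0//.
  rewrite (_ : _ * _ / 2 = x ^+ 2 / 4); last by field.
  over.
by move=> ->; rewrite -EFinM ltry.
Qed.

Lemma Rintegral_gauss_odd (f : R -> R) (K : R) : measurable_fun [set: R] f ->
  (forall x, `|f x| <= K * expR (x ^+ 2 / 4)) ->
  (forall x, f (- x) = - f x) ->
  (\int[gamma]_x (f x)%:E = 0)%E.
Proof.
move=> mf fK fodd; have intf := gauss_integrable mf fK.
rewrite integralE /=.
have E : (\int[gamma]_x (fun x => (f x)%:E)^\- x = \int[gamma]_x (fun x => (f x)%:E)^\+ x)%E.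
  rewrite -ge0_integral_gaussN//.
    apply: eq_integral => x _; rewrite funenegE funeposE /=.
    by rewrite fodd -?EFinN ?opprK.
  by apply: measurable_funeneg; exact/measurable_EFinP.
rewrite E subee//.
have := integrable_pos_fin_num measurableT intf.
by [].
Qed.

Lemma integral_gauss_sqr : (\int[gamma]_x (x ^+ 2)%:E = 1)%E.
Proof.
have msq : measurable_fun [set: R] (fun x : R => x ^+ 2) by mfun.
have mexp (c : R) : measurable_fun [set: R] (fun x : R => expR (c * x ^+ 2 / 2)) by mfun.
have m1 (k : R) : (\int[gamma]_x k%:E = k%:E)%E.
  by apply: intE_cst; exact: probability_setT.
have Z (k : R) : 0 <= k ->
    (\int[gamma]_x (k * x ^+ 2)%:E = k%:E * \int[gamma]_x (x ^+ 2)%:E)%E.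
  by move=> k0; apply: intEZ => // x; exact: sqr_ge0.
(* the moment generating function of x^2 squeezes the second moment *)
have up (s : R) : 0 < s -> s < 1 -> (\int[gamma]_x (x ^+ 2)%:E <= (2 / (s * (1 + s)))%:E)%E.
  move=> s0 s1.
  have d0 : 0 <= (1 - s ^+ 2) / 2 by nra.
  have H : (1%:E + ((1 - s ^+ 2) / 2)%:E * \int[gamma]_x (x ^+ 2)%:E <= (s^-1)%:E)%E.
    rewrite -(integral_gauss_expR s0) -(Z _ d0).
    rewrite -{1}(m1 1) -intED; [|by mfun..|by []|]; last first.
      by move=> x; rewrite mulr_ge0 ?sqr_ge0.
    apply: le_intE; [by mfun..| |].
    - by move=> x; rewrite addr_ge0// mulr_ge0 ?sqr_ge0.
    - by move=> x; apply: le_trans (expR_ge1Dx _); rewrite mulrAC.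
  move: H; have := intE_ge0 gamma (fun x => sqr_ge0 x).
  case: (\int[gamma]_x (x ^+ 2)%:E)%E => [r| |]//.
  - rewrite -EFinM -EFinD !lee_fin => r0 H.
    rewrite ler_pdivlMr; last by rewrite mulr_gt0// addr_gt0.
    have : s * (1 + (1 - s ^+ 2) / 2 * r) <= 1 by rewrite -ler_pdivlMl// mulr1.
    move=> H2.
    have : (1 - s) * (r * (s * (1 + s)) / 2) <= (1 - s) * 1 by lra.
    rewrite ler_pM2l ?subr_gt0//; lra.
  - have d1 : 0 < (1 - s ^+ 2) / 2 by nra.
    by move=> _; rewrite gt0_muley ?lte_fin // addey// leye_eq.
have dn (s : R) : 1 < s -> ((2 / (s * (1 + s)))%:E <= \int[gamma]_x (x ^+ 2)%:E)%E.
  move=> s1; have s0 : 0 < s by apply: lt_trans s1.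
  have d0 : 0 <= (s ^+ 2 - 1) / 2 by nra.
  have H : (1%:E <= (s^-1)%:E + ((s ^+ 2 - 1) / 2)%:E * \int[gamma]_x (x ^+ 2)%:E)%E.
    rewrite -(integral_gauss_expR s0) -(Z _ d0).
    rewrite -{1}(m1 1) -intED; [|by mfun..| |]; last 2 first.
    - by move=> x; exact: expR_ge0.
    - by move=> x; rewrite mulr_ge0 ?sqr_ge0.
    apply: le_intE; [by mfun..|by []|].
    move=> x; rewrite -lerBlDr; apply: le_trans (expR_ge1Dx _); lra.
  move: H; have := intE_ge0 gamma (fun x => sqr_ge0 x).
  case: (\int[gamma]_x (x ^+ 2)%:E)%E => [r| |]; [|by rewrite ?leey|by []].
  rewrite -EFinM -EFinD !lee_fin => r0 H.
  rewrite ler_pdivrMr; last by rewrite mulr_gt0// addr_gt0.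
  have : s * 1 <= s * (s^-1 + (s ^+ 2 - 1) / 2 * r) by rewrite ler_pM2l.
  rewrite mulrDr divff ?gt_eqF// => H2.
  have : (s - 1) * 1 <= (s - 1) * (r * (s * (1 + s)) / 2) by lra.
  rewrite ler_pM2l ?subr_gt0//; lra.
move: up dn; have := intE_ge0 gamma (fun x => sqr_ge0 x).
case: (\int[gamma]_x (x ^+ 2)%:E)%E => [r| |]//; last first.
  have h1 : (0 : R) < 2^-1 by lra.
  have h2 : (2^-1 : R) < 1 by lra.
  by move=> _ /(_ _ h1 h2); rewrite leye_eq.
rewrite !lee_fin => r0 up dn; congr EFin; apply/eqP; rewrite eq_le; apply/andP; split.
- apply/ler_addgt0Pr => e e0.
  (* For [s = 1 - u] with [u <= 2^-1], [2 / (s * (1 + s)) <= 1 + 8 * u], hence the [e / 8]. The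
     lower bound uses [s = 1 + u] in the same way. *)
  pose u := Num.min (2^-1) (e / 8).
  have u0 : 0 < u by rewrite lt_min invr_gt0 ltr0n/= divr_gt0.
  have u2 : u <= 2^-1 by rewrite ge_min lexx.
  have ue : u <= e / 8 by rewrite ge_min lexx orbT.
  have s0 : 0 < 1 - u by lra.
  have s1 : 1 - u < 1 by lra.
  have := up _ s0 s1; rewrite lee_fin => H; apply: (le_trans H).
  rewrite ler_pdivrMr; last by nra.
  have : (1 + 8 * u) * ((1 - u) * (1 + (1 - u))) <= (1 + e) * ((1 - u) * (1 + (1 - u))).
    by rewrite ler_wpM2r//; nra.
  have : 0 <= u * (2^-1 - u) by rewrite mulr_ge0; lra.
  have : 0 <= u ^+ 3 by rewrite exprn_ge0// ltW.
  lra.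
- apply/ler_addgt0Pr => e e0.
  pose u := Num.min 1 (e / 8).
  have u0 : 0 < u by rewrite lt_min ltr01/= divr_gt0.
  have u2 : u <= 1 by rewrite ge_min lexx.
  have ue : u <= e / 8 by rewrite ge_min lexx orbT.
  have s1 : 1 < 1 + u by lra.
  have := dn _ s1; rewrite lee_fin => H.
  rewrite -lerBlDr; apply: le_trans H; rewrite ler_pdivlMr; last by nra.
  have : (1 - e) * ((1 + u) * (1 + (1 + u))) <= (1 - 8 * u) * ((1 + u) * (1 + (1 + u))).
    by rewrite ler_wpM2r//; nra.
  have : 0 <= u ^+ 2 by rewrite exprn_ge0// ltW.
  have : 0 <= u ^+ 3 by rewrite exprn_ge0// ltW.
  lra.
Qed.

End gaussian.

(** * Wiener increments *)

Section adapted_measurability.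
Context {R : realType} {d : measure_display} {Omega : measurableType d}.
Variables (Filt : R -> set (set Omega)).
Hypothesis HF : is_filtration Filt.

(** Passing through the generated sigma-algebra makes measurability at time [s] an instance of
    [measurable_fun], so that closure under pairs, sums and compositions comes for free. For
    [s >= 0] nothing is added to [Filt s], by [g_sigma_FiltE]. *)
Definition Fmeas d' (S : measurableType d') (s : R) (Z : Omega -> S) : Prop :=
  measurable_fun [set: g_sigma_algebraType (Filt s)]
    (Z : g_sigma_algebraType (Filt s) -> S).

Lemma g_sigma_FiltE s : 0 <= s -> <<s Filt s >> = Filt s.
Proof. by move=> s0; apply: sigma_algebra_id; case: HF => /(_ _ s0). Qed.

Lemma FmeasP d' (S : measurableType d') s (Z : Omega -> S) : 0 <= s ->
  Fmeas s Z <-> (forall A, measurable A -> Filt s (Z @^-1` A)).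
Proof.
move=> s0; split=> [mZ A mA|mZ _ A mA]; last first.
  by rewrite setTI /measurable/= g_sigma_FiltE//; exact: mZ.
have := mZ measurableT A mA; rewrite setTI /measurable/= g_sigma_FiltE//.
Qed.

Lemma Fmeas_le d' (S : measurableType d') s t (Z : Omega -> S) :
  0 <= s -> s <= t -> Fmeas s Z -> Fmeas t Z.
Proof.
move=> s0 st /(FmeasP _ s0) mZ; apply/FmeasP; first exact: le_trans st.
by move=> A mA; have [_ _ H] := HF; apply: H st _ _ => //; exact: mZ.
Qed.

Lemma Fmeas_measurable d' (S : measurableType d') s (Z : Omega -> S) :
  0 <= s -> Fmeas s Z -> measurable_fun [set: Omega] Z.
Proof.
move=> s0 /(FmeasP _ s0) mZ _ A mA; rewrite setTI.
by have [_ H _] := HF; exact: H (mZ _ mA).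
Qed.

End adapted_measurability.

Section wiener_increments.
Context {R : realType} {d : measure_display} {Omega : measurableType d}.
Variables (P : probability Omega R) (Filt : R -> set (set Omega)).
Variable (B : R -> Omega -> R).
Hypothesis HF : is_filtration Filt.
Hypothesis HB : is_wiener P Filt B.
Local Notation gamma := (normal_prob (0 : R) 1).

Lemma wiener_Fmeas s : 0 <= s -> Fmeas Filt s (B s).
Proof. by move=> s0; apply/FmeasP => //; case: HB => aB _ _ _ _; exact: aB. Qed.

Lemma wiener_increment_Fmeas s t : 0 <= s -> s <= t ->
  Fmeas Filt t (fun w => B t w - B s w).
Proof.
move=> s0 st; have t0 : 0 <= t by exact: le_trans st.
apply: measurable_funB; first exact: wiener_Fmeas.
by apply: (Fmeas_le HF s0 st); exact: wiener_Fmeas.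
Qed.

(** Replaces conditional expectation given [Filt s]. The joint law of [Z] and the increment agrees
    with a product measure on rectangles, by independence, hence everywhere; Tonelli then integrates
    the increment first. *)
Lemma expect_wiener_increment d' (S : measurableType d') (s t : R)
    (Z : Omega -> S) (Psi : S * R -> \bar R) :
  0 <= s -> s < t -> Fmeas Filt s Z ->
  measurable_fun [set: S * R] Psi -> (forall x, 0 <= Psi x)%E ->
  (\int[P]_w Psi (Z w, (B t w - B s w)%R) =
   \int[P]_w \int[gamma]_x Psi (Z w, Num.sqrt (t - s) * x)%R)%E.
Proof.
move=> s0 st mZ mPsi Psi0.
have mZ' := Fmeas_measurable HF s0 mZ.
have mD : measurable_fun [set: Omega] (fun w => B t w - B s w).
  have t0 : 0 <= t by apply: ltW; exact: le_lt_trans st.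
  exact: (Fmeas_measurable HF t0 (wiener_increment_Fmeas s0 (ltW st))).
pose D w := B t w - B s w.
pose sg := Num.sqrt (t - s).
have sg0 : 0 < sg by rewrite sqrtr_gt0 subr_gt0.
pose Zm : {mfun Omega >-> S} := HB.pack Z (isMeasurableFun.Build _ _ _ _ Z mZ').
have mD' : measurable_fun [set: Omega] (D : Omega -> measurableTypeR R) by exact mD.
have mPsi' : measurable_fun [set: S * measurableTypeR R] Psi by exact mPsi.
pose ZD : Omega -> (S * measurableTypeR R)%type := fun w => (Z w, D w).
have mZD : measurable_fun [set: Omega] ZD by exact: measurable_fun_pair.
pose m1 := distribution P Zm.
pose m2 : probability _ R := normal_prob 0 sg.
pose ZDm : {mfun Omega >-> (S * measurableTypeR R)%type} := HB.pack ZD (isMeasurableFun.Build _ _ _ _ ZD mZD).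
pose m3 := distribution P ZDm.
have E : forall A, measurable A -> (m1 \x m2)%E A = m3 A.
  apply: product_measure_unique => A C mA mC.
  rewrite /m1 /m2 /m3 /distribution /pushforward/=.
  have [_ _ _ HN HI] := HB.
  rewrite -(HN s t C s0 st mC) -(HI s t (Z @^-1` A) C s0 st _ mC)//.
  by move/(FmeasP HF _ s0) : mZ; exact.
transitivity (\int[m3]_z Psi z)%E.
  by rewrite ge0_integral_pushforward; [rewrite preimage_setT|..].
transitivity (\int[m1 \x m2]_z Psi z)%E.
  by apply: eq_measure_integral => A mA _; exact/esym/E.
rewrite fubini_tonelli1//.
transitivity (\int[m1]_z \int[gamma]_x Psi (z, sg * x)%R)%E.
  apply: eq_integral => z _; rewrite /fubini_F.
  by apply: ge0_integral_normal_probE => //; exact: measurableT_comp.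
rewrite ge0_integral_pushforward//.
- have mpair : measurable_fun [set: S * measurableTypeR R]
      (fun zx : S * measurableTypeR R => (zx.1, (sg * zx.2)%R) : S * measurableTypeR R).
    apply: measurable_fun_pair; first exact: measurable_fst.
    exact (measurableT_comp (@mulrl_measurable R setT sg) (@measurable_snd _ _ S (measurableTypeR R))).
  have mPsi2 : measurable_fun [set: S * measurableTypeR R]
      (fun zx : S * measurableTypeR R => Psi (zx.1, (sg * zx.2)%R)).
    exact (measurableT_comp mPsi' mpair).
  exact (measurable_fun_fubini_tonelli_F (m2 := gamma) _ mPsi2 (fun=> Psi0 _)).
- by move=> x _; apply: integral_ge0.
Qed.

End wiener_increments.

Section conditional_bounds.
Context {R : realType} {d : measure_display} {Omega : measurableType d}.
Variables (P : probability Omega R) (Filt : R -> set (set Omega)).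
Variable (B : R -> Omega -> R).
Hypothesis HF : is_filtration Filt.
Hypothesis HB : is_wiener P Filt B.
Local Notation gamma := (normal_prob (0 : R) 1).

Lemma measurable_gauss_integral d' (S : measurableType d') (sg : R)
    (Psi : S * R -> \bar R) :
  measurable_fun [set: S * R] Psi -> (forall x, 0 <= Psi x)%E ->
  measurable_fun [set: S] (fun z => \int[gamma]_x Psi (z, (sg * x)%R))%E.
Proof.
move=> mPsi Psi0.
have mPsi' : measurable_fun [set: S * measurableTypeR R] Psi by exact mPsi.
have mpair : measurable_fun [set: S * measurableTypeR R]
    (fun zx : S * measurableTypeR R => (zx.1, (sg * zx.2)%R) : S * measurableTypeR R).
  apply: measurable_fun_pair; first exact: measurable_fst.
  exact (measurableT_comp (@mulrl_measurable R setT sg) (@measurable_snd _ _ S (measurableTypeR R))).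
have mPsi2 : measurable_fun [set: S * measurableTypeR R]
    (fun zx : S * measurableTypeR R => Psi (zx.1, (sg * zx.2)%R)).
  exact (measurableT_comp mPsi' mpair).
exact (measurable_fun_fubini_tonelli_F (m2 := gamma) _ mPsi2 (fun=> Psi0 _)).
Qed.

Lemma expect_wiener_increment_le d' (S : measurableType d') (s t : R)
    (Z : Omega -> S) (Psi : S * R -> R) (K : S -> R) :
  0 <= s -> s < t -> Fmeas Filt s Z ->
  measurable_fun [set: S * R] Psi -> (forall x, 0 <= Psi x) ->
  measurable_fun [set: S] K ->
  (forall z, \int[gamma]_x (Psi (z, Num.sqrt (t - s) * x))%:E <= (K z)%:E)%E ->
  (\int[P]_w (Psi (Z w, B t w - B s w))%:E <= \int[P]_w (K (Z w))%:E)%E.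
Proof.
move=> s0 st mZ mPsi Psi0 mK PsiK.
have mPsiE : measurable_fun [set: S * R] (EFin \o Psi) by exact/measurable_EFinP.
have Psi0E x : (0 <= (EFin \o Psi) x)%E by rewrite lee_fin.
have mZ' := Fmeas_measurable HF s0 mZ.
rewrite (expect_wiener_increment HF HB s0 st mZ mPsiE Psi0E).
apply: ge0_le_integral => //.
- by move=> w _; apply: integral_ge0.
- exact: (measurableT_comp (measurable_gauss_integral (Num.sqrt (t - s)) mPsiE Psi0E) mZ').
- by apply/measurable_EFinP; exact: measurableT_comp.
- by move=> w _; exact: PsiK.
Qed.

(** Comparing one step with two half steps involves two increments at once. Conditioning is done at
    [t], with [Z] and the first increment as known data, then at [s]. *)
Lemma expect_two_wiener_increments_le d' (S : measurableType d') (s t u : R)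
    (Z : Omega -> S) (Psi : S * R * R -> R) (K : S -> R) (h : R) :
  0 <= s -> 0 < h -> t = s + h -> u = t + h -> Fmeas Filt s Z ->
  measurable_fun [set: S * R * R] Psi -> (forall x, 0 <= Psi x) ->
  measurable_fun [set: S] K ->
  (forall z, \int[gamma \x gamma]_x
     (Psi (z, Num.sqrt h * x.1, Num.sqrt h * x.2))%:E <= (K z)%:E)%E ->
  (\int[P]_w (Psi (Z w, B t w - B s w, B u w - B t w))%:E <=
   \int[P]_w (K (Z w))%:E)%E.
Proof.
move=> s0 h0 tE uE mZ mPsi Psi0 mK PsiK.
have st : s < t by rewrite tE ltrDl.
have t0 : 0 <= t by exact: le_trans (ltW st).
have tu : t < u by rewrite uE ltrDl.
have ts : t - s = h by rewrite tE addrC addKr.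
have ut : u - t = h by rewrite uE addrC addKr.
have mPsiE : measurable_fun [set: S * R * R] (EFin \o Psi) by exact/measurable_EFinP.
have Psi0E x : (0 <= (EFin \o Psi) x)%E by rewrite lee_fin.
have mZD : Fmeas Filt t (fun w => (Z w, B t w - B s w)).
  apply: measurable_fun_pair; first exact: (Fmeas_le HF s0 (ltW st) mZ).
  exact: (wiener_increment_Fmeas HF HB s0 (ltW st)).
rewrite (expect_wiener_increment HF HB t0 tu mZD mPsiE Psi0E) ut.
pose Psi1 zx := (\int[gamma]_x (EFin \o Psi) (zx, (Num.sqrt h * x)%R))%E.
have mPsi1 : measurable_fun [set: S * R] Psi1.
  exact: measurable_gauss_integral.
have Psi1_0 x : (0 <= Psi1 x)%E by apply: integral_ge0.
rewrite (expect_wiener_increment HF HB s0 st mZ mPsi1 Psi1_0) ts.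
have mZ' := Fmeas_measurable HF s0 mZ.
apply: ge0_le_integral => //.
- by move=> w _; apply: integral_ge0.
- exact: (measurableT_comp (measurable_gauss_integral (Num.sqrt h) mPsi1 Psi1_0) mZ').
- by apply/measurable_EFinP; exact: measurableT_comp.
move=> w _; apply: le_trans (PsiK (Z w)).
have mx : measurable_fun [set: measurableTypeR R * measurableTypeR R]
   (fun x : measurableTypeR R * measurableTypeR R =>
      (Z w, (Num.sqrt h * x.1)%R, (Num.sqrt h * x.2)%R)
      : (S * measurableTypeR R * measurableTypeR R)%type).
  apply: measurable_fun_pair; first apply: measurable_fun_pair.
  - exact: measurable_cst.
  - exact (measurableT_comp (@mulrl_measurable R setT (Num.sqrt h)) (@measurable_fst _ _ (measurableTypeR R) (measurableTypeR R))).
  - exact (measurableT_comp (@mulrl_measurable R setT (Num.sqrt h)) (@measurable_snd _ _ (measurableTypeR R) (measurableTypeR R))).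
have mPsi' : measurable_fun [set: S * measurableTypeR R * measurableTypeR R] (EFin \o Psi).
  exact mPsiE.
have mcomp := measurableT_comp mPsi' mx.
rewrite (fubini_tonelli1 _ mcomp (fun=> Psi0E _)).
exact: lexx.
Qed.

End conditional_bounds.

(** * Growth of even moments in one step *)

Section powers.
Context {R : realType}.
Implicit Types e h k w : R.

(** Each binomial term of degree at least two in [x] is dominated by [|e| ^+ (n - 2) * |x| ^+ 2] or
    by [|x| ^+ n], according to which of [|e|] and [|x|] is larger; the binomial coefficients add up
    to at most [2 ^+ n]. *)
Lemma exprD_even_le (n : nat) (e x : R) : ~~ odd n -> (1 < n)%N ->
  (e + x) ^+ n <= e ^+ n + n%:R * e ^+ n.-1 * x +
    2 ^+ n * (`|e| ^+ (n - 2) * `|x| ^+ 2 + `|x| ^+ n).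
Proof.
case: n => [//|[//|n]] nodd _.
rewrite exprDn big_ord_recl big_ord_recl.
rewrite [X in X + _](_ : _ = e ^+ n.+2); last by rewrite subn0 expr0 mulr1.
rewrite [X in _ + (X + _)](_ : _ = n.+2%:R * e ^+ n.+1 * x); last first.
  by rewrite -mulrA mulr_natl -[in RHS]mulr_natl -mulr_natl /bump expr1 bin1 subn1.
rewrite -!addrA !lerD2l.
have E : forall i : 'I_n.+1, e ^+ (n.+2 - (1 + (1 + i))) * x ^+ (1 + (1 + i)) *+ 'C(n.+2, 1 + (1 + i))
   <= (`|e| ^+ n * `|x| ^+ 2 + `|x| ^+ n.+2) *+ 'C(n.+2, 1 + (1 + i)).
  move=> i; apply: ler_wMn2r.
  apply: le_trans (ler_norm _) _; rewrite normrM !normrX.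
  have -> : (n.+2 - (1 + (1 + i)) = n - i)%N by rewrite !addnA.
  have ile : (i <= n)%N by rewrite -ltnS.
  have [ex|xe] := leP `|e| `|x|.
    apply: (@le_trans _ _ (`|x| ^+ n.+2)); last by rewrite lerDr mulr_ge0// exprn_ge0.
    have -> : (n.+2 = (n - i) + (1 + (1 + i)))%N by lia.
    by rewrite [leRHS]exprD ler_wpM2r ?exprn_ge0// lerXn2r ?nnegrE.
  apply: (@le_trans _ _ (`|e| ^+ n * `|x| ^+ 2)); last by rewrite lerDl exprn_ge0.
  have -> : (1 + (1 + i) = i + 2)%N by lia.
  rewrite exprD mulrA ler_wpM2r ?exprn_ge0//.
  have -> : `|e| ^+ n = `|e| ^+ (n - i) * `|e| ^+ i by rewrite -exprD subnK.
  by rewrite ler_wpM2l ?exprn_ge0// lerXn2r ?nnegrE// ltW.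
apply: (le_trans (ler_sum _ (fun i _ => E i))).
rewrite sumrMnr (_ : (n.+2 - 2 = n)%N); last by rewrite subn2.
rewrite -[leLHS]mulr_natl ler_wpM2r//.
rewrite -natrX ler_nat.
have -> : (2 ^ n.+2 = \sum_(i < n.+3) 'C(n.+2, i))%N.
  rewrite -[2%N]/(1 + 1)%N expnDn; apply: eq_bigr => i _.
  by rewrite !exp1n !muln1.
by rewrite big_ord_recl big_ord_recl /= addnA leq_addl.
Qed.

Lemma exprD_le_convex (n : nat) (x y : R) : 0 <= x -> 0 <= y ->
  (x + y) ^+ n.+1 <= 2 ^+ n * (x ^+ n.+1 + y ^+ n.+1).
Proof.
move=> x0 y0; elim: n => [|n IH]; first by rewrite expr0 mul1r !expr1.
rewrite exprS; apply: (le_trans (ler_wpM2l (addr_ge0 x0 y0) IH)).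
(* The two factors have the same sign: this is Chebyshev's sum inequality for two terms. *)
have H : 0 <= (x - y) * (x ^+ n.+1 - y ^+ n.+1).
  have [xy|yx] := leP x y.
    by apply: mulr_le0; rewrite subr_le0// lerXn2r ?nnegrE.
  by apply: mulr_ge0; rewrite subr_ge0 ?(ltW yx)// lerXn2r ?nnegrE// ltW.
have -> : (x + y) * (2 ^+ n * (x ^+ n.+1 + y ^+ n.+1)) =
  2 ^+ n * ((x + y) * (x ^+ n.+1 + y ^+ n.+1)) by ring.
have -> : 2 ^+ n.+1 * (x ^+ n.+2 + y ^+ n.+2) = 2 ^+ n * (2 * (x ^+ n.+2 + y ^+ n.+2)) :> R.
  by rewrite (exprSr 2); ring.
rewrite ler_wpM2l ?exprn_ge0// -subr_ge0.
by rewrite (_ : _ - _ = (x - y) * (x ^+ n.+1 - y ^+ n.+1))// (exprS x n.+1) (exprS y n.+1); ring.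
Qed.

(** The exponent [n.-1], and not [n], is essential in [rk_scheme_refine]: it is what keeps the
    constant unchanged under halving. *)
Lemma exprD_even_le_convex (n : nat) (x y : R) : ~~ odd n -> (0 < n)%N ->
  (x + y) ^+ n <= 2 ^+ n.-1 * (x ^+ n + y ^+ n).
Proof.
move=> nodd n0; case: n nodd n0 => // n nodd _ /=.
have E (z : R) : z ^+ n.+1 = `|z| ^+ n.+1.
  by rewrite -normrX ger0_norm// exprn_even_ge0.
rewrite (E x) (E y) (E (x + y)); apply: le_trans (exprD_le_convex _ (normr_ge0 x) (normr_ge0 y)).
by rewrite lerXn2r ?nnegrE ?addr_ge0// ler_normD.
Qed.

Lemma exprD_le (n : nat) (x y : R) : 0 <= x -> 0 <= y ->
  (x + y) ^+ n <= 2 ^+ n * (x ^+ n + y ^+ n).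
Proof.
case: n => [|n] x0 y0; first by rewrite !expr0; lra.
apply: (le_trans (exprD_le_convex n x0 y0)).
rewrite ler_wpM2r ?addr_ge0 ?exprn_ge0// exprS; have := exprn_ge0 n (ler0n R 2); lra.
Qed.

(** The summand [n] comes from the drift in the linear term of [exprD_even_le]; [4] and [2 ^+ n]
    come from [|m + z| <= 2 * (sqrt h * a * w)], with [a = |e| + k], raised to the powers [2] and
    [n]. *)
Definition step_const (n : nat) : R := n%:R + 2 ^+ n * (4 + 2 ^+ n).

Lemma step_const_ge0 n : 0 <= step_const n.
Proof. by rewrite addr_ge0// mulr_ge0// ?addr_ge0// exprn_ge0. Qed.

(** Only the term linear in [z] is of order [sqrt h]. It is kept exactly, to be integrated to zero;
    everything else is of order [h]. *)
Lemma step_pointwise (n : nat) (h e k w m z : R) : ~~ odd n -> (1 < n)%N ->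
  0 <= h <= 1 -> 0 <= k -> 1 <= w ->
  `|m| <= h * (`|e| + k) * w -> `|z| <= Num.sqrt h * (`|e| + k) * w ->
  (e + (m + z)) ^+ n <= e ^+ n + n%:R * e ^+ n.-1 * z +
    step_const n * (h * (`|e| + k) ^+ n) * w ^+ n.
Proof.
move=> nodd n1 /andP[h0 h1] k0 w1 mle zle.
have w0 : 0 <= w by apply: le_trans w1.
set a := `|e| + k; have a0 : 0 <= a by rewrite addr_ge0.
have ea : `|e| <= a by rewrite lerDl.
have hs : h <= Num.sqrt h.
  rewrite -{1}(sqr_sqrtr h0) expr2 ler_piMl ?sqrtr_ge0//.
  by rewrite -[leRHS]sqrtr1 ler_wsqrtr.
have zm : `|m + z| <= 2 * (Num.sqrt h * a * w).
  apply: (le_trans (ler_normD _ _)).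
  have : h * a * w <= Num.sqrt h * a * w by rewrite ler_wpM2r// ler_wpM2r.
  by move: mle zle; rewrite -/a; lra.
have b0 : 0 <= 2 * (Num.sqrt h * a * w) by rewrite !mulr_ge0// sqrtr_ge0.
apply: (le_trans (exprD_even_le e (m + z) nodd n1)).
rewrite -addrA -[leRHS]addrA lerD2l mulrDr -addrA addrC -!addrA lerD2l.
have X2 : `|m + z| ^+ 2 <= 4 * (h * a ^+ 2 * w ^+ n).
  apply: (@le_trans _ _ ((2 * (Num.sqrt h * a * w)) ^+ 2)).
    by rewrite lerXn2r ?nnegrE.
  rewrite !exprMn sqr_sqrtr//.
  have : w ^+ 2 <= w ^+ n by rewrite ler_weXn2l.
  move=> H; have : h * a ^+ 2 * w ^+ 2 <= h * a ^+ 2 * w ^+ n.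
    by rewrite ler_wpM2l// mulr_ge0// exprn_ge0.
  by lra.
have Xn : `|m + z| ^+ n <= 2 ^+ n * (h * a ^+ n * w ^+ n).
  apply: (@le_trans _ _ ((2 * (Num.sqrt h * a * w)) ^+ n)).
    by rewrite lerXn2r ?nnegrE.
  rewrite !exprMn ler_wpM2l ?exprn_ge0// ler_wpM2r ?exprn_ge0// ler_wpM2r ?exprn_ge0//.
  have -> : n = (2 + (n - 2))%N by rewrite subnKC.
  rewrite exprD sqr_sqrtr// ler_piMr// exprn_ile1 ?sqrtr_ge0//.
  by rewrite -[leRHS]sqrtr1 ler_wsqrtr.
have an : a ^+ n = a ^+ (n - 2) * a ^+ 2 by rewrite -exprD subnK.
have an1 : a ^+ n = a ^+ n.-1 * a by rewrite -exprSr prednK// ltnW.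
have M : n%:R * e ^+ n.-1 * m <= n%:R * (h * a ^+ n * w ^+ n).
  rewrite -mulrA ler_wpM2l//.
  apply: (le_trans (ler_norm _)); rewrite normrM normrX.
  apply: (@le_trans _ _ (a ^+ n.-1 * (h * a * w))).
    by rewrite ler_pM ?exprn_ge0// lerXn2r ?nnegrE.
  have -> : a ^+ n.-1 * (h * a * w) = h * a ^+ n * w by rewrite an1; ring.
  rewrite ler_wpM2l ?mulr_ge0 ?exprn_ge0// -{1}(expr1 w) ler_weXn2l//.
  exact: ltnW.
have EX : 2 ^+ n * (`|e| ^+ (n - 2) * `|m + z| ^+ 2) <= 2 ^+ n * (4 * (h * a ^+ n * w ^+ n)).
  rewrite ler_wpM2l ?exprn_ge0//.
  apply: (@le_trans _ _ (a ^+ (n - 2) * (4 * (h * a ^+ 2 * w ^+ n)))).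
    by rewrite ler_pM ?exprn_ge0// lerXn2r ?nnegrE.
  by rewrite an; lra.
have EX2 : 2 ^+ n * `|m + z| ^+ n <= 2 ^+ n * (2 ^+ n * (h * a ^+ n * w ^+ n)).
  by rewrite ler_wpM2l ?exprn_ge0.
rewrite /step_const; lra.
Qed.

(* e is the current error, m and z are the drift part and the centred part of
   its increment, and k is the size of the local error *)
Lemma step_integral d (T : measurableType d) (nu : {measure set T -> \bar R})
   (n : nat) (h e k C : R) (w m z : T -> R) :
  nu setT = 1%E -> ~~ odd n -> (1 < n)%N ->
  0 <= h <= 1 -> 0 <= k -> (forall x, 1 <= w x) ->
  (forall x, `|m x| <= h * (`|e| + k) * w x) ->
  (forall x, `|z x| <= Num.sqrt h * (`|e| + k) * w x) ->
  measurable_fun [set: T] w -> measurable_fun [set: T] m ->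
  measurable_fun [set: T] z ->
  (\int[nu]_x (w x ^+ n)%:E <= C%:E)%E ->
  (\int[nu]_x (z x)%:E = 0)%E ->
  (\int[nu]_x ((e + (m x + z x)) ^+ n)%:E <=
   ((1 + 2 ^+ n * step_const n * C * h) * e ^+ n +
     2 ^+ n * step_const n * C * h * k ^+ n)%:E)%E.
Proof.
move=> nu1 nodd n1 h01 k0 w1 mle zle mw mm mz wC z0.
have h0 : 0 <= h by case/andP : h01.
have w0 x : 0 <= w x by apply: le_trans (w1 x).
pose a := `|e| + k; have a0 : 0 <= a by rewrite addr_ge0.
have mwn : measurable_fun [set: T] (fun x => w x ^+ n) by mfun.
have iw : nu.-integrable setT (fun x => (w x ^+ n)%:E).
  apply/integrableP; split; first exact/measurable_EFinP.
  under eq_integral do rewrite gee0_abs ?lee_fin ?exprn_ge0//.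
  exact: le_lt_trans wC (ltry _).
have iz : nu.-integrable setT (fun x => (z x)%:E).
  apply: (@le_integrable _ _ _ _ _ measurableT _ (fun x => (Num.sqrt h * a)%:E * (w x ^+ n)%:E)%E).
  - exact/measurable_EFinP.
  - move=> x _; rewrite abse_EFin -EFinM abse_EFin lee_fin.
    apply: (le_trans (zle x)); apply: le_trans (ler_norm _).
    rewrite ler_wpM2l ?mulr_ge0 ?sqrtr_ge0//.
    by rewrite -{1}(expr1 (w x)) ler_weXn2l// ltnW.
  - exact: integrableZl.
pose c1 := n%:R * e ^+ n.-1; pose c2 := step_const n * (h * a ^+ n).
have c20 : 0 <= c2 by rewrite mulr_ge0 ?step_const_ge0// mulr_ge0// exprn_ge0.
have P x : (e + (m x + z x)) ^+ n <= e ^+ n + c1 * z x + c2 * w x ^+ n.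
  exact: step_pointwise.
apply: (@le_trans _ _ (\int[nu]_x (((e ^+ n)%:E + c1%:E * (z x)%:E) + c2%:E * (w x ^+ n)%:E))%E).
  apply: ge0_le_integral => //.
  - by move=> x _; rewrite lee_fin exprn_even_ge0.
  - by apply/measurable_EFinP; mfun.
  - by apply/measurable_EFinP; mfun.
  - by move=> x _; rewrite -!EFinM -!EFinD lee_fin.
have ic : nu.-integrable setT (fun x : T => (e ^+ n)%:E).
  apply/integrableP; split; first by apply/measurable_EFinP; mfun.
  by rewrite integral_cst// nu1 mule1 ltry.
have iz1 : nu.-integrable setT (fun x : T => c1%:E * (z x)%:E)%E by exact: integrableZl.
have iw1 : nu.-integrable setT (fun x : T => c2%:E * (w x ^+ n)%:E)%E by exact: integrableZl.
rewrite (integralD measurableT _ iw1); last exact: integrableD.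
rewrite (integralD measurableT ic iz1) (integralZl measurableT iz) z0 mule0 adde0.
rewrite intE_cst// (integralZl measurableT iw).
apply: (@le_trans _ _ ((e ^+ n)%:E + c2%:E * C%:E)%E).
  by rewrite leeD2l// lee_wpmul2l// lee_fin.
rewrite -EFinM -EFinD lee_fin mulrDl mul1r -addrA lerD2l.
have C0 : 0 <= C.
  by rewrite -lee_fin; apply: le_trans wC; apply: intE_ge0 => x; rewrite exprn_ge0.
have : a ^+ n <= 2 ^+ n * (e ^+ n + k ^+ n).
  apply: (le_trans (exprD_le n (normr_ge0 e) k0)).
  by rewrite -normrX ger0_norm// exprn_even_ge0.
move=> H.
have : step_const n * C * h * a ^+ n <= step_const n * C * h * (2 ^+ n * (e ^+ n + k ^+ n)).
  by rewrite ler_wpM2l// !mulr_ge0// step_const_ge0.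
rewrite /c2; lra.
Qed.

End powers.

(** * A discrete Gronwall inequality *)

Section gronwall.
Context {R : realType}.

(** With values in the extended reals, no finiteness of the moments has to be known in advance; it
    is part of the conclusion. *)
Lemma discrete_gronwall (E : nat -> \bar R) (N : nat) (ch e0 K : R) :
  0 <= ch -> 0 <= e0 -> 0 <= K -> (E 0%N <= e0%:E)%E ->
  (forall n, (n < N)%N -> (E n.+1 <= (1 + ch)%:E * E n + (ch * K)%:E)%E) ->
  forall n, (n <= N)%N -> (E n <= (expR (n%:R * ch) * (e0 + K))%:E)%E.
Proof.
move=> ch0 e00 K0 E0 ES.
(* [- K] is the fixed point of the affine recursion, so that [E n + K] grows geometrically. *)
have H n : (n <= N)%N -> (E n <= ((1 + ch) ^+ n * (e0 + K) - K)%:E)%E.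
  elim: n => [_|n IH nN]; first by rewrite expr0 mul1r addrK.
  apply: (le_trans (ES _ nN)).
  have c1 : (0 <= (1 + ch)%:E)%E by rewrite lee_fin addr_ge0.
  apply: (@le_trans _ _ ((1 + ch)%:E * ((1 + ch) ^+ n * (e0 + K) - K)%:E + (ch * K)%:E)%E).
    by rewrite leeD2r// lee_wpmul2l//; apply: IH; exact: ltnW.
  by rewrite -EFinM -EFinD lee_fin exprS; lra.
move=> n nN; apply: (le_trans (H _ nN)); rewrite lee_fin.
apply: (@le_trans _ _ ((1 + ch) ^+ n * (e0 + K))); first by rewrite gerBl.
rewrite ler_wpM2r ?addr_ge0// expRM_natl.
by rewrite lerXn2r ?nnegrE ?addr_ge0 ?expR_ge0// expR_ge1Dx.
Qed.

End gronwall.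

(** * Moments and centred polynomials of Gaussian variables *)

Section gaussian_polynomials.
Context {R : realType}.
Local Notation gamma := (normal_prob (0 : R) 1).

(** The weight [1 + x ^+ 2] serves everywhere as a common bound for [1], [|x|] and
    [|x ^+ 2 - 1|]. *)
Lemma sqr1_ge1 (x : R) : 1 <= 1 + x ^+ 2.
Proof. by rewrite lerDl sqr_ge0. Qed.

Lemma sqr1_ge0 (x : R) : 0 <= 1 + x ^+ 2.
Proof. exact: le_trans (sqr1_ge1 x). Qed.

Lemma norm_le_sqr1 (x : R) : `|x| <= 1 + x ^+ 2.
Proof. by rewrite -real_normK ?num_real//; have := normr_ge0 x; nra. Qed.

Lemma normB1_le_sqr1 (x : R) : `|x ^+ 2 - 1| <= 1 + x ^+ 2.
Proof. by rewrite ler_norml; have := sqr_ge0 x; lra. Qed.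

Lemma sqr1X_le_expR (n : nat) (t : R) : 0 < t ->
  exists2 K : R, 0 <= K & forall x : R, (1 + x ^+ 2) ^+ n <= K * expR (t * x ^+ 2).
Proof.
move=> t0; case: n => [|n].
  exists 1 => // x; rewrite expr0 mul1r -[leLHS]expR0 ler_expR mulr_ge0 ?sqr_ge0//.
  exact: ltW.
have t1 : 0 < t / n.+1%:R by rewrite divr_gt0.
exists ((t / n.+1%:R)^-1 ^+ n.+1 * expR t).
  by rewrite mulr_ge0 ?expR_ge0// exprn_ge0// invr_ge0 ltW.
move=> x; set s := t / n.+1%:R in t1 *.
have : 1 + x ^+ 2 <= s^-1 * expR (s * (1 + x ^+ 2)).
  rewrite ler_pdivlMl//; apply: le_trans (expR_ge1Dx _).
  by rewrite lerDr.
move=> H; apply: (@le_trans _ _ ((s^-1 * expR (s * (1 + x ^+ 2))) ^+ n.+1)).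
  by rewrite lerXn2r ?nnegrE ?sqr1_ge0 ?mulr_ge0 ?expR_ge0 ?invr_ge0 ?(ltW t1).
have -> : expR (t * x ^+ 2) = expR (t * (1 + x ^+ 2)) / expR t.
  by rewrite -expRN -expRD; congr expR; ring.
rewrite mulrA mulrAC (mulrAC _ (expR t)) -!mulrA divff ?gt_eqF ?expR_gt0// mulr1.
rewrite exprMn -expRM_natl ler_wpM2l ?exprn_ge0 ?invr_ge0 ?(ltW t1)//.
by rewrite (mulrA t) mulrCA divff ?mulr1// pnatr_eq0.
Qed.

Lemma gauss_expR_moment : exists2 C : R, 0 <= C &
  (\int[gamma]_x (expR (4^-1 * x ^+ 2))%:E <= C%:E)%E.
Proof.
have s20 : 0 < Num.sqrt (2^-1 : R) by rewrite sqrtr_gt0 invr_gt0.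
exists (Num.sqrt 2^-1)^-1; first by rewrite invr_ge0 ltW.
rewrite -(integral_gauss_expR s20); apply: le_intE; [by mfun..| |].
- by move=> x; exact: expR_ge0.
- by move=> x; rewrite ler_expR sqr_sqrtr ?invr_ge0//; lra.
Qed.

Lemma gauss_sqr1_moment (n : nat) : exists2 C : R, 0 <= C &
  (\int[gamma]_x ((1 + x ^+ 2) ^+ n)%:E <= C%:E)%E.
Proof.
have t0 : 0 < (4^-1 : R) by rewrite invr_gt0.
have [K K0 HK] := sqr1X_le_expR n t0; have [C C0 HC] := gauss_expR_moment.
exists (K * C); first exact: mulr_ge0.
apply: (@le_trans _ _ (\int[gamma]_x (K * expR (4^-1 * x ^+ 2))%:E)%E).
  by apply: le_intE => //; [mfun|mfun|move=> x; rewrite exprn_ge0 ?sqr1_ge0].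
rewrite intEZ//; last by mfun.
by rewrite EFinM lee_wpmul2l.
Qed.

Lemma gauss_poly_integrable (n : nat) (K : R) (f : R -> R) : 0 <= K ->
  measurable_fun [set: R] f -> (forall x, `|f x| <= K * (1 + x ^+ 2) ^+ n) ->
  gamma.-integrable setT (EFin \o f).
Proof.
move=> K0 mf fK.
have t0 : 0 < (4^-1 : R) by rewrite invr_gt0.
have [K' K'0 HK'] := sqr1X_le_expR n t0.
apply: (gauss_integrable (K := K * K') mf) => x; apply: (le_trans (fK x)).
rewrite -mulrA ler_wpM2l// (le_trans (HK' x))//.
by rewrite (_ : 4^-1 * x ^+ 2 = x ^+ 2 / 4)// mulrC.
Qed.

(** The noise of each one-step difference below is a combination of [x], [x ^+ 2 - 1] and [x ^+ 3];
    this shows that it is centred. The odd powers vanish by symmetry. *)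
Lemma gauss_cubic (al be th et : R) :
  (\int[gamma]_x (al + be * x + th * (x ^+ 2 - 1) + et * x ^+ 3)%:E = al%:E)%E.
Proof.
have nx n : forall x : R, `|x ^+ n| <= 1 * (1 + x ^+ 2) ^+ n.
  move=> x; rewrite mul1r normrX lerXn2r ?nnegrE ?sqr1_ge0//.
  exact: norm_le_sqr1.
have ix n : gamma.-integrable setT (fun x : R => (x ^+ n)%:E).
  by apply: (gauss_poly_integrable (n := n) (K := 1)) => //; mfun.
have i1 : gamma.-integrable setT (fun x : R => (al - th)%:E).
  apply: (gauss_poly_integrable (n := 0%N) (K := `|al - th|)) => //.
  by move=> x; rewrite expr0 mulr1.
have iZ n (c : R) : gamma.-integrable setT (fun x : R => c%:E * (x ^+ n)%:E)%E.
  exact: integrableZl.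
have t0 : 0 < (4^-1 : R) by rewrite invr_gt0.
have oddn n : odd n -> (\int[gamma]_x (x ^+ n)%:E = 0)%E.
  move=> on; have [K K0 HK] := sqr1X_le_expR n t0.
  apply: (Rintegral_gauss_odd (K := K)) => //.
  - move=> x; rewrite (le_trans (nx n x))// mul1r (le_trans (HK x))//.
    by rewrite (_ : 4^-1 * x ^+ 2 = x ^+ 2 / 4)// mulrC.
  - by move=> x; rewrite exprNn -signr_odd on expr1 mulN1r.
transitivity (\int[gamma]_x ((al - th)%:E + be%:E * (x ^+ 1)%:E +
    (th%:E * (x ^+ 2)%:E + et%:E * (x ^+ 3)%:E)))%E.
  apply: eq_integral => x _; rewrite -!EFinM -!EFinD; congr EFin; ring.
rewrite integralD//; [|exact: integrableD..].
rewrite integralD//; rewrite integralD//.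
rewrite !integralZl// (oddn 1%N)// (oddn 3%N)// integral_gauss_sqr !mule0 adde0 mule1 adde0.
rewrite intE_cst; last exact: probability_setT.
by rewrite -EFinD subrK.
Qed.

End gaussian_polynomials.

Section gaussian_pairs.
Context {R : realType}.
Local Notation gamma := (normal_prob (0 : R) 1).
Local Notation RR := (measurableTypeR R * measurableTypeR R)%type.

Lemma measurable_pair_fst (f : R -> R) : measurable_fun [set: R] f ->
  measurable_fun [set: RR] (fun x : RR => f x.1).
Proof.
by move=> mf; exact (measurableT_comp mf (@measurable_fst _ _ (measurableTypeR R) (measurableTypeR R))).
Qed.

Lemma measurable_pair_snd (f : R -> R) : measurable_fun [set: R] f ->
  measurable_fun [set: RR] (fun x : RR => f x.2).
Proof.
by move=> mf; exact (measurableT_comp mf (@measurable_snd _ _ (measurableTypeR R) (measurableTypeR R))).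
Qed.

Lemma gauss_pair_setT : (gamma \x gamma)%E [set: RR] = 1%E.
Proof.
by rewrite -setXTT product_measure1E//= [X in (X * _)%E]probability_setT mul1e probability_setT.
Qed.

Lemma gauss_pair_moment (n : nat) : exists2 C : R, 0 <= C &
  (\int[gamma \x gamma]_x (((1 + x.1 ^+ 2) * (1 + x.2 ^+ 2)) ^+ n)%:E <= C%:E)%E.
Proof.
have [C C0 HC] := gauss_sqr1_moment (R := R) n.
exists (C * C); first exact: mulr_ge0.
pose f (x : RR) := (((1 + x.1 ^+ 2) * (1 + x.2 ^+ 2)) ^+ n)%:E : \bar R.
have mv : measurable_fun [set: R] (fun x : R => 1 + x ^+ 2) by mfun.
have mf : measurable_fun [set: RR] f.
  apply/measurable_EFinP; apply: measurable_funX; apply: measurable_funM.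
  - exact: (measurable_pair_fst mv).
  - exact: (measurable_pair_snd mv).
have f0 x : (0 <= f x)%E by rewrite lee_fin exprn_ge0// mulr_ge0// sqr1_ge0.
rewrite (fubini_tonelli1 f mf f0) /fubini_F /f /=.
have mvn : measurable_fun [set: R] (fun x : R => (1 + x ^+ 2) ^+ n) by mfun.
have E (x : R) : (\int[gamma]_y (((1 + x ^+ 2) * (1 + y ^+ 2)) ^+ n)%:E =
   ((1 + x ^+ 2) ^+ n)%:E * \int[gamma]_y ((1 + y ^+ 2) ^+ n)%:E)%E.
  rewrite -intEZ//; [|by move=> y; rewrite exprn_ge0// sqr1_ge0|by rewrite exprn_ge0// sqr1_ge0].
  by apply: eq_integral => y _; rewrite exprMn.
under eq_integral do rewrite E.
rewrite ge0_integralZr//; last 3 first.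
- exact/measurable_EFinP.
- by move=> x _; rewrite lee_fin exprn_ge0// sqr1_ge0.
- by apply: intE_ge0 => x; rewrite exprn_ge0// sqr1_ge0.
rewrite EFinM; apply: lee_pmul => //; apply: intE_ge0 => x;
  by rewrite exprn_ge0// sqr1_ge0.
Qed.

(** Integrating the second variable first kills the terms of [A1] and [A2], whatever these functions
    are, and leaves [A0]. The polynomial bound gives the integrability that Fubini requires. *)
Lemma gauss_pair_centered (n : nat) (K : R) (A0 A1 A2 : R -> R) :
  0 <= K -> measurable_fun [set: R] A0 -> measurable_fun [set: R] A1 ->
  measurable_fun [set: R] A2 -> (\int[gamma]_x (A0 x)%:E = 0)%E ->
  (forall x y, `|A0 x + A1 x * y + A2 x * (y ^+ 2 - 1)| <=
     K * ((1 + x ^+ 2) * (1 + y ^+ 2)) ^+ n) ->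
  (\int[gamma \x gamma]_x (A0 x.1 + A1 x.1 * x.2 + A2 x.1 * (x.2 ^+ 2 - 1))%:E = 0)%E.
Proof.
move=> K0 m0 m1 m2 I0 bnd.
pose f (x : RR) := (A0 x.1 + A1 x.1 * x.2 + A2 x.1 * (x.2 ^+ 2 - 1))%:E : \bar R.
have mid : measurable_fun [set: R] (fun x : R => x) by mfun.
have msq : measurable_fun [set: R] (fun x : R => x ^+ 2 - 1) by mfun.
have mf : measurable_fun [set: RR] f.
  apply/measurable_EFinP; apply: measurable_funD; first apply: measurable_funD.
  - exact: (measurable_pair_fst m0).
  - apply: measurable_funM; first exact: (measurable_pair_fst m1).
    exact: (measurable_pair_snd mid).
  - apply: measurable_funM; first exact: (measurable_pair_fst m2).
    exact: (measurable_pair_snd msq).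
have [C C0 HC] := gauss_pair_moment n.
have mv : measurable_fun [set: R] (fun x : R => 1 + x ^+ 2) by mfun.
have mvv : measurable_fun [set: RR] (fun x : RR => ((1 + x.1 ^+ 2) * (1 + x.2 ^+ 2)) ^+ n).
  apply: measurable_funX; apply: measurable_funM.
  - exact: (measurable_pair_fst mv).
  - exact: (measurable_pair_snd mv).
have intf : (gamma \x gamma)%E.-integrable setT f.
  apply/integrableP; split => //.
  apply: (@le_lt_trans _ _ (K * C)%:E); last exact: ltry.
  apply: (@le_trans _ _ (\int[gamma \x gamma]_x
     (K * ((1 + x.1 ^+ 2) * (1 + x.2 ^+ 2)) ^+ n)%:E)%E).
    apply: ge0_le_integral => //.
    - exact: measurableT_comp.
    - by apply/measurable_EFinP; mfun.
    - by move=> x _; rewrite abse_EFin lee_fin; exact: bnd.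
  rewrite intEZ//.
    by rewrite EFinM lee_wpmul2l.
  by move=> x; rewrite exprn_ge0// mulr_ge0// sqr1_ge0.
rewrite -(integral12_prod_meas1 intf) /fubini_F /f /=.
rewrite -[RHS]I0; apply: eq_integral => x _.
rewrite -[RHS](gauss_cubic (A0 x) (A1 x) (A2 x) 0).
by apply: eq_integral => y _; rewrite mul0r addr0.
Qed.

End gaussian_pairs.

(** * The derivative-free Milstein step *)

(** What survives of class C^2 with bounded derivatives after odd extension: the second derivative
    may jump at [0], while the first order expansion keeps a quadratic remainder. *)
Record lipschitz_diff {R : realType} (L : R) (a a' : R -> R) : Prop := LipschitzDiff {
  ld_ge1 : 1 <= L ;
  ld_0 : a 0 = 0 ;
  ld_lip : forall x y, `|a x - a y| <= L * `|x - y| ;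
  ld_taylor : forall x y, `|a y - a x - a' x * (y - x)| <= L * (y - x) ^+ 2 ;
  ld_bound : forall x, `|a' x| <= L ;
  ld_lip' : forall x y, `|a' x - a' y| <= L * `|x - y| }.

Section rk_milstein.
Context {R : realType}.
Implicit Types h x y z s e : R.

Lemma norm_leM (x y X Y : R) : `|x| <= X -> `|y| <= Y -> `|x * y| <= X * Y.
Proof. by move=> xX yY; rewrite normrM ler_pM. Qed.

Lemma norm_leD (x y X Y : R) : `|x| <= X -> `|y| <= Y -> `|x + y| <= X + Y.
Proof. by move=> xX yY; apply: (le_trans (ler_normD _ _)); rewrite lerD. Qed.

Lemma norm_leN (x X : R) : `|x| <= X -> `|- x| <= X.
Proof. by rewrite normrN. Qed.

Definition rk_slope (b : R -> R) h y := (b (y + Num.sqrt h * b y) - b y) / Num.sqrt h.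

Definition rk_step (a b : R -> R) h y dB :=
  y + a y * h + b y * dB + 2^-1 * rk_slope b h y * (dB ^+ 2 - h).

Variables (a a' b b' : R -> R) (L : R).
Hypothesis (Ha : lipschitz_diff L a a') (Hb : lipschitz_diff L b b').

Let L1 : 1 <= L := ld_ge1 Hb.
Let L0 : 0 <= L. Proof. exact: le_trans L1. Qed.
Let LX n : 0 <= L ^+ n. Proof. exact: exprn_ge0. Qed.

Lemma ld_norm (c c' : R -> R) x : lipschitz_diff L c c' -> `|c x| <= L * `|x|.
Proof. by move=> Hc; have := ld_lip Hc x 0; rewrite (ld_0 Hc) !subr0. Qed.

Lemma continuous_lipschitz (c : R -> R) (K : R) :
  (forall x y, `|c x - c y| <= K * `|x - y|) -> continuous c.
Proof.
move=> H x; apply/cvgrPdist_le => /= e e0.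
have K1 : 0 < `|K| + 1 by rewrite ltr_wpDl.
apply/nbhs_ballP; exists (e / (`|K| + 1)) => /=; first by rewrite divr_gt0.
move=> y; rewrite /ball/= => xy; apply: (le_trans (H x y)).
apply: (@le_trans _ _ ((`|K| + 1) * `|x - y|)).
  by rewrite ler_wpM2r// (le_trans (ler_norm _))// lerDl.
by rewrite -ler_pdivlMl// mulrC ltW.
Qed.

Lemma measurable_lipschitz (c : R -> R) K : (forall x y, `|c x - c y| <= K * `|x - y|) ->
  measurable_fun [set: R] c.
Proof. by move=> Hc; apply: continuous_measurable_fun; exact: continuous_lipschitz Hc. Qed.

Lemma rk_slope_bound h y : 0 < h -> `|rk_slope b h y| <= L ^+ 2 * `|y|.
Proof.
move=> h0; have s0 : 0 < Num.sqrt h by rewrite sqrtr_gt0.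
rewrite /rk_slope normrM normfV (gtr0_norm s0) ler_pdivrMr//.
apply: (le_trans (ld_lip Hb _ _)).
rewrite addrC addKr normrM (gtr0_norm s0) expr2 -!mulrA ler_wpM2l//.
by rewrite mulrC [leRHS]mulrA ler_wpM2r ?(ltW s0)//; exact: ld_norm Hb.
Qed.

(** The stability that [b' b] lacks. Dividing by [sqrt h] costs one factor [sqrt h]; since the slope
    enters a step with weight [h], a contribution of order [sqrt h * |z - y|] remains, which is
    admissible because it is centred. *)
Lemma rk_slope_lip h y z : 0 < h <= 1 ->
  Num.sqrt h * `|rk_slope b h z - rk_slope b h y| <= 3 * L ^+ 2 * `|z - y|.
Proof.
move=> /andP[h0 h1]; have s0 : 0 < Num.sqrt h by rewrite sqrtr_gt0.
have s1 : Num.sqrt h <= 1 by rewrite -[leRHS]sqrtr1 ler_wsqrtr.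
have -> : Num.sqrt h * `|rk_slope b h z - rk_slope b h y| =
   `|b (z + Num.sqrt h * b z) - b (y + Num.sqrt h * b y) - (b z - b y)|.
  rewrite -[X in X * _](gtr0_norm s0) -normrM /rk_slope -mulrBl mulrC divfK ?gt_eqF//.
  by congr `|_|; ring.
have Hz := ld_lip Hb z y.
have H1 : `|z + Num.sqrt h * b z - (y + Num.sqrt h * b y)| <= (1 + L) * `|z - y|.
  have -> : z + Num.sqrt h * b z - (y + Num.sqrt h * b y) = (z - y) + Num.sqrt h * (b z - b y) by ring.
  rewrite mulrDl mul1r; apply: norm_leD => //.
  rewrite normrM (gtr0_norm s0); apply: le_trans Hz.
  by rewrite ler_piMl.
have H2 : `|b (z + Num.sqrt h * b z) - b (y + Num.sqrt h * b y)| <= L * ((1 + L) * `|z - y|).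
  by apply: (le_trans (ld_lip Hb _ _)); rewrite ler_wpM2l.
apply: (le_trans (norm_leD H2 (norm_leN Hz))).
rewrite mulrA -mulrDl ler_wpM2r//; have := L1; nra.
Qed.

(** The Taylor remainder for the increment [sqrt h * b y] is quadratic in [y]: this is the origin of
    the local errors [h * (1 + y ^+ 2)]. *)
Lemma rk_slope_approx h y : 0 < h ->
  `|rk_slope b h y - b' y * b y| <= L ^+ 3 * y ^+ 2 * Num.sqrt h.
Proof.
move=> h0; have s0 : 0 < Num.sqrt h by rewrite sqrtr_gt0.
have -> : rk_slope b h y - b' y * b y =
   (b (y + Num.sqrt h * b y) - b y - b' y * (y + Num.sqrt h * b y - y)) / Num.sqrt h.
  by rewrite /rk_slope; field; rewrite gt_eqF.
rewrite normrM normfV (gtr0_norm s0) ler_pdivrMr//.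
apply: (le_trans (ld_taylor Hb _ _)).
have B2 : b y ^+ 2 <= L ^+ 2 * y ^+ 2.
  rewrite -exprMn -ler_sqrt ?sqr_ge0// !sqrtr_sqr normrM (ger0_norm L0).
  exact: ld_norm Hb.
have ss : Num.sqrt h ^+ 2 = h by rewrite sqr_sqrtr ?(ltW h0).
have -> : L * (y + Num.sqrt h * b y - y) ^+ 2 = L * h * b y ^+ 2.
  by rewrite -[in RHS]ss; ring.
have -> : L ^+ 3 * y ^+ 2 * Num.sqrt h * Num.sqrt h = L * h * (L ^+ 2 * y ^+ 2).
  by rewrite -[in RHS]ss; ring.
by rewrite ler_wpM2l// mulr_ge0// ltW.
Qed.

Lemma rk_step_scaled h y x : 0 <= h -> rk_step a b h y (Num.sqrt h * x) =
  y + (a y * h + (Num.sqrt h * b y * x + 2^-1 * h * rk_slope b h y * (x ^+ 2 - 1))).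
Proof. by move=> h0; rewrite /rk_step exprMn sqr_sqrtr//; ring. Qed.

Lemma sqrt_le1 h : 0 < h <= 1 -> [/\ 0 < Num.sqrt h, Num.sqrt h <= 1, h <= Num.sqrt h &
  Num.sqrt h * Num.sqrt h = h].
Proof.
move=> /andP[h0 h1]; have s0 : 0 < Num.sqrt h by rewrite sqrtr_gt0.
have s1 : Num.sqrt h <= 1 by rewrite -[leRHS]sqrtr1 ler_wsqrtr.
have ss : Num.sqrt h * Num.sqrt h = h by rewrite -expr2 sqr_sqrtr// ltW.
by split => //; rewrite -{1}ss ler_piMl// ltW.
Qed.

(** All coefficients vanish at [0], so that the increment is bounded relatively to [|y|] and
    [step_integral] applies with [k = 0]. *)
Lemma rk_step_moment (n : nat) : ~~ odd n -> (1 < n)%N ->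
  exists2 C : R, 0 <= C & forall h y, 0 < h <= 1 ->
  (\int[normal_prob 0 1]_x ((rk_step a b h y (Num.sqrt h * x)) ^+ n)%:E <=
    ((1 + C * h) * y ^+ n)%:E)%E.
Proof.
move=> nodd n1; have [C C0 HC] := gauss_sqr1_moment (R := R) n.
pose K := 2 * L ^+ 2.
have K1 : 1 <= K by rewrite /K; have := L1; nra.
have K0 : 0 <= K by apply: le_trans K1.
exists (2 ^+ n * step_const n * (K ^+ n * C)).
  by rewrite !mulr_ge0 ?exprn_ge0 ?step_const_ge0.
move=> h y h01; have [s0 s1 hs ss] := sqrt_le1 h01.
case/andP: (h01) => h0 h1.
pose w x := K * (1 + x ^+ 2).
pose m (x : R) := a y * h.
pose z x := Num.sqrt h * b y * x + 2^-1 * h * rk_slope b h y * (x ^+ 2 - 1).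
have Ey x : (rk_step a b h y (Num.sqrt h * x)) ^+ n = (y + (m x + z x)) ^+ n.
  by rewrite rk_step_scaled// ltW.
under eq_integral do rewrite Ey.
have w1 x : 1 <= w x.
  by rewrite /w -[leLHS]mulr1 ler_pM// ?sqr1_ge1.
have by_ := ld_norm y Hb; have ay := ld_norm y Ha.
have H : (\int[normal_prob 0 1]_x ((y + (m x + z x)) ^+ n)%:E <=
   ((1 + 2 ^+ n * step_const n * (K ^+ n * C) * h) * y ^+ n +
     2 ^+ n * step_const n * (K ^+ n * C) * h * 0 ^+ n)%:E)%E.
  apply: (@step_integral R _ (measurableTypeR R) (normal_prob 0 1) n h y 0 (K ^+ n * C) w m z) => //.
  - exact: probability_setT.
  - by rewrite (ltW h0).
  - move=> x; rewrite /m addr0 mulrC normrM (gtr0_norm h0) -mulrA ler_wpM2l// ?(ltW h0)//.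
    apply: (le_trans ay); rewrite mulrC ler_wpM2l//.
    apply: (@le_trans _ _ (K * 1)); last by rewrite ler_wpM2l// sqr1_ge1.
    by rewrite /K mulr1; have := L1; nra.
  - move=> x; rewrite addr0 /z /w.
    have B1 : `|Num.sqrt h * b y * x| <= Num.sqrt h * (L * `|y|) * (1 + x ^+ 2).
      apply: norm_leM; last exact: norm_le_sqr1.
      by rewrite normrM (gtr0_norm s0) ler_wpM2l// ltW.
    have B2 : `|2^-1 * h * rk_slope b h y * (x ^+ 2 - 1)| <=
        2^-1 * Num.sqrt h * (L ^+ 2 * `|y|) * (1 + x ^+ 2).
      apply: norm_leM; last exact: normB1_le_sqr1.
      apply: norm_leM; last exact: rk_slope_bound.
      by rewrite ger0_norm ?mulr_ge0 ?(ltW h0)// ler_wpM2l.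
    apply: (le_trans (norm_leD B1 B2)); rewrite -mulrDl [leRHS]mulrA ler_wpM2r ?sqr1_ge0//.
    have t0 : 0 <= Num.sqrt h * `|y| by rewrite mulr_ge0// ltW.
    have LL : L <= L ^+ 2 by have := L1; nra.
    have := ler_wpM2r t0 LL; have : 0 <= L ^+ 2 * (Num.sqrt h * `|y|) by rewrite mulr_ge0.
    rewrite /K; lra.
  - by rewrite /w; mfun.
  - by rewrite /m; mfun.
  - by rewrite /z; mfun.
  - rewrite /w; under eq_integral do rewrite exprMn.
    rewrite intEZ; [|by mfun|by move=> x; rewrite exprn_ge0 ?sqr1_ge0|by rewrite exprn_ge0].
    by rewrite EFinM lee_wpmul2l// lee_fin exprn_ge0.
  - rewrite -[RHS](gauss_cubic 0 (Num.sqrt h * b y) (2^-1 * h * rk_slope b h y) 0).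
    by apply: eq_integral => x _; rewrite /z mul0r addr0 add0r.
apply: (le_trans H); rewrite lee_fin expr0n gtn_eqF ?mulr0 ?addr0//.
exact: ltnW.
Qed.

End rk_milstein.

(** * One step of size 2h against two steps of size h *)

Section two_half_steps.
Context {R : realType}.
Implicit Types h x y z s e : R.
Variables (a a' b b' : R -> R) (L : R).
Hypothesis (Ha : lipschitz_diff L a a') (Hb : lipschitz_diff L b b').

Let L1 : 1 <= L := ld_ge1 Hb.
Let L0 : 0 <= L. Proof. exact: le_trans L1. Qed.
Let LX n : 0 <= L ^+ n. Proof. exact: exprn_ge0. Qed.

Let up i j t : (i <= j)%N -> 0 <= t -> L ^+ i * t <= L ^+ j * t.
Proof. by move=> ij t0; rewrite ler_wpM2r// ler_weXn2l. Qed.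

Section fixed_step.
Variables (h y x : R).
Hypothesis h01 : 0 < h <= 1.
Let s := Num.sqrt h.
Let v := 1 + x ^+ 2.
Let Y := 1 + y ^+ 2.
Let y1 := rk_step a b h y (s * x).

Let h0 : 0 < h. Proof. by case/andP : h01. Qed.
Let h1 : h <= 1. Proof. by case/andP : h01. Qed.
Let s0 : 0 < s. Proof. by have [] := sqrt_le1 h01. Qed.
Let s1 : s <= 1. Proof. by have [] := sqrt_le1 h01. Qed.
Let hs : h <= s. Proof. by have [] := sqrt_le1 h01. Qed.
Let ss : s * s = h. Proof. by have [] := sqrt_le1 h01. Qed.
Let v1 : 1 <= v. Proof. exact: sqr1_ge1. Qed.
Let yY : `|y| <= Y. Proof. exact: norm_le_sqr1. Qed.
Let y2Y : y ^+ 2 <= Y. Proof. by rewrite lerDr. Qed.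
Let s20 : 0 < Num.sqrt (2 * h). Proof. by rewrite sqrtr_gt0 mulr_gt0. Qed.
Let s2s : Num.sqrt (2 * h) <= 2 * s.
Proof.
rewrite -(@ler_pXn2r _ 2)// ?nnegrE ?mulr_ge0 ?(ltW s0) ?(ltW s20)//.
rewrite exprMn sqr_sqrtr ?mulr_ge0 ?(ltW h0)// (_ : s ^+ 2 = h); last by rewrite expr2 ss.
by have := h0; lra.
Qed.
Let vV : v <= v ^+ 2. Proof. by rewrite expr2 ler_peMl// (le_trans _ v1). Qed.
Let v0 : 0 <= v. Proof. exact: le_trans v1. Qed.
Let Y0 : 0 <= Y. Proof. exact: sqr1_ge0. Qed.
Let y1E : y1 = y + (a y * h + (s * b y * x + 2^-1 * h * rk_slope b h y * (x ^+ 2 - 1))).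
Proof. by apply: rk_step_scaled; exact: ltW. Qed.

Lemma rk_noise_le :
  `|s * b y * x + 2^-1 * h * rk_slope b h y * (x ^+ 2 - 1)| <= 2 * L ^+ 2 * `|y| * s * v.
Proof.
have B1 : `|s * b y * x| <= s * (L * `|y|) * v.
  apply: norm_leM; last exact: norm_le_sqr1.
  by rewrite normrM (gtr0_norm s0) ler_wpM2l ?(ltW s0)//; exact: ld_norm Hb.
have B2 : `|2^-1 * h * rk_slope b h y * (x ^+ 2 - 1)| <= 2^-1 * s * (L ^+ 2 * `|y|) * v.
  apply: norm_leM; last exact: normB1_le_sqr1.
  apply: norm_leM; last exact: (rk_slope_bound Hb).
  by rewrite ger0_norm ?mulr_ge0 ?(ltW h0)// ler_wpM2l.
apply: (le_trans (norm_leD B1 B2)).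
have t0 : 0 <= `|y| * s * v by rewrite !mulr_ge0// ltW.
have := up (isT : 1 <= 2)%N t0; have : 0 <= L ^+ 2 * (`|y| * s * v) by rewrite mulr_ge0.
rewrite expr1; lra.
Qed.

Lemma rk_increment_le : `|y1 - y| <= 3 * L ^+ 2 * `|y| * s * v.
Proof.
rewrite y1E addrC addKr.
have B1 : `|a y * h| <= L * `|y| * s.
  by apply: norm_leM; [exact: ld_norm Ha|rewrite gtr0_norm].
apply: (le_trans (norm_leD B1 rk_noise_le)).
have t0 : 0 <= `|y| * s by rewrite !mulr_ge0// ltW.
have t1 : `|y| * s <= `|y| * s * v by rewrite ler_peMr.
have := up (isT : 1 <= 2)%N t0; have := ler_wpM2l (LX 2) t1.
rewrite expr1; lra.
Qed.

Lemma rk_increment_sqr_le : (y1 - y) ^+ 2 <= 9 * L ^+ 4 * h * Y * v ^+ 2.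
Proof.
have -> : (y1 - y) ^+ 2 = `|y1 - y| * `|y1 - y| by rewrite -expr2 real_normK ?num_real.
apply: (@le_trans _ _ ((3 * L ^+ 2 * `|y| * s * v) * (3 * L ^+ 2 * `|y| * s * v))).
  by apply: ler_pM => //; exact: rk_increment_le.
have -> : (3 * L ^+ 2 * `|y| * s * v) * (3 * L ^+ 2 * `|y| * s * v) =
   (9 * L ^+ 4 * h * v ^+ 2) * (`|y| ^+ 2) by rewrite -ss; ring.
rewrite real_normK ?num_real//.
have -> : 9 * L ^+ 4 * h * Y * v ^+ 2 = (9 * L ^+ 4 * h * v ^+ 2) * Y by ring.
by rewrite ler_wpM2l// !mulr_ge0 ?sqr_ge0// ltW.
Qed.

(** The linear response of the drift to the noise of the first half step is too large for the drift
    part of the error; it is subtracted here and treated as centred in [dbl_A0]. *)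
Lemma rk_drift_taylor :
  `|a y1 - a y - a' y * (s * b y * x + 2^-1 * h * rk_slope b h y * (x ^+ 2 - 1))| <=
   10 * L ^+ 5 * (h * Y) * v ^+ 2.
Proof.
have -> : a y1 - a y - a' y * (s * b y * x + 2^-1 * h * rk_slope b h y * (x ^+ 2 - 1)) =
   (a y1 - a y - a' y * (y1 - y)) + a' y * a y * h by rewrite y1E; ring.
have B1 : `|a y1 - a y - a' y * (y1 - y)| <= L * (9 * L ^+ 4 * h * Y * v ^+ 2).
  apply: (le_trans (ld_taylor Ha _ _)); rewrite ler_wpM2l//.
  exact: rk_increment_sqr_le.
have B2 : `|a' y * a y * h| <= L * (L * `|y|) * h.
  apply: norm_leM; last by rewrite gtr0_norm.
  by apply: norm_leM; [exact: ld_bound Ha _|exact: ld_norm Ha].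
apply: (le_trans (norm_leD B1 B2)).
have t0 : 0 <= h * Y by rewrite mulr_ge0// ltW.
have t1 : h * Y <= h * Y * v ^+ 2 by rewrite ler_peMr// (le_trans v1).
have t2 : h * `|y| <= h * Y by rewrite ler_wpM2l// ltW.
have := up (isT : 2 <= 5)%N t0; have := ler_wpM2l (LX 2) t2; have := ler_wpM2l (LX 5) t1.
lra.
Qed.

Lemma rk_slope2_approx : `|rk_slope b (2 * h) y - b' y * b y| <= 2 * L ^+ 3 * Y * s.
Proof.
have h20 : 0 < 2 * h by rewrite mulr_gt0.
apply: (le_trans (rk_slope_approx Hb y h20)).
have -> : 2 * L ^+ 3 * Y * s = (L ^+ 3 * Y) * (2 * s) by ring.
apply: ler_pM; [exact: mulr_ge0 (LX 3) (sqr_ge0 y)|exact: sqrtr_ge0|by rewrite ler_wpM2l|exact: s2s].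
Qed.

Lemma rk_slope_halving : `|rk_slope b (2 * h) y - rk_slope b h y| <= 3 * L ^+ 3 * Y * s.
Proof.
have -> : rk_slope b (2 * h) y - rk_slope b h y =
  (rk_slope b (2 * h) y - b' y * b y) + - (rk_slope b h y - b' y * b y) by ring.
have B2 : `|rk_slope b h y - b' y * b y| <= L ^+ 3 * Y * s.
  apply: (le_trans (rk_slope_approx Hb y h0)).
  by rewrite ler_wpM2r ?(ltW s0)// ler_wpM2l.
apply: (le_trans (norm_leD rk_slope2_approx (norm_leN B2))); lra.
Qed.

(** Squaring the sum of two increments, the long step produces the mixed term
    [h * rk_slope b (2 * h) y * x1 * x2]. The half steps produce it through [b y1 - b y], up to this
    remainder. *)
Lemma rk_diffusion_taylor :
  `|b y1 - b y - s * rk_slope b (2 * h) y * x| <= 14 * L ^+ 5 * (h * Y) * v ^+ 2.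
Proof.
have -> : b y1 - b y - s * rk_slope b (2 * h) y * x =
   (b y1 - b y - b' y * (y1 - y)) +
   (b' y * (a y * h + 2^-1 * h * rk_slope b h y * (x ^+ 2 - 1)) +
    - (s * (rk_slope b (2 * h) y - b' y * b y) * x)) by rewrite y1E; ring.
have B1 : `|b y1 - b y - b' y * (y1 - y)| <= L * (9 * L ^+ 4 * h * Y * v ^+ 2).
  apply: (le_trans (ld_taylor Hb _ _)); rewrite ler_wpM2l//.
  exact: rk_increment_sqr_le.
have B2 : `|b' y * (a y * h + 2^-1 * h * rk_slope b h y * (x ^+ 2 - 1))| <=
    L * (L * `|y| * h + 2^-1 * h * (L ^+ 2 * `|y|) * v).
  apply: norm_leM; first exact: ld_bound Hb _.
  apply: norm_leD.
    by apply: norm_leM; [exact: ld_norm Ha|rewrite gtr0_norm].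
  apply: norm_leM; last exact: normB1_le_sqr1.
  apply: norm_leM; last exact: (rk_slope_bound Hb).
  by rewrite ger0_norm ?mulr_ge0 ?(ltW h0).
have B3 : `|s * (rk_slope b (2 * h) y - b' y * b y) * x| <= s * (2 * L ^+ 3 * Y * s) * v.
  apply: norm_leM; last exact: norm_le_sqr1.
  by apply: norm_leM; [rewrite gtr0_norm|exact: rk_slope2_approx].
apply: (le_trans (norm_leD B1 (norm_leD B2 (norm_leN B3)))).
have -> : s * (2 * L ^+ 3 * Y * s) * v = 2 * L ^+ 3 * (h * Y * v) by rewrite -ss; ring.
have t0 : 0 <= h * Y by rewrite mulr_ge0// ltW.
have t1 : h * Y <= h * Y * v by rewrite ler_peMr.
have t3 : h * Y * v <= h * Y * v ^+ 2 by rewrite ler_wpM2l.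
have t2 : h * `|y| <= h * Y by rewrite ler_wpM2l// ltW.
have t5 : h * `|y| * v <= h * Y * v by rewrite ler_wpM2r.
have t6 : 0 <= h * Y * v by rewrite mulr_ge0.
have t7 : 0 <= h * Y * v ^+ 2 by apply: le_trans t3.
have u1 := up (isT : 2 <= 3)%N t0; have u2 := ler_wpM2l (LX 2) t2.
have u3 := ler_wpM2l (LX 3) t1; have u4 := ler_wpM2l (LX 3) t5.
have u5 := ler_wpM2l (LX 3) t3; have u6 := up (isT : 3 <= 5)%N t7.
have u7 : 0 <= L ^+ 5 * (h * Y * v ^+ 2) by rewrite mulr_ge0.
lra.
Qed.

(** Order [sqrt h] suffices, because the slope is multiplied by [h] and by the centred
    [x2 ^+ 2 - 1]. Both slopes are compared with [b' b], at [y] and at [y1]; a bound quadratic in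
    [y] is harmless here, being part of the local error. *)
Lemma rk_slope_after_step :
  `|rk_slope b (2 * h) y - rk_slope b h y1| <= 30 * L ^+ 7 * (s * Y) * v ^+ 2.
Proof.
have -> : rk_slope b (2 * h) y - rk_slope b h y1 =
   (rk_slope b (2 * h) y - b' y * b y) +
   (- (b' y1 * (b y1 - b y)) + - ((b' y1 - b' y) * b y) +
    - (rk_slope b h y1 - b' y1 * b y1)) by ring.
have D := rk_increment_le.
have B2 : `|b' y1 * (b y1 - b y)| <= L * (L * (3 * L ^+ 2 * `|y| * s * v)).
  apply: norm_leM; first exact: ld_bound Hb _.
  by apply: (le_trans (ld_lip Hb _ _)); rewrite ler_wpM2l.
have B3 : `|(b' y1 - b' y) * b y| <= L * (3 * L ^+ 2 * `|y| * s * v) * (L * `|y|).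
  apply: norm_leM; last exact: ld_norm Hb.
  by apply: (le_trans (ld_lip' Hb _ _)); rewrite ler_wpM2l.
have y1sq : y1 ^+ 2 <= 20 * L ^+ 4 * Y * v ^+ 2.
  have H1 : y1 ^+ 2 <= 2 * y ^+ 2 + 2 * (y1 - y) ^+ 2.
    have := sqr_ge0 (y1 - 2 * y); nra.
  have H2 := rk_increment_sqr_le.
  have t0 : 0 <= Y * v ^+ 2 by rewrite mulr_ge0 ?sqr_ge0.
  have t1 : Y <= Y * v ^+ 2 by rewrite ler_peMr// (le_trans v1).
  have H3 : 9 * L ^+ 4 * h * Y * v ^+ 2 <= 9 * L ^+ 4 * Y * v ^+ 2.
    have -> : 9 * L ^+ 4 * h * Y * v ^+ 2 = h * (9 * L ^+ 4 * Y * v ^+ 2) by ring.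
    by rewrite ler_piMl// !mulr_ge0 ?sqr_ge0.
  have := up (isT : 0 <= 4)%N t0; rewrite expr0; have := y2Y; lra.
have B4 : `|rk_slope b h y1 - b' y1 * b y1| <= L ^+ 3 * (20 * L ^+ 4 * Y * v ^+ 2) * s.
  apply: (le_trans (rk_slope_approx Hb y1 h0)).
  by rewrite ler_wpM2r ?(ltW s0)// ler_wpM2l.
apply: (le_trans (norm_leD rk_slope2_approx (norm_leD (norm_leD (norm_leN B2) (norm_leN B3)) (norm_leN B4)))).
have sY0 : 0 <= s * Y by rewrite mulr_ge0// ltW.
have t1 : s * Y <= s * Y * v by rewrite ler_peMr.
have t3 : s * Y * v <= s * Y * v ^+ 2 by rewrite ler_wpM2l.
have t6 : 0 <= s * Y * v by rewrite mulr_ge0.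
have t7 : 0 <= s * Y * v ^+ 2 by apply: le_trans t3.
have t8 : `|y| * s * v <= s * Y * v.
  by rewrite (mulrC s) ler_wpM2r// ler_wpM2r// ltW.
have t9 : `|y| * `|y| * s * v <= s * Y * v.
  by rewrite (mulrC s) ler_wpM2r// ler_wpM2r ?(ltW s0)// -expr2 real_normK ?num_real.
have u1 := up (isT : 3 <= 7)%N sY0; have u2 := up (isT : 4 <= 7)%N t6.
have u3 := ler_wpM2l (LX 4) t8; have u4 := ler_wpM2l (LX 4) t9.
have u5 := ler_wpM2l (LX 7) t3; have u6 := ler_wpM2l (LX 7) t1.
have u7 : 0 <= L ^+ 7 * (s * Y * v ^+ 2) by rewrite mulr_ge0.
have E4 : 2 * L ^+ 3 * Y * s + (L * (L * (3 * L ^+ 2 * `|y| * s * v)) +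
  L * (3 * L ^+ 2 * `|y| * s * v) * (L * `|y|) + L ^+ 3 * (20 * L ^+ 4 * Y * v ^+ 2) * s) =
  2 * (L ^+ 3 * (s * Y)) + 3 * (L ^+ 4 * (`|y| * s * v)) + 3 * (L ^+ 4 * (`|y| * `|y| * s * v))
  + 20 * (L ^+ 7 * (s * Y * v ^+ 2)) by ring.
rewrite E4; lra.
Qed.

Lemma rk_slope2_lip z : 2 * h <= 1 ->
  h * `|rk_slope b (2 * h) z - rk_slope b (2 * h) y| <= 3 * L ^+ 2 * s * `|z - y|.
Proof.
move=> h2; have h201 : 0 < 2 * h <= 1 by rewrite mulr_gt0.
have := rk_slope_lip Hb y z h201 => H.
rewrite -[X in X * _]ss.
apply: (@le_trans _ _ (s * (Num.sqrt (2 * h) * `|rk_slope b (2 * h) z - rk_slope b (2 * h) y|))).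
  rewrite -mulrA ler_wpM2l ?(ltW s0)// ler_wpM2r// ler_wsqrtr//.
  by rewrite ler_peMl ?(ltW h0)// ler1n.
have -> : 3 * L ^+ 2 * s * `|z - y| = s * (3 * L ^+ 2 * `|z - y|) by ring.
by rewrite ler_wpM2l// ltW.
Qed.

End fixed_step.
End two_half_steps.

Section doubling.
Context {R : realType}.
Implicit Types h x y z s e : R.
Variables (a a' b b' : R -> R) (L : R).
Hypothesis (Ha : lipschitz_diff L a a') (Hb : lipschitz_diff L b b').
Local Notation gamma := (normal_prob (0 : R) 1).
Local Notation RR := (measurableTypeR R * measurableTypeR R)%type.

Let L1 : 1 <= L := ld_ge1 Hb.
Let L0 : 0 <= L. Proof. exact: le_trans L1. Qed.
Let LX n : 0 <= L ^+ n. Proof. exact: exprn_ge0. Qed.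

Let up i j t : (i <= j)%N -> 0 <= t -> L ^+ i * t <= L ^+ j * t.
Proof. by move=> ij t0; rewrite ler_wpM2r// ler_weXn2l. Qed.

Lemma measurable_rk_slope h : measurable_fun [set: R] (rk_slope b h).
Proof.
have mb := measurable_lipschitz (ld_lip Hb).
rewrite /rk_slope; apply: measurable_funM; last exact: measurable_cst.
apply: measurable_funB => //.
apply: (measurableT_comp mb); apply: measurable_funD; first exact: measurable_id.
by apply: measurable_funM => //; exact: measurable_cst.
Qed.

Lemma measurable_rk_step d (T : measurableType d) h (f g : T -> R) :
  measurable_fun [set: T] f -> measurable_fun [set: T] g ->
  measurable_fun [set: T] (fun t => rk_step a b h (f t) (g t)).
Proof.
move=> mf mg.
have mb := measurableT_comp (measurable_lipschitz (ld_lip Hb)) mf.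
have ma := measurableT_comp (measurable_lipschitz (ld_lip Ha)) mf.
have ms := measurableT_comp (measurable_rk_slope h) mf.
rewrite /rk_step; mfun.
Qed.

Section fixed_step.
Variables (h y z : R).
Hypothesis h0 : 0 < h.
Hypothesis h2 : 2 * h <= 1.
Let s := Num.sqrt h.
Let h1 : h <= 1. Proof. by apply: le_trans h2; rewrite ler_peMl ?ler1n// ltW. Qed.
Let h01 : 0 < h <= 1. Proof. by rewrite h0. Qed.
Let s0 : 0 < s. Proof. by have [] := sqrt_le1 h01. Qed.
Let ss : s * s = h. Proof. by have [] := sqrt_le1 h01. Qed.
Let y1 x := rk_step a b h y (s * x).
Let noise x := s * b y * x + 2^-1 * h * rk_slope b h y * (x ^+ 2 - 1).
Let kap := h * (1 + y ^+ 2).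

(** For [x1] fixed, the difference is expanded along [1], [x2] and [x2 ^+ 2 - 1]. The coefficient of
    [1] is split into [dbl_drift] and [dbl_A0], centred in [x1]. The term [h * a' y * noise x] has
    order [sqrt h * kap]: too large for [dbl_drift], whose budget is [h * kap], but within that of a
    centred term. *)
Definition dbl_drift x := 2 * h * (a z - a y) - h * (a (y1 x) - a y - a' y * noise x).
Definition dbl_A0 x := - (h * a' y * noise x) + s * x * (b z - b y) +
  2^-1 * h * (rk_slope b (2 * h) z - rk_slope b h y) * (x ^+ 2 - 1).
Definition dbl_A1 x := s * (b z - b (y1 x)) + h * rk_slope b (2 * h) z * x.
Definition dbl_A2 x := 2^-1 * h * (rk_slope b (2 * h) z - rk_slope b h (y1 x)).

Lemma dbl_decomposition x1 x2 :
  rk_step a b (2 * h) z (s * x1 + s * x2) - rk_step a b h (y1 x1) (s * x2) =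
  (z - y) + (dbl_drift x1 + (dbl_A0 x1 + dbl_A1 x1 * x2 + dbl_A2 x1 * (x2 ^+ 2 - 1))).
Proof.
rewrite (rk_step_scaled a b (y1 x1) x2 (ltW h0)).
rewrite {1}/rk_step -mulrDr exprMn sqr_sqrtr ?(ltW h0)// -/s.
rewrite /dbl_drift /dbl_A0 /dbl_A1 /dbl_A2 /noise.
have := rk_step_scaled a b y x1 (ltW h0); rewrite -/s -/(y1 x1) => E1.
lra.
Qed.

Let kap0 : 0 <= kap. Proof. by rewrite mulr_ge0 ?(ltW h0)// sqr1_ge0. Qed.
Let yY : h * `|y| <= kap. Proof. by rewrite ler_wpM2l ?(ltW h0)// norm_le_sqr1. Qed.

Lemma dbl_drift_le x : `|dbl_drift x| <= h * (`|z - y| + kap) * (10 * L ^+ 7 * (1 + x ^+ 2) ^+ 2).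
Proof.
have v1 : 1 <= (1 + x ^+ 2) ^+ 2 by rewrite exprn_ege1// sqr1_ge1.
have B1 : `|2 * h * (a z - a y)| <= 2 * h * (L * `|z - y|).
  apply: norm_leM; last exact: ld_lip Ha _ _.
  by rewrite gtr0_norm ?mulr_gt0.
have B2 : `|h * (a (y1 x) - a y - a' y * noise x)| <=
    h * (10 * L ^+ 5 * (h * (1 + y ^+ 2)) * (1 + x ^+ 2) ^+ 2).
  by apply: norm_leM; [rewrite gtr0_norm|exact: (rk_drift_taylor Ha Hb y x h01)].
apply: (le_trans (norm_leD B1 (norm_leN B2))).
rewrite -/kap; set V := (1 + x ^+ 2) ^+ 2 in v1 *.
have t0 : 0 <= h * `|z - y| by rewrite mulr_ge0 ?(ltW h0).
have t1 : h * `|z - y| <= h * `|z - y| * V by rewrite ler_peMr.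
have V0 : 0 <= V by apply: le_trans v1.
have t2 : 0 <= h * kap * V by rewrite mulr_ge0// mulr_ge0// ltW.
have u1 := up (isT : 1 <= 7)%N t0; have u2 := ler_wpM2l (LX 7) t1.
have u3 := up (isT : 5 <= 7)%N t2.
have u4 : 0 <= L ^+ 7 * (h * `|z - y| * V).
  by rewrite mulr_ge0//; apply: le_trans t1.
rewrite expr1 in u1; lra.
Qed.

Lemma dbl_noise_le x1 x2 :
  `|dbl_A0 x1 + dbl_A1 x1 * x2 + dbl_A2 x1 * (x2 ^+ 2 - 1)| <=
  s * (`|z - y| + kap) * (40 * L ^+ 7 * ((1 + x1 ^+ 2) ^+ 2 * (1 + x2 ^+ 2))).
Proof.
set v := 1 + x1 ^+ 2; set u := 1 + x2 ^+ 2; set E := `|z - y|.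
have v1 : 1 <= v by exact: sqr1_ge1.
have u1 : 1 <= u by exact: sqr1_ge1.
have v0 : 0 <= v by apply: le_trans v1.
have u0 : 0 <= u by apply: le_trans u1.
have D := rk_slope2_lip Hb y h01 z h2.
have D' x : 0 <= x -> 2^-1 * x <= x by lra.
have bzy : `|b z - b y| <= L * E by exact: ld_lip Hb _ _.
have B0 : `|dbl_A0 x1| <= L * (2 * L ^+ 2 * s * kap * v) + s * v * (L * E) +
    (3 * L ^+ 2 * s * E + 3 * L ^+ 3 * s * kap) * v.
  apply: norm_leD; first apply: norm_leD.
  - apply: norm_leN.
    have -> : h * a' y * noise x1 = a' y * (h * noise x1) by ring.
    apply: norm_leM; first exact: ld_bound Ha _.
    rewrite normrM (gtr0_norm h0).
    have H1 : `|noise x1| <= 2 * L ^+ 2 * `|y| * s * v by exact: (rk_noise_le Hb y x1 h01).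
    have := ler_wpM2l (ltW h0) H1.
    have : 2 * L ^+ 2 * s * v * (h * `|y|) <= 2 * L ^+ 2 * s * v * kap.
      by rewrite ler_wpM2l// !mulr_ge0// ltW.
    lra.
  - apply: norm_leM => //; apply: norm_leM; last exact: norm_le_sqr1.
    by rewrite gtr0_norm.
  - apply: norm_leM; last exact: normB1_le_sqr1.
    have -> : 2^-1 * h * (rk_slope b (2 * h) z - rk_slope b h y) =
      2^-1 * (h * (rk_slope b (2 * h) z - rk_slope b (2 * h) y)) +
      2^-1 * (h * (rk_slope b (2 * h) y - rk_slope b h y)) by ring.
    apply: norm_leD.
      rewrite normrM ger0_norm// normrM (gtr0_norm h0).
      by apply: (le_trans (D' _ _)); rewrite ?mulr_ge0 ?(ltW h0).
    rewrite normrM ger0_norm// normrM (gtr0_norm h0).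
    apply: (le_trans (D' _ _)); first by rewrite mulr_ge0 ?(ltW h0).
    apply: (le_trans (ler_wpM2l (ltW h0) (rk_slope_halving Hb y h01))).
    by rewrite -/s /kap; lra.
have B1 : `|dbl_A1 x1| <= s * (L * E) + s * (14 * L ^+ 5 * kap * v ^+ 2) + 3 * L ^+ 2 * s * E * v.
  (* Inserting the values at [y] separates the propagation of the error [z - y] from the local
     error. *)
  have -> : dbl_A1 x1 = s * (b z - b y) +
     - (s * (b (y1 x1) - b y - s * rk_slope b (2 * h) y * x1)) +
     h * (rk_slope b (2 * h) z - rk_slope b (2 * h) y) * x1.
    have E1 : s * (s * rk_slope b (2 * h) y * x1) = h * rk_slope b (2 * h) y * x1.
      by rewrite !mulrA ss.
    rewrite /dbl_A1; lra.
  apply: norm_leD; first apply: norm_leD.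
  - by apply: norm_leM => //; rewrite gtr0_norm.
  - apply: norm_leN; apply: norm_leM; first by rewrite gtr0_norm.
    exact: (rk_diffusion_taylor Ha Hb y x1 h01).
  - apply: norm_leM; last exact: norm_le_sqr1.
    by rewrite normrM (gtr0_norm h0).
have B2 : `|dbl_A2 x1| <= 3 * L ^+ 2 * s * E + 15 * L ^+ 7 * s * kap * v ^+ 2.
  have -> : dbl_A2 x1 = 2^-1 * (h * (rk_slope b (2 * h) z - rk_slope b (2 * h) y)) +
      2^-1 * (h * (rk_slope b (2 * h) y - rk_slope b h (y1 x1))).
    by rewrite /dbl_A2; ring.
  apply: norm_leD.
    rewrite normrM ger0_norm// normrM (gtr0_norm h0).
    by apply: (le_trans (D' _ _)); rewrite ?mulr_ge0 ?(ltW h0).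
  rewrite normrM ger0_norm// normrM (gtr0_norm h0).
  have := ler_wpM2l (ltW h0) (rk_slope_after_step Ha Hb y x1 h01).
  by rewrite -/s -/(y1 x1) -/v /kap; lra.
have B3 : `|dbl_A1 x1 * x2| <=
   (s * (L * E) + s * (14 * L ^+ 5 * kap * v ^+ 2) + 3 * L ^+ 2 * s * E * v) * u.
  by apply: norm_leM => //; exact: norm_le_sqr1.
have B4 : `|dbl_A2 x1 * (x2 ^+ 2 - 1)| <=
   (3 * L ^+ 2 * s * E + 15 * L ^+ 7 * s * kap * v ^+ 2) * u.
  by apply: norm_leM => //; exact: normB1_le_sqr1.
apply: (le_trans (norm_leD (norm_leD B0 B3) B4)).
have vV : v <= v ^+ 2 by rewrite expr2 ler_peMl.
have vvu : v <= v ^+ 2 * u by apply: (le_trans vV); rewrite ler_peMr// exprn_ge0.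
have uvu : u <= v ^+ 2 * u by rewrite ler_peMl// (le_trans v1).
have vuvu : v * u <= v ^+ 2 * u by rewrite ler_wpM2r.
set W := v ^+ 2 * u in vvu uvu vuvu *.
have W0 : 0 <= W by apply: le_trans vvu.
have sE0 : 0 <= s * E by exact: mulr_ge0 (ltW s0) (normr_ge0 _).
have sk0 : 0 <= s * kap by exact: mulr_ge0 (ltW s0) kap0.
pose p := L ^+ 7.
have pW t c i : (i <= 7)%N -> 0 <= c -> 0 <= t -> t <= W -> L ^+ i * (c * t) <= p * (c * W).
  move=> i7 c0 t0 tW; apply: (@le_trans _ _ (p * (c * t))).
    by apply: up => //; exact: mulr_ge0.
  by apply: ler_wpM2l (LX 7) _ _ _; exact: ler_wpM2l.
have vu0 : 0 <= v * u by exact: mulr_ge0.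
have g1 := pW v _ 3%N isT sk0 v0 vvu.
have g2 := pW v _ 1%N isT sE0 v0 vvu.
have g3 := pW v _ 2%N isT sE0 v0 vvu.
have g4 := pW u _ 1%N isT sE0 u0 uvu.
have g5 := pW W _ 5%N isT sk0 W0 (lexx _).
have g6 := pW _ _ 2%N isT sE0 vu0 vuvu.
have g7 := pW u _ 2%N isT sE0 u0 uvu.
have g8 : 0 <= p * (s * E * W) by exact: mulr_ge0 (LX 7) (mulr_ge0 sE0 W0).
have g9 : 0 <= p * (s * kap * W) by exact: mulr_ge0 (LX 7) (mulr_ge0 sk0 W0).
have -> : L * (2 * L ^+ 2 * s * kap * v) + s * v * (L * E) +
    (3 * L ^+ 2 * s * E + 3 * L ^+ 3 * s * kap) * v +
    (s * (L * E) + s * (14 * L ^+ 5 * kap * v ^+ 2) + 3 * L ^+ 2 * s * E * v) * u +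
    (3 * L ^+ 2 * s * E + 15 * L ^+ 7 * s * kap * v ^+ 2) * u =
   5 * (L ^+ 3 * (s * kap * v)) + L ^+ 1 * (s * E * v) + 3 * (L ^+ 2 * (s * E * v)) +
   L ^+ 1 * (s * E * u) + 14 * (L ^+ 5 * (s * kap * W)) + 3 * (L ^+ 2 * (s * E * (v * u))) +
   3 * (L ^+ 2 * (s * E * u)) + 15 * (p * (s * kap * W)).
  by rewrite /W /p; ring.
have -> : s * (E + kap) * (40 * L ^+ 7 * W) = 40 * (p * (s * E * W)) + 40 * (p * (s * kap * W)).
  by rewrite /p; ring.
lra.
Qed.

Lemma measurable_dbl_A1 : measurable_fun [set: R] dbl_A1.
Proof.
have my1 : measurable_fun [set: R] y1 by apply: measurable_rk_step; mfun.
have mb := measurableT_comp (measurable_lipschitz (ld_lip Hb)) my1.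
by rewrite /dbl_A1; mfun.
Qed.

Lemma measurable_dbl_A2 : measurable_fun [set: R] dbl_A2.
Proof.
have my1 : measurable_fun [set: R] y1 by apply: measurable_rk_step; mfun.
have mb := measurableT_comp (measurable_rk_slope h) my1.
by rewrite /dbl_A2; mfun.
Qed.

Lemma measurable_dbl_A0 : measurable_fun [set: R] dbl_A0.
Proof. by rewrite /dbl_A0 /noise; mfun. Qed.

Lemma measurable_dbl_drift : measurable_fun [set: R] dbl_drift.
Proof.
have my1 : measurable_fun [set: R] y1 by apply: measurable_rk_step; mfun.
have ma := measurableT_comp (measurable_lipschitz (ld_lip Ha)) my1.
by rewrite /dbl_drift /noise; mfun.
Qed.

End fixed_step.

(** Here [z] is the state of the coarse scheme and [y] that of the fine one. Stability and
    consistency are obtained together: [z - y] is the error [e] of [step_integral] and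
    [h * (1 + y ^+ 2)] its local error [k]. *)
Lemma rk_doubling_step (n : nat) : ~~ odd n -> (1 < n)%N ->
  exists2 C : R, 0 <= C & forall h y z, 0 < h -> 2 * h <= 1 ->
  (\int[gamma \x gamma]_x ((rk_step a b (2 * h) z (Num.sqrt h * x.1 + Num.sqrt h * x.2) -
     rk_step a b h (rk_step a b h y (Num.sqrt h * x.1)) (Num.sqrt h * x.2)) ^+ n)%:E <=
    ((1 + C * h) * (z - y) ^+ n + C * h * (h * (1 + y ^+ 2)) ^+ n)%:E)%E.
Proof.
move=> nodd n1; have [C C0 HC] := gauss_pair_moment (R := R) (2 * n)%N.
pose K := 40 * L ^+ 7.
have L71 : 1 <= L ^+ 7 by rewrite exprn_ege1.
have K1 : 1 <= K by rewrite /K; lra.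
have K0 : 0 <= K by apply: le_trans K1.
pose CC := 2 ^+ n * step_const n * (K ^+ n * C).
have CC0 : 0 <= CC by rewrite !mulr_ge0 ?exprn_ge0 ?step_const_ge0.
exists (CC * 2); first by rewrite mulr_ge0.
move=> h y z h0 h2.
pose w (x : RR) := K * ((1 + x.1 ^+ 2) * (1 + x.2 ^+ 2)) ^+ 2.
pose zt (x : RR) := dbl_A0 h y z x.1 + dbl_A1 h y z x.1 * x.2 + dbl_A2 h y z x.1 * (x.2 ^+ 2 - 1).
pose mt (x : RR) := dbl_drift h y z x.1.
under eq_integral do rewrite (dbl_decomposition y z h0).
have -> : (1 + CC * 2 * h) * (z - y) ^+ n + CC * 2 * h * (h * (1 + y ^+ 2)) ^+ n =
  (1 + CC * (2 * h)) * (z - y) ^+ n + CC * (2 * h) * (h * (1 + y ^+ 2)) ^+ n by ring.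
have mid : measurable_fun [set: R] (fun x : R => x) by mfun.
have mv : measurable_fun [set: R] (fun x : R => 1 + x ^+ 2) by mfun.
have mv2 : measurable_fun [set: R] (fun x : R => x ^+ 2 - 1) by mfun.
have mA0 := measurable_pair_fst (measurable_dbl_A0 h y z).
have mA1 := measurable_pair_fst (measurable_dbl_A1 h y z).
have mA2 := measurable_pair_fst (measurable_dbl_A2 h y z).
have mx2 := measurable_pair_snd mid.
have mx22 := measurable_pair_snd mv2.
have mv1' := measurable_pair_fst mv.
have mv2' := measurable_pair_snd mv.
have kap0 : 0 <= h * (1 + y ^+ 2) by rewrite mulr_ge0 ?sqr1_ge0 ?(ltW h0).
have hh2 : h <= 2 * h by rewrite ler_peMl ?ler1n// ltW.
have vv (x : RR) : 1 <= (1 + x.1 ^+ 2) * (1 + x.2 ^+ 2) :> R.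
  by rewrite -[leLHS]mulr1 ler_pM ?sqr1_ge1.
have w1 (x : RR) : 1 <= w x.
  by rewrite /w -[leLHS]mulr1 ler_pM// exprn_ege1.
have vle (x : RR) : (1 + x.1 ^+ 2) ^+ 2 <= ((1 + x.1 ^+ 2) * (1 + x.2 ^+ 2)) ^+ 2 :> R.
  rewrite exprMn ler_peMr ?exprn_ge0 ?sqr1_ge0// exprn_ege1// sqr1_ge1//.
have vle2 (x : RR) : (1 + x.1 ^+ 2) ^+ 2 * (1 + x.2 ^+ 2) <= ((1 + x.1 ^+ 2) * (1 + x.2 ^+ 2)) ^+ 2 :> R.
  by rewrite exprMn ler_wpM2l ?exprn_ge0 ?sqr1_ge0// expr2 ler_peMl ?sqr1_ge0 ?sqr1_ge1.
have ztle (x : RR) : `|zt x| <= Num.sqrt (2 * h) * (`|z - y| + h * (1 + y ^+ 2)) * w x.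
  apply: (le_trans (dbl_noise_le y z h0 h2 _ _)).
  apply: ler_pM.
  - by rewrite mulr_ge0 ?sqrtr_ge0 ?addr_ge0.
  - by rewrite !mulr_ge0 ?exprn_ge0 ?sqr1_ge0.
  - by rewrite ler_wpM2r ?addr_ge0// ler_wsqrtr.
  - by rewrite /w /K ler_wpM2l.
apply: (@step_integral R _ RR (gamma \x gamma)%E n (2 * h) (z - y) (h * (1 + y ^+ 2)) (K ^+ n * C) w mt zt) => //.
- exact: gauss_pair_setT.
- by rewrite mulr_ge0 ?(ltW h0).
- move=> x; apply: (le_trans (dbl_drift_le y z h0 h2 x.1)).
  apply: ler_pM.
  - by rewrite mulr_ge0 ?(ltW h0) ?addr_ge0.
  - by rewrite !mulr_ge0 ?exprn_ge0 ?sqr1_ge0.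
  - by rewrite ler_wpM2r ?addr_ge0.
  - rewrite /w /K; apply: ler_pM => //.
      by rewrite mulr_ge0.
      by rewrite exprn_ge0// sqr1_ge0.
    by rewrite ler_wpM2r// ler_nat.
- by rewrite /w; apply: measurable_funM; [exact: measurable_cst|]; apply: measurable_funX; apply: measurable_funM.
- exact: (measurable_pair_fst (measurable_dbl_drift h y z)).
- rewrite /zt; apply: measurable_funD; first apply: measurable_funD => //.
    exact: measurable_funM.
  exact: measurable_funM.
- rewrite /w; under eq_integral do rewrite exprMn -exprM.
  rewrite intEZ; last 3 first.
  - by apply: measurable_funX; apply: measurable_funM.
  - by move=> x; rewrite exprn_ge0// (le_trans _ (vv x)).
  - by rewrite exprn_ge0.
  by rewrite EFinM lee_wpmul2l// lee_fin exprn_ge0.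
(* Only [dbl_A0] has to be centred in the first variable, and it is a combination of [x1] and
   [x1 ^+ 2 - 1]. *)
- apply: (@gauss_pair_centered R 2 (Num.sqrt (2 * h) * (`|z - y| + h * (1 + y ^+ 2)) * K)).
  - by rewrite !mulr_ge0 ?sqrtr_ge0 ?addr_ge0.
  - exact: measurable_dbl_A0.
  - exact: measurable_dbl_A1.
  - exact: measurable_dbl_A2.
  - rewrite -[RHS](gauss_cubic 0 (- (h * a' y * (Num.sqrt h * b y)) + Num.sqrt h * (b z - b y))
      (- (h * a' y * (2^-1 * h * rk_slope b h y)) + 2^-1 * h * (rk_slope b (2 * h) z - rk_slope b h y)) 0).
    by apply: eq_integral => x _; congr EFin; rewrite /dbl_A0; ring.
  - by move=> x1 x2; apply: (le_trans (ztle (x1, x2))); rewrite mulrA.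
Qed.

End doubling.

(** * The exponential step *)

Section exponential_remainders.
Context {R : realType}.

Lemma mvt_norm_le (r r' : R -> R) (x M : R) :
  (forall y : R, is_derive y 1 r (r' y)) -> r 0 = 0 ->
  (forall y, `|y| <= `|x| -> `|r' y| <= M) -> `|r x| <= M * `|x|.
Proof.
move=> dr r0 HM.
have cr (A : set R) : {within A, continuous r}.
  apply: continuous_subspaceT => y; apply: differentiable_continuous.
  by apply/derivable1_diffP; have [] := dr y.
have [x0|x0] := leP 0 x.
  have [c] := MVT_segment x0 (fun y _ => dr y) (cr _).
  rewrite in_itv/= => /andP[c0 cx]; rewrite r0 !subr0 => ->.
  by rewrite normrM ler_wpM2r// HM// !ger0_norm.
have [c] := MVT_segment (ltW x0) (fun y _ => dr y) (cr _).
rewrite in_itv/= => /andP[c0 cx]; rewrite r0 !sub0r => /eqP; rewrite eqr_oppLR => /eqP ->.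
rewrite normrN normrM normrN ler_wpM2r// HM// !ler0_norm// ?(ltW x0)//.
by rewrite lerN2.
Qed.

(** The derivative of a Taylor remainder is the preceding remainder, so that one application of the
    mean value theorem raises the order by one. The factorials are given up. *)
Lemma expR_remainder_step (r r' : R -> R) (k : nat) :
  (forall y : R, is_derive y 1 r (r' y)) -> r 0 = 0 ->
  (forall y, `|r' y| <= `|y| ^+ k * expR `|y|) ->
  forall x, `|r x| <= `|x| ^+ k.+1 * expR `|x|.
Proof.
move=> dr r0 H x.
rewrite exprSr mulrAC; apply: (mvt_norm_le dr r0) => y yx.
apply: (le_trans (H y)); apply: ler_pM; rewrite ?exprn_ge0 ?expR_ge0 ?ler_expR//.
by rewrite lerXn2r ?nnegrE.
Qed.

Lemma expR_remainder2 (x : R) : `|expR x - 1 - x| <= `|x| ^+ 2 * expR `|x|.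
Proof.
have H1 : forall y : R, `|expR y - 1| <= `|y| ^+ 1 * expR `|y|.
  apply: (@expR_remainder_step _ expR).
  - by move=> y; apply: is_derive_eq; rewrite subr0.
  - by rewrite expR0 subrr.
  - move=> y; rewrite expr0 mul1r ger0_norm ?expR_ge0// ler_expR ler_norm//.
apply: (@expR_remainder_step (fun y => expR y - 1 - y) (fun y => expR y - 1)) => //.
- by move=> y; apply: is_derive_eq; rewrite subr0.
- by rewrite expR0 subrr subr0.
Qed.

(** Order four is what consistency requires: the exponent has size [sqrt h], and the part of the
    error that is not centred must be of order [h ^+ 2]. *)
Lemma expR_remainder4 (x : R) :
  `|expR x - 1 - x - x ^+ 2 / 2 - x ^+ 3 / 6| <= `|x| ^+ 4 * expR `|x|.
Proof.
apply: (@expR_remainder_step (fun y => expR y - 1 - y - y ^+ 2 / 2 - y ^+ 3 / 6) (fun y => expR y - 1 - y - y ^+ 2 / 2)).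
- move=> y; apply: is_derive_eq.
  by rewrite /= /GRing.scale /=; field.
- by rewrite /= expR0; field.
apply: (@expR_remainder_step (fun y => expR y - 1 - y - y ^+ 2 / 2) (fun y => expR y - 1 - y)).
- move=> y; apply: is_derive_eq. by rewrite /= /GRing.scale /=; field.
- by rewrite /= expR0; field.
exact: expR_remainder2.
Qed.

End exponential_remainders.

Section exponential_step.
Context {R : realType}.
Implicit Types x : R.
Variables (a a' b b' : R -> R) (L : R).
Hypothesis (Ha : lipschitz_diff L a a') (Hb : lipschitz_diff L b b').
Local Notation gamma := (normal_prob (0 : R) 1).

Let L1 : 1 <= L := ld_ge1 Hb.
Let L0 : 0 <= L. Proof. exact: le_trans L1. Qed.
Let LX n : 0 <= L ^+ n. Proof. exact: exprn_ge0. Qed.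

(* F, f and f'g written in terms of a = Gbar, b = g and b' = g' *)
Definition rel_diffusion X := b X / X.
Definition rel_drift X := (a X - 2^-1 * (b' X * b X)) / X.
Definition rel_correction X := (b' X - rel_diffusion X) * rel_diffusion X.

Definition exp_step (h X dB : R) :=
  expR (rel_drift X * h + rel_diffusion X * dB + 2^-1 * rel_correction X * dB ^+ 2) * X.

(** Also true at [X = 0], where the quotient is [0] by convention and [b 0 = 0]. Multiplying by the
    state thus removes every division from the expansions. *)
Lemma rel_diffusionE X : X * rel_diffusion X = b X.
Proof.
rewrite /rel_diffusion; have [->|X0] := eqVneq X 0; first by rewrite mul0r (ld_0 Hb).
by rewrite mulrC divfK.
Qed.

Lemma rel_driftE X : X * rel_drift X = a X - 2^-1 * (b' X * b X).
Proof.
rewrite /rel_drift; have [->|X0] := eqVneq X 0.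
  by rewrite mul0r (ld_0 Hb) (ld_0 Ha) !mulr0 subr0.
by rewrite mulrC divfK.
Qed.

Lemma rel_diffusion_le X : `|rel_diffusion X| <= L.
Proof.
rewrite /rel_diffusion; have [->|X0] := eqVneq X 0; first by rewrite invr0 mulr0 normr0.
by rewrite normrM normfV ler_pdivrMr ?normr_gt0//; exact: ld_norm Hb.
Qed.

Lemma rel_correction_le X : `|rel_correction X| <= 2 * L ^+ 2.
Proof.
have := norm_leM (norm_leD (ld_bound Hb X) (norm_leN (rel_diffusion_le X))) (rel_diffusion_le X).
by rewrite /rel_correction; lra.
Qed.

Lemma rel_drift_le X : `|rel_drift X| <= 2 * L ^+ 2.
Proof.
rewrite /rel_drift; have [->|X0] := eqVneq X 0.
  by rewrite invr0 mulr0 normr0 mulr_ge0.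
rewrite normrM normfV ler_pdivrMr ?normr_gt0//.
have H : `|2^-1 * (b' X * b X)| <= 2^-1 * (L * (L * `|X|)).
  apply: norm_leM; first by rewrite ger0_norm.
  by apply: norm_leM; [exact: ld_bound Hb X|exact: ld_norm Hb].
have H2 := norm_leD (ld_norm X Ha) (norm_leN H).
apply: (le_trans H2).
have LL : L <= L ^+ 2 by rewrite expr2 ler_peMl.
have := ler_wpM2r (normr_ge0 X) LL; have : 0 <= L ^+ 2 * `|X| by rewrite mulr_ge0.
lra.
Qed.

(** In [exp_u], the diffusion contributes [L], the drift [2 * L ^+ 2] and the correction [L ^+ 2],
    in units of [sqrt h * (1 + x ^+ 2)]. *)
Let M := 4 * L ^+ 2.
Let M4 : 4 <= M. Proof. by rewrite /M ler_peMr// exprn_ege1. Qed.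
Let M1 : 1 <= M. Proof. by have := M4; lra. Qed.
Let M0 : 0 <= M. Proof. exact: le_trans M1. Qed.

Section fixed_step.
Variables (n : nat) (h X : R).
Hypothesis h01 : 0 < h <= 1.
(* keeps the n-th moments of exp_w finite *)
Hypothesis hM : M * Num.sqrt h <= (8 * n%:R)^-1.
Let s := Num.sqrt h.
Let h0 : 0 < h. Proof. by case/andP : h01. Qed.
Let h1 : h <= 1. Proof. by case/andP : h01. Qed.
Let s0 : 0 < s. Proof. by have [] := sqrt_le1 h01. Qed.
Let s1 : s <= 1. Proof. by have [] := sqrt_le1 h01. Qed.
Let hs : h <= s. Proof. by have [] := sqrt_le1 h01. Qed.
Let ss : s * s = h. Proof. by have [] := sqrt_le1 h01. Qed.

Definition exp_k x := rel_drift X + 2^-1 * rel_correction X * x ^+ 2.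
Definition exp_u x := rel_diffusion X * s * x + h * exp_k x.
(** The fourth power comes from the remainder of order four, the exponential from the factor
    [expR |exp_u x|] of the remainders. Dividing by [8 * n] makes the n-th power of the exponential
    [expR (8^-1 * (1 + x ^+ 2))], for every [n]. *)
Definition exp_w x := (1 + x ^+ 2) ^+ 4 * expR ((8 * n%:R)^-1 * (1 + x ^+ 2)).

Lemma exp_step_scaled x : exp_step h X (s * x) = expR (exp_u x) * X.
Proof.
rewrite /exp_step; congr (expR _ * _); rewrite /exp_u /exp_k exprMn sqr_sqrtr ?(ltW h0)//.
by rewrite -/s; ring.
Qed.

Lemma exp_k_le x : `|exp_k x| <= M * (1 + x ^+ 2).
Proof.
have H : `|2^-1 * rel_correction X * x ^+ 2| <= 2^-1 * (2 * L ^+ 2) * x ^+ 2.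
  apply: norm_leM; last by rewrite ger0_norm ?sqr_ge0.
  by apply: norm_leM; [rewrite ger0_norm|exact: rel_correction_le].
apply: (le_trans (norm_leD (rel_drift_le X) H)).
have := mulr_ge0 (LX 2) (sqr_ge0 x); have := LX 2; rewrite /M; lra.
Qed.

Lemma exp_u_le x : `|exp_u x| <= M * s * (1 + x ^+ 2).
Proof.
have v0 := sqr1_ge0 x; have v1 := sqr1_ge1 x.
have B1 : `|rel_diffusion X * s * x| <= L * s * (1 + x ^+ 2).
  apply: norm_leM; last exact: norm_le_sqr1.
  by apply: norm_leM; [exact: rel_diffusion_le|rewrite gtr0_norm].
have B2 : `|h * rel_drift X| <= s * (2 * L ^+ 2) * (1 + x ^+ 2).
  apply: (@le_trans _ _ (s * (2 * L ^+ 2))).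
    by apply: norm_leM; [rewrite gtr0_norm|exact: rel_drift_le].
  by rewrite ler_peMr// !mulr_ge0// ltW.
have B3 : `|h * (2^-1 * rel_correction X * x ^+ 2)| <= s * (2^-1 * (2 * L ^+ 2) * (1 + x ^+ 2)).
  apply: norm_leM; first by rewrite gtr0_norm.
  apply: norm_leM; last by rewrite ger0_norm ?sqr_ge0// lerDr.
  by apply: norm_leM; [rewrite ger0_norm|exact: rel_correction_le].
have -> : exp_u x = rel_diffusion X * s * x + (h * rel_drift X + h * (2^-1 * rel_correction X * x ^+ 2)).
  by rewrite /exp_u /exp_k; ring.
apply: (le_trans (norm_leD B1 (norm_leD B2 B3))).
have t0 : 0 <= s * (1 + x ^+ 2) by rewrite mulr_ge0// ltW.
have LL : L <= L ^+ 2 by rewrite expr2 ler_peMl.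
have := ler_wpM2r t0 LL; rewrite /M; lra.
Qed.

Lemma exp_u_expR_le x : expR `|exp_u x| <= expR ((8 * n%:R)^-1 * (1 + x ^+ 2)).
Proof.
by rewrite ler_expR (le_trans (exp_u_le x))// ler_wpM2r// sqr1_ge0.
Qed.

Let V x := (1 + x ^+ 2) ^+ 4.
Let W x := expR ((8 * n%:R)^-1 * (1 + x ^+ 2)).

Let W1 x : 1 <= W x.
Proof.
rewrite /W -[leLHS]expR0 ler_expR mulr_ge0 ?sqr1_ge0//.
Qed.

Let powV i x : (i <= 4)%N -> (1 + x ^+ 2) ^+ i <= V x.
Proof. by move=> i4; rewrite /V ler_weXn2l// sqr1_ge1. Qed.

Let V0 x : 0 <= V x. Proof. by rewrite exprn_ge0// sqr1_ge0. Qed.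

Let Vw x : V x <= exp_w x.
Proof. by rewrite /exp_w; apply: ler_peMr; [exact: V0|exact: W1]. Qed.

Lemma exp_w_ge1 x : 1 <= exp_w x.
Proof. by rewrite /exp_w -[leLHS]mulr1 ler_pM ?exprn_ege1 ?sqr1_ge1//; exact: W1. Qed.

Lemma exp_remainder2_le x : `|expR (exp_u x) - 1 - exp_u x| <= M ^+ 2 * h * exp_w x.
Proof.
apply: (le_trans (expR_remainder2 _)).
have -> : M ^+ 2 * h * exp_w x = (M ^+ 2 * h * V x) * W x by rewrite /exp_w /V /W; ring.
apply: ler_pM; rewrite ?exprn_ge0 ?expR_ge0//; last exact: exp_u_expR_le.
apply: (@le_trans _ _ ((M * s * (1 + x ^+ 2)) ^+ 2)).
  by rewrite lerXn2r ?nnegrE ?mulr_ge0 ?sqr1_ge0 ?(ltW s0)//; exact: exp_u_le.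
rewrite 2!exprMn (expr2 s) ss ler_wpM2l ?mulr_ge0 ?exprn_ge0 ?(ltW h0)//.
exact: powV.
Qed.

Lemma exp_remainder4_le x :
  `|expR (exp_u x) - 1 - exp_u x - exp_u x ^+ 2 / 2 - exp_u x ^+ 3 / 6| <=
   M ^+ 4 * h ^+ 2 * exp_w x.
Proof.
apply: (le_trans (expR_remainder4 _)).
have -> : M ^+ 4 * h ^+ 2 * exp_w x = (M ^+ 4 * h ^+ 2 * V x) * W x by rewrite /exp_w /V /W; ring.
apply: ler_pM; rewrite ?exprn_ge0 ?expR_ge0//; last exact: exp_u_expR_le.
apply: (@le_trans _ _ ((M * s * (1 + x ^+ 2)) ^+ 4)).
  by rewrite lerXn2r ?nnegrE ?mulr_ge0 ?sqr1_ge0 ?(ltW s0)//; exact: exp_u_le.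
by rewrite 2!exprMn (_ : s ^+ 4 = h ^+ 2)// -ss; ring.
Qed.

Definition exp_mom_m x := X * (h * exp_k x + (expR (exp_u x) - 1 - exp_u x)).
Definition exp_mom_z x := X * (rel_diffusion X * s * x).

Lemma exp_mom_decomposition x :
  exp_step h X (s * x) = X + (exp_mom_m x + exp_mom_z x).
Proof. by rewrite exp_step_scaled /exp_mom_m /exp_mom_z /exp_u; ring. Qed.

Lemma exp_mom_m_le x : `|exp_mom_m x| <= h * `|X| * (2 * M ^+ 2 * exp_w x).
Proof.
have B1 : `|h * exp_k x| <= h * (M * (1 + x ^+ 2)).
  by apply: norm_leM; [rewrite gtr0_norm|exact: exp_k_le].
have -> : h * `|X| * (2 * M ^+ 2 * exp_w x) = `|X| * (h * (2 * M ^+ 2 * exp_w x)) by ring.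
rewrite normrM ler_wpM2l//.
apply: (le_trans (norm_leD B1 (exp_remainder2_le x))).
have H1 : M * (1 + x ^+ 2) <= M ^+ 2 * exp_w x.
  apply: ler_pM => //; [exact: sqr1_ge0|by rewrite expr2 ler_peMl|].
  apply: (@le_trans _ _ (V x)); first by rewrite -{1}[1 + _]expr1 powV.
  exact: Vw.
have := ler_wpM2l (ltW h0) H1; lra.
Qed.

Lemma exp_mom_z_le x : `|exp_mom_z x| <= s * `|X| * (2 * M ^+ 2 * exp_w x).
Proof.
have -> : s * `|X| * (2 * M ^+ 2 * exp_w x) = `|X| * (s * (2 * M ^+ 2 * exp_w x)) by ring.
rewrite normrM ler_wpM2l//.
have B1 : `|rel_diffusion X * s * x| <= L * s * (1 + x ^+ 2).
  apply: norm_leM; last exact: norm_le_sqr1.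
  by apply: norm_leM; [exact: rel_diffusion_le|rewrite gtr0_norm].
apply: (le_trans B1); rewrite mulrAC mulrC ler_wpM2l ?(ltW s0)//.
apply: ler_pM => //; first exact: sqr1_ge0.
  have : L <= L ^+ 2 by rewrite expr2 ler_peMl.
  have : 0 <= M ^+ 2 - M by rewrite subr_ge0 expr2 ler_peMl.
  by have := LX 2; rewrite {2}/M; lra.
apply: le_trans (Vw x); rewrite -{1}[1 + _]expr1; exact: powV.
Qed.

Variable y : R.

(** Apart from the difference of the drifts, these are the terms of order [h ^+ 2] or higher in the
    cubic expansion of the exponential, with [exp_u] split into a part of order [sqrt h] and the
    part [h * exp_k]. The terms of lower order form [exp_err_z], sorted by [x], [x ^+ 2 - 1] and
    [x ^+ 3]. *)
Definition exp_err_m x := (a X - a y) * h +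
  X * (2^-1 * h ^+ 2 * exp_k x ^+ 2 +
    6^-1 * (3 * rel_diffusion X ^+ 2 * x ^+ 2 * h ^+ 2 * exp_k x +
      3 * rel_diffusion X * s * x * h ^+ 2 * exp_k x ^+ 2 + h ^+ 3 * exp_k x ^+ 3) +
    (expR (exp_u x) - 1 - exp_u x - exp_u x ^+ 2 / 2 - exp_u x ^+ 3 / 6)).

Definition exp_z1 := s * (b X - b y) + h * (b X * s * rel_drift X).
Definition exp_z2 := 2^-1 * h * (rk_slope b h X - rk_slope b h y) +
  2^-1 * h * (b' X * b X - rk_slope b h X).
Definition exp_z3 := h * (2^-1 * b X * s * rel_correction X + 6^-1 * rel_diffusion X ^+ 2 * b X * s).
Definition exp_err_z x := exp_z1 * x + exp_z2 * (x ^+ 2 - 1) + exp_z3 * x ^+ 3.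

(** The identity behind the scheme is [X * (rel_correction X + rel_diffusion X ^+ 2) = b' X * b X]:
    the correction in the exponent and the square of its diffusion part add up to the Milstein
    coefficient, while the term [- 2^-1 * b' b] of [rel_drift] supplies the compensator of
    [dB ^+ 2]. *)
Lemma exp_err_decomposition x :
  exp_step h X (s * x) - rk_step a b h y (s * x) =
   (X - y) + (exp_err_m x + exp_err_z x).
Proof.
rewrite exp_step_scaled rk_step_scaled ?(ltW h0)// -/s.
rewrite /exp_err_m /exp_err_z /exp_z1 /exp_z2 /exp_z3 /exp_u /exp_k.
have Ea : a X = X * rel_drift X + 2^-1 * (b' X * (X * rel_diffusion X)).
  by rewrite rel_driftE rel_diffusionE; ring.
rewrite Ea -[b X]rel_diffusionE /rel_correction.
by rewrite -ss; field.
Qed.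

Let kap := h * (1 + X ^+ 2).
Let kap0 : 0 <= kap. Proof. by rewrite mulr_ge0 ?(ltW h0)// sqr1_ge0. Qed.
Let XK : h * `|X| <= kap. Proof. by rewrite ler_wpM2l ?(ltW h0)// norm_le_sqr1. Qed.

Lemma exp_err_m_le x : `|exp_err_m x| <= h * (`|X - y| + kap) * (8 * M ^+ 4 * exp_w x).
Proof.
have V1 : 1 <= V x by rewrite exprn_ege1// sqr1_ge1.
set v := 1 + x ^+ 2.
have v0 : 0 <= v by exact: sqr1_ge0.
have k2 : `|exp_k x ^+ 2| <= M ^+ 2 * v ^+ 2.
  by rewrite -exprMn normrX lerXn2r ?nnegrE ?mulr_ge0//; exact: exp_k_le.
have k3 : `|exp_k x ^+ 3| <= M ^+ 3 * v ^+ 3.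
  by rewrite -exprMn normrX lerXn2r ?nnegrE ?mulr_ge0//; exact: exp_k_le.
have LM : L <= M.
  have : L <= L ^+ 2 by rewrite expr2 ler_peMl.
  by have := LX 2; rewrite /M; lra.
have fM : `|rel_diffusion X| <= M by apply: le_trans (rel_diffusion_le X) LM.
have f2 : `|rel_diffusion X ^+ 2| <= M ^+ 2.
  by rewrite normrX lerXn2r ?nnegrE.
have T1 : `|2^-1 * h ^+ 2 * exp_k x ^+ 2| <= 2^-1 * h ^+ 2 * (M ^+ 4 * V x).
  apply: norm_leM; first by rewrite ger0_norm// mulr_ge0// exprn_ge0// ltW.
  apply: (le_trans k2); apply: ler_pM; rewrite ?exprn_ge0//; last exact: powV.
  by rewrite ler_weXn2l.
have T2 : `|3 * rel_diffusion X ^+ 2 * x ^+ 2 * h ^+ 2 * exp_k x| <= 3 * h ^+ 2 * (M ^+ 4 * V x).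
  have -> : 3 * rel_diffusion X ^+ 2 * x ^+ 2 * h ^+ 2 * exp_k x =
    3 * h ^+ 2 * (rel_diffusion X ^+ 2 * exp_k x * x ^+ 2) by ring.
  apply: norm_leM; first by rewrite ger0_norm// mulr_ge0// exprn_ge0// ltW.
  apply: (@le_trans _ _ (M ^+ 2 * (M * v) * v)).
    apply: norm_leM; last by rewrite ger0_norm ?sqr_ge0// lerDr.
    by apply: norm_leM => //; exact: exp_k_le.
  have -> : M ^+ 2 * (M * v) * v = M ^+ 3 * v ^+ 2 by ring.
  by apply: ler_pM; rewrite ?exprn_ge0//; [rewrite ler_weXn2l|exact: powV].
have T3 : `|3 * rel_diffusion X * s * x * h ^+ 2 * exp_k x ^+ 2| <= 3 * h ^+ 2 * (M ^+ 4 * V x).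
  have -> : 3 * rel_diffusion X * s * x * h ^+ 2 * exp_k x ^+ 2 =
    3 * h ^+ 2 * (s * (rel_diffusion X * exp_k x ^+ 2 * x)) by ring.
  apply: norm_leM; first by rewrite ger0_norm// mulr_ge0// exprn_ge0// ltW.
  apply: (@le_trans _ _ (1 * (M * (M ^+ 2 * v ^+ 2) * v))).
    apply: norm_leM; first by rewrite gtr0_norm.
    apply: norm_leM; last exact: norm_le_sqr1.
    by apply: norm_leM.
  have -> : 1 * (M * (M ^+ 2 * v ^+ 2) * v) = M ^+ 3 * v ^+ 3 by ring.
  by apply: ler_pM; rewrite ?exprn_ge0//; [rewrite ler_weXn2l|exact: powV].
have T4 : `|h ^+ 3 * exp_k x ^+ 3| <= h ^+ 2 * (M ^+ 4 * V x).
  apply: norm_leM.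
    rewrite ger0_norm ?exprn_ge0 ?(ltW h0)// exprSr ler_piMr// exprn_ge0// ltW//.
  apply: (le_trans k3).
  by apply: ler_pM; rewrite ?exprn_ge0//; [rewrite ler_weXn2l|exact: powV].
have W0 : 0 <= exp_w x by apply: le_trans (exp_w_ge1 x).
have T6 : `|6^-1 * (3 * rel_diffusion X ^+ 2 * x ^+ 2 * h ^+ 2 * exp_k x +
      3 * rel_diffusion X * s * x * h ^+ 2 * exp_k x ^+ 2 + h ^+ 3 * exp_k x ^+ 3)| <=
    6^-1 * (3 * h ^+ 2 * (M ^+ 4 * V x) + 3 * h ^+ 2 * (M ^+ 4 * V x) + h ^+ 2 * (M ^+ 4 * V x)).
  apply: norm_leM; first by rewrite ger0_norm.
  by apply: norm_leD => //; apply: norm_leD.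
have T7 := norm_leM (lexx `|X|) (norm_leD (norm_leD T1 T6) (exp_remainder4_le x)).
have T8 : `|(a X - a y) * h| <= L * `|X - y| * h.
  by apply: norm_leM; [exact: ld_lip Ha _ _|rewrite gtr0_norm].
apply: (le_trans (norm_leD T8 T7)).
set p := M ^+ 4.
have p1 : 1 <= p by rewrite exprn_ege1.
have p0 : 0 <= p by apply: le_trans p1.
have Lp : L <= p by apply: (le_trans LM); rewrite /p -{1}[M]expr1 ler_weXn2l.
have g1 : L * (`|X - y| * h) <= p * (`|X - y| * h * exp_w x).
  by apply: ler_pM => //; rewrite ?mulr_ge0 ?(ltW h0)// ler_peMr ?mulr_ge0 ?(ltW h0)// exp_w_ge1.
have hX0 : 0 <= h * (h * `|X|) by rewrite !mulr_ge0 ?(ltW h0).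
have g2 : h * (h * `|X|) * (p * V x) <= h * (h * `|X|) * (p * exp_w x).
  by rewrite ler_wpM2l// ler_wpM2l.
have g3 : h * (h * `|X|) * (p * exp_w x) <= h * kap * (p * exp_w x).
  by rewrite ler_wpM2r ?mulr_ge0// ler_wpM2l// ltW.
have g4 : 0 <= h * kap * (p * exp_w x).
  exact: mulr_ge0 (mulr_ge0 (ltW h0) kap0) (mulr_ge0 p0 W0).
have g5 : 0 <= p * (`|X - y| * h * exp_w x) by rewrite !mulr_ge0 ?(ltW h0).
have -> : `|X| * (2^-1 * h ^+ 2 * (p * V x) +
  6^-1 * (3 * h ^+ 2 * (p * V x) + 3 * h ^+ 2 * (p * V x) + h ^+ 2 * (p * V x)) +
   p * h ^+ 2 * exp_w x) = (5 / 3) * (h * (h * `|X|) * (p * V x)) + h * (h * `|X|) * (p * exp_w x).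
  by field.
have -> : L * `|X - y| * h = L * (`|X - y| * h) by ring.
lra.
Qed.

Lemma exp_err_z_le x : `|exp_err_z x| <= s * (`|X - y| + kap) * (8 * M ^+ 4 * exp_w x).
Proof.
set v := 1 + x ^+ 2; set E := `|X - y|.
have v0 : 0 <= v by exact: sqr1_ge0.
have bXle := ld_norm X Hb.
have D1 : `|exp_z1| <= s * (L * E) + h * (L * `|X| * s * (2 * L ^+ 2)).
  apply: norm_leD; apply: norm_leM; rewrite ?(gtr0_norm s0) ?(gtr0_norm h0)//.
    exact: ld_lip Hb _ _.
  apply: norm_leM; last exact: rel_drift_le.
  by apply: norm_leM => //; rewrite gtr0_norm.
have D2 : `|exp_z2| <= 3 * L ^+ 2 * (s * E) + h * (L ^+ 3 * X ^+ 2 * s).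
  have hh : 2^-1 * h <= h by have := ltW h0; lra.
  apply: norm_leD.
    rewrite normrM ger0_norm ?mulr_ge0 ?(ltW h0)//.
    apply: (@le_trans _ _ (h * `|rk_slope b h X - rk_slope b h y|)); first by rewrite ler_wpM2r.
    have H := rk_slope_lip Hb y X h01.
    have -> : h * `|rk_slope b h X - rk_slope b h y| = s * (s * `|rk_slope b h X - rk_slope b h y|).
      by rewrite mulrA ss.
    have -> : 3 * L ^+ 2 * (s * E) = s * (3 * L ^+ 2 * E) by ring.
    by rewrite ler_wpM2l// ltW.
  apply: norm_leM; first by rewrite ger0_norm ?mulr_ge0 ?(ltW h0).
  by rewrite distrC; exact: (rk_slope_approx Hb X h0).
have D3 : `|exp_z3| <= h * (2^-1 * (L * `|X|) * s * (2 * L ^+ 2) + 6^-1 * L ^+ 2 * (L * `|X|) * s).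
  apply: norm_leM; first by rewrite gtr0_norm.
  apply: norm_leD.
    apply: norm_leM; last exact: rel_correction_le.
    apply: norm_leM; last by rewrite gtr0_norm.
    by apply: norm_leM => //; rewrite ger0_norm.
  apply: norm_leM; last by rewrite gtr0_norm.
  apply: norm_leM => //; apply: norm_leM; first by rewrite ger0_norm.
  by rewrite normrX lerXn2r ?nnegrE//; exact: rel_diffusion_le.
have x3 : `|x ^+ 3| <= V x.
  rewrite normrX; apply: (@le_trans _ _ ((1 + x ^+ 2) ^+ 3)); last exact: powV.
  by rewrite lerXn2r ?nnegrE ?sqr1_ge0// norm_le_sqr1.
have vV : v <= V x by rewrite -[v]expr1; exact: powV.
have x1 : `|x| <= V x by apply: le_trans vV; exact: norm_le_sqr1.
have x2 : `|x ^+ 2 - 1| <= V x by apply: le_trans vV; exact: normB1_le_sqr1.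
have T := norm_leD (norm_leD (norm_leM D1 x1) (norm_leM D2 x2)) (norm_leM D3 x3).
apply: (le_trans T); rewrite -!mulrDl.
have -> : s * (E + kap) * (8 * M ^+ 4 * exp_w x) = s * (E + kap) * (8 * M ^+ 4) * exp_w x.
  by rewrite !mulrA.
apply: ler_pM; rewrite ?V0//.
  exact: addr_ge0 (addr_ge0 (le_trans (normr_ge0 _) D1) (le_trans (normr_ge0 _) D2)) (le_trans (normr_ge0 _) D3).
have sE0 : 0 <= s * E by exact: mulr_ge0 (ltW s0) (normr_ge0 _).
have sk0 : 0 <= s * kap by exact: mulr_ge0 (ltW s0) kap0.
have shX : s * (h * `|X|) <= s * kap by rewrite ler_wpM2l// ltW.
have shX2 : s * (h * X ^+ 2) <= s * kap.
  by rewrite ler_wpM2l ?(ltW s0)// ler_wpM2l ?(ltW h0)// lerDr.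
set p := M ^+ 4.
have Lp i : (i <= 4)%N -> L ^+ i <= p.
  move=> i4; apply: (@le_trans _ _ (L ^+ 4)); first by rewrite ler_weXn2l.
  rewrite /p lerXn2r ?nnegrE//.
  have : L <= L ^+ 2 by rewrite expr2 ler_peMl.
  by have := LX 2; rewrite /M; lra.
have LpM i t : (i <= 4)%N -> 0 <= t -> L ^+ i * t <= p * t.
  by move=> i4 t0; rewrite ler_wpM2r// Lp.
have g1 := LpM 1%N _ isT sE0; have g2 := LpM 2%N _ isT sE0.
have g3 : L ^+ 3 * (s * (h * `|X|)) <= p * (s * kap).
  by apply: ler_pM => //; [exact: mulr_ge0 (ltW s0) (mulr_ge0 (ltW h0) (normr_ge0 X))|exact: Lp].
have g4 : L ^+ 3 * (s * (h * X ^+ 2)) <= p * (s * kap).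
  by apply: ler_pM => //; [exact: mulr_ge0 (ltW s0) (mulr_ge0 (ltW h0) (sqr_ge0 X))|exact: Lp].
have -> : s * (L * E) + h * (L * `|X| * s * (2 * L ^+ 2)) +
  (3 * L ^+ 2 * (s * E) + h * (L ^+ 3 * X ^+ 2 * s)) +
  h * (2^-1 * (L * `|X|) * s * (2 * L ^+ 2) + 6^-1 * L ^+ 2 * (L * `|X|) * s) =
  L ^+ 1 * (s * E) + 3 * (L ^+ 2 * (s * E)) + (3 + 6^-1) * (L ^+ 3 * (s * (h * `|X|))) +
  L ^+ 3 * (s * (h * X ^+ 2)).
  by field.
have p0 : 0 <= p by rewrite exprn_ge0.
have := mulr_ge0 p0 sE0; have := mulr_ge0 p0 sk0; lra.
Qed.

End fixed_step.
End exponential_step.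

Section exponential_step_integrals.
Context {R : realType}.
Implicit Types x : R.
Variables (a a' b b' : R -> R) (L : R).
Hypothesis (Ha : lipschitz_diff L a a') (Hb : lipschitz_diff L b b').
Local Notation gamma := (normal_prob (0 : R) 1).

Let L1 : 1 <= L := ld_ge1 Hb.
Let M := 4 * L ^+ 2.
Let M4 : 4 <= M. Proof. by rewrite /M ler_peMr// exprn_ege1. Qed.
Let M1 : 1 <= M. Proof. by have := M4; lra. Qed.
Let M0 : 0 <= M. Proof. exact: le_trans M1. Qed.

Lemma gauss_exp_w_moment (n : nat) : (0 < n)%N -> exists2 C : R, 0 <= C &
  (\int[gamma]_x (exp_w n x ^+ n)%:E <= C%:E)%E.
Proof.
(* The exponent [4^-1] of [gauss_expR_moment] is shared equally: [8^-1] absorbs the polynomial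
   factor and [8^-1] is the exponential factor of the weight. *)
move=> n0; have t0 : 0 < (8^-1 : R) by rewrite invr_gt0.
have [K K0 HK] := sqr1X_le_expR (R := R) (4 * n) t0; have [C C0 HC] := gauss_expR_moment (R := R).
exists (K * expR 8^-1 * C); first by rewrite !mulr_ge0 ?expR_ge0.
have mw : measurable_fun [set: R] (fun x : R => exp_w n x ^+ n) by rewrite /exp_w; mfun.
apply: (@le_trans _ _ (\int[gamma]_x (K * expR 8^-1 * expR (4^-1 * x ^+ 2))%:E)%E).
  apply: le_intE => //; first by mfun.
  - by move=> x; rewrite exprn_ge0// (le_trans _ (exp_w_ge1 n x)).
  - move=> x; rewrite /exp_w exprMn -exprM -expRM_natl.
    have -> : n%:R * ((8 * n%:R)^-1 * (1 + x ^+ 2)) = 8^-1 + 8^-1 * x ^+ 2 :> R.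
      by field; rewrite pnatr_eq0 -lt0n.
    have -> : expR (4^-1 * x ^+ 2) = expR (8^-1 * x ^+ 2) * expR (8^-1 * x ^+ 2).
      by rewrite -expRD; congr expR; field.
    have -> : K * expR 8^-1 * (expR (8^-1 * x ^+ 2) * expR (8^-1 * x ^+ 2)) =
      K * expR (8^-1 * x ^+ 2) * expR (8^-1 + 8^-1 * x ^+ 2) by rewrite expRD; ring.
    by rewrite ler_wpM2r ?expR_ge0.
rewrite intEZ//; last 2 first.
- by mfun.
- by rewrite mulr_ge0 ?expR_ge0.
by rewrite [leRHS]EFinM lee_wpmul2l// lee_fin mulr_ge0 ?expR_ge0.
Qed.

Let mexp_w n : measurable_fun [set: R] (@exp_w R n).
Proof. by rewrite /exp_w; mfun. Qed.

Lemma exp_step_moment (n : nat) : ~~ odd n -> (1 < n)%N ->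
  exists2 C : R, 0 <= C & forall h X, 0 < h <= 1 ->
  M * Num.sqrt h <= (8 * n%:R)^-1 ->
  (\int[gamma]_x ((exp_step a b b' h X (Num.sqrt h * x)) ^+ n)%:E <=
    ((1 + C * h) * X ^+ n)%:E)%E.
Proof.
move=> nodd n1; have [C C0 HC] := gauss_exp_w_moment (ltnW n1).
pose K := 2 * M ^+ 2.
have K1 : 1 <= K by have : 1 <= M ^+ 2 by [rewrite exprn_ege1]; rewrite /K; lra.
have K0 : 0 <= K by apply: le_trans K1.
pose CC := 2 ^+ n * step_const n * (K ^+ n * C).
exists CC; first by rewrite !mulr_ge0 ?exprn_ge0 ?step_const_ge0.
move=> h X h01 hM; have [s0 s1 hs ss] := sqrt_le1 h01.
case/andP: (h01) => h0 h1.
under eq_integral do rewrite (exp_mom_decomposition a b b' X h01).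
have -> : (1 + CC * h) * X ^+ n = (1 + CC * h) * X ^+ n + CC * h * 0 ^+ n.
  by rewrite expr0n gtn_eqF ?mulr0 ?addr0// ltnW.
pose w x := K * exp_w n x.
have mk : measurable_fun [set: R] (exp_k a b b' X) by rewrite /exp_k; mfun.
have mu : measurable_fun [set: R] (exp_u a b b' h X) by rewrite /exp_u; mfun.
apply: (@step_integral R _ (measurableTypeR R) gamma n h X 0 (K ^+ n * C) w
  (exp_mom_m a b b' h X) (exp_mom_z b h X)) => //.
- exact: probability_setT.
- by rewrite (ltW h0).
- by move=> x; rewrite /w -[leLHS]mulr1 ler_pM// exp_w_ge1.
- by move=> x; rewrite addr0; exact: (exp_mom_m_le Ha Hb X h01 hM).
- by move=> x; rewrite addr0; exact: (exp_mom_z_le Hb n X h01).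
- by have me := mexp_w n; rewrite /w; mfun.
- by rewrite /exp_mom_m; mfun.
- by rewrite /exp_mom_z; mfun.
- have me := mexp_w n.
  rewrite /w; under eq_integral do rewrite exprMn.
  rewrite intEZ; [|by mfun|by move=> x; rewrite exprn_ge0// (le_trans _ (exp_w_ge1 n x))|by rewrite exprn_ge0].
  by rewrite EFinM lee_wpmul2l// lee_fin exprn_ge0.
- rewrite -[RHS](gauss_cubic 0 (X * (rel_diffusion b X * Num.sqrt h)) 0 0).
  by apply: eq_integral => x _; congr EFin; rewrite /exp_mom_z; ring.
Qed.

Lemma exp_step_error (n : nat) : ~~ odd n -> (1 < n)%N ->
  exists2 C : R, 0 <= C & forall h X y, 0 < h <= 1 ->
  M * Num.sqrt h <= (8 * n%:R)^-1 ->
  (\int[gamma]_x ((exp_step a b b' h X (Num.sqrt h * x) -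
     rk_step a b h y (Num.sqrt h * x)) ^+ n)%:E <=
    ((1 + C * h) * (X - y) ^+ n + C * h * (h * (1 + X ^+ 2)) ^+ n)%:E)%E.
Proof.
move=> nodd n1; have [C C0 HC] := gauss_exp_w_moment (ltnW n1).
pose K := 8 * M ^+ 4.
have K1 : 1 <= K by have : 1 <= M ^+ 4 by [rewrite exprn_ege1]; rewrite /K; lra.
have K0 : 0 <= K by apply: le_trans K1.
pose CC := 2 ^+ n * step_const n * (K ^+ n * C).
exists CC; first by rewrite !mulr_ge0 ?exprn_ge0 ?step_const_ge0.
move=> h X y h01 hM; have [s0 s1 hs ss] := sqrt_le1 h01.
case/andP: (h01) => h0 h1.
under eq_integral do rewrite (exp_err_decomposition Ha Hb X h01).
pose w x := K * exp_w n x.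
have mk : measurable_fun [set: R] (exp_k a b b' X) by rewrite /exp_k; mfun.
have mu : measurable_fun [set: R] (exp_u a b b' h X) by rewrite /exp_u; mfun.
apply: (@step_integral R _ (measurableTypeR R) gamma n h (X - y) (h * (1 + X ^+ 2)) (K ^+ n * C) w
  (exp_err_m a b b' h X y) (exp_err_z a b b' h X y)) => //.
- exact: probability_setT.
- by rewrite (ltW h0).
- by rewrite mulr_ge0 ?sqr1_ge0// ltW.
- by move=> x; rewrite /w -[leLHS]mulr1 ler_pM// exp_w_ge1.
- by move=> x; exact: (exp_err_m_le Ha Hb X h01 hM).
- by move=> x; exact: (exp_err_z_le Ha Hb n X h01).
- by have me := mexp_w n; rewrite /w; mfun.
- by rewrite /exp_err_m; mfun.
- by rewrite /exp_err_z; mfun.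
- have me := mexp_w n.
  rewrite /w; under eq_integral do rewrite exprMn.
  rewrite intEZ; [|by mfun|by move=> x; rewrite exprn_ge0// (le_trans _ (exp_w_ge1 n x))|by rewrite exprn_ge0].
  by rewrite EFinM lee_wpmul2l// lee_fin exprn_ge0.
- by rewrite -[RHS](gauss_cubic 0 (exp_z1 a b b' h X y) (exp_z2 b b' h X y) (exp_z3 b b' h X));
    apply: eq_integral => x _; congr EFin; rewrite /exp_err_z add0r.
Qed.

End exponential_step_integrals.

(** * Schemes driven by the Wiener process *)

Lemma measurable_invr {R : realType} : measurable_fun [set: R] (@GRing.inv R).
Proof.
have -> : [set: R] = [set 0] `|` ~` [set 0] by rewrite setUv.
apply/measurable_funU => //; first exact: measurableC.
split; first exact: measurable_fun_set1.
apply: open_continuous_measurable_fun; first exact: closed_openC.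
by move=> x /[!inE]/= /eqP x0; exact: inv_continuous.
Qed.

Section schemes.
Context {R : realType} {d : measure_display} {Omega : measurableType d}.
Variables (P : probability Omega R) (Filt : R -> set (set Omega)).
Variable (B : R -> Omega -> R).
Hypothesis HF : is_filtration Filt.
Hypothesis HB : is_wiener P Filt B.
Variables (a a' b b' : R -> R) (L : R).
Hypothesis (Ha : lipschitz_diff L a a') (Hb : lipschitz_diff L b b').
Variable x0 : R.

Definition dB (h : R) (n : nat) (w : Omega) := B (n.+1%:R * h) w - B (n%:R * h) w.

Fixpoint one_step_scheme (step : R -> R -> R -> R) (h : R) (n : nat) (w : Omega) : R :=
  if n is m.+1 then step h (one_step_scheme step h m w) (dB h m w) else x0.

Definition rk_scheme := one_step_scheme (rk_step a b).

Definition xp_scheme := one_step_scheme (exp_step a b b').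

Lemma time_ge0 (h : R) (n : nat) : 0 < h -> 0 <= n%:R * h.
Proof. by move=> h0; rewrite mulr_ge0// ltW. Qed.

Lemma time_lt (h : R) (n : nat) : 0 < h -> n%:R * h < n.+1%:R * h.
Proof. by move=> h0; rewrite ltr_pM2r// ltr_nat. Qed.

Lemma timeB (h : R) (n : nat) : n.+1%:R * h - n%:R * h = h.
Proof. by rewrite -mulrBl -natrB// subSnn mul1r. Qed.

Lemma dB_Fmeas h n : 0 < h -> Fmeas Filt (n.+1%:R * h) (dB h n).
Proof.
move=> h0; apply: (wiener_increment_Fmeas HF HB); first exact: time_ge0.
by apply: ltW; exact: time_lt.
Qed.

Lemma one_step_Fmeas step h n : 0 < h ->
  (forall d' (T : measurableType d') (f g : T -> R), measurable_fun [set: T] f ->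
    measurable_fun [set: T] g -> measurable_fun [set: T] (fun t => step h (f t) (g t))) ->
  Fmeas Filt (n%:R * h) (one_step_scheme step h n).
Proof.
move=> h0 mstep; elim: n => [|n IH]; first exact: measurable_cst.
apply: mstep; last exact: dB_Fmeas.
by apply: (Fmeas_le HF _ _ IH); [exact: time_ge0|apply: ltW; exact: time_lt].
Qed.

Lemma measurable_exp_step d' (T : measurableType d') h (f g : T -> R) :
  measurable_fun [set: T] f -> measurable_fun [set: T] g ->
  measurable_fun [set: T] (fun t => exp_step a b b' h (f t) (g t)).
Proof.
move=> mf mg.
have mb : measurable_fun [set: R] b := measurable_lipschitz (ld_lip Hb).
have ma : measurable_fun [set: R] a := measurable_lipschitz (ld_lip Ha).
have mb' : measurable_fun [set: R] b' := measurable_lipschitz (ld_lip' Hb).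
have mi := @measurable_invr R.
have m1 : measurable_fun [set: R] (rel_diffusion b) by rewrite /rel_diffusion; mfun.
have m2 : measurable_fun [set: R] (rel_drift a b b') by rewrite /rel_drift; mfun.
have m3 : measurable_fun [set: R] (rel_correction b b') by rewrite /rel_correction; mfun.
have m1f := measurableT_comp m1 mf.
have m2f := measurableT_comp m2 mf.
have m3f := measurableT_comp m3 mf.
by rewrite /exp_step; mfun.
Qed.

Lemma rk_scheme_Fmeas h n : 0 < h -> Fmeas Filt (n%:R * h) (rk_scheme h n).
Proof.
by move=> h0; apply: one_step_Fmeas => // *; apply: (measurable_rk_step Ha Hb).
Qed.

Lemma xp_scheme_Fmeas h n : 0 < h -> Fmeas Filt (n%:R * h) (xp_scheme h n).
Proof. by move=> h0; apply: one_step_Fmeas => // *; apply: measurable_exp_step. Qed.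

Lemma measurable_rk_scheme h n : 0 < h -> measurable_fun [set: Omega] (rk_scheme h n).
Proof.
by move=> h0; have mS := rk_scheme_Fmeas (n := n) h0; exact (Fmeas_measurable HF (time_ge0 n h0) mS).
Qed.

Lemma measurable_xp_scheme h n : 0 < h -> measurable_fun [set: Omega] (xp_scheme h n).
Proof.
by move=> h0; have mS := xp_scheme_Fmeas (n := n) h0; exact (Fmeas_measurable HF (time_ge0 n h0) mS).
Qed.

Lemma expect_scheme_le d' (S : measurableType d') (h : R) (n : nat)
    (Z : Omega -> S) (Psi : S * R -> R) (K : S -> R) :
  0 < h -> Fmeas Filt (n%:R * h) Z ->
  measurable_fun [set: S * R] Psi -> (forall x, 0 <= Psi x) ->
  measurable_fun [set: S] K ->
  (forall z, \int[normal_prob 0 1]_x (Psi (z, Num.sqrt h * x))%:E <= (K z)%:E)%E ->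
  (\int[P]_w (Psi (Z w, dB h n w))%:E <= \int[P]_w (K (Z w))%:E)%E.
Proof.
move=> h0 mZ mPsi Psi0 mK PsiK.
apply: (expect_wiener_increment_le HF HB (time_ge0 n h0) (time_lt n h0) mZ mPsi Psi0 mK).
by move=> z; rewrite timeB.
Qed.

Lemma scheme_moment (step : R -> R -> R -> R) (q : nat) (C h : R) : ~~ odd q ->
  0 <= C -> 0 < h ->
  (forall d' (T : measurableType d') (f g : T -> R), measurable_fun [set: T] f ->
    measurable_fun [set: T] g -> measurable_fun [set: T] (fun t => step h (f t) (g t))) ->
  (forall y, \int[normal_prob 0 1]_x ((step h y (Num.sqrt h * x)) ^+ q)%:E <=
    ((1 + C * h) * y ^+ q)%:E)%E ->
  forall n, (\int[P]_w (one_step_scheme step h n w ^+ q)%:E <=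
    (expR (C * (n%:R * h)) * x0 ^+ q)%:E)%E.
Proof.
move=> qodd C0 h0 mstep Hstep n.
have H : forall n, (n <= n)%N -> (\int[P]_w (one_step_scheme step h n w ^+ q)%:E <=
    (expR (n%:R * (C * h)) * (x0 ^+ q + 0))%:E)%E.
  move=> N _; apply: (@discrete_gronwall _ (fun n => \int[P]_w (one_step_scheme step h n w ^+ q)%:E)%E N) => //.
  - by rewrite mulr_ge0// ltW.
  - by rewrite exprn_even_ge0.
  - by rewrite /= intE_cst//; exact: probability_setT.
  move=> m mN; rewrite mulr0 adde0.
  have Ch : 0 <= 1 + C * h by rewrite addr_ge0// mulr_ge0// ltW.
  have mS := one_step_Fmeas (n := m) h0 mstep.
  have mSm := Fmeas_measurable HF (time_ge0 m h0) mS.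
  rewrite -intEZ//; [|by mfun|by move=> w; rewrite exprn_even_ge0].
  apply: (@expect_scheme_le _ R h m (one_step_scheme step h m)
    (fun zx => step h zx.1 zx.2 ^+ q) (fun z => (1 + C * h) * z ^+ q)) => //.
  - by apply: measurable_funX; apply: mstep; [exact: measurable_fst|exact: measurable_snd].
  - by move=> x; rewrite exprn_even_ge0.
  - by mfun.
have := H n (leqnn n); rewrite addr0.
by rewrite (_ : n%:R * (C * h) = C * (n%:R * h))//; ring.
Qed.

End schemes.

(** * Comparison of the schemes with each other *)

Section scheme_comparison.
Context {R : realType} {d : measure_display} {Omega : measurableType d}.
Variables (P : probability Omega R) (Filt : R -> set (set Omega)).
Variable (B : R -> Omega -> R).
Hypothesis HF : is_filtration Filt.
Hypothesis HB : is_wiener P Filt B.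
Variables (a a' b b' : R -> R) (L : R).
Hypothesis (Ha : lipschitz_diff L a a') (Hb : lipschitz_diff L b b').
Variable x0 : R.
Variable q : nat.
Hypotheses (qodd : ~~ odd q) (q1 : (1 < q)%N).

Local Notation rk := (rk_scheme B a b x0).
Local Notation xp := (xp_scheme B a b b' x0).
Local Notation "'EE' f" := (\int[P]_w (f w)%:E)%E (at level 10, f at level 9).

Let mrk n h (h0 : 0 < h) : measurable_fun [set: Omega] (rk h n) :=
  measurable_rk_scheme HF HB Ha Hb x0 n h0.
Let mxp n h (h0 : 0 < h) : measurable_fun [set: Omega] (xp h n) :=
  measurable_xp_scheme HF HB Ha Hb x0 n h0.

(** Local errors are quadratic in the state, so that their q-th moments cost moments of order
    [2 * q] of the scheme. *)
Lemma sqr1_moment_le (S : Omega -> R) (mom h : R) : 0 <= h ->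
  measurable_fun [set: Omega] S ->
  (\int[P]_w (S w ^+ (2 * q))%:E <= mom%:E)%E ->
  (\int[P]_w ((h * (1 + S w ^+ 2)) ^+ q)%:E <= (h ^+ q * (2 ^+ q * (1 + mom)))%:E)%E.
Proof.
move=> h0 mS HS.
have S0 w : 0 <= S w ^+ (2 * q) by rewrite exprM exprn_ge0// sqr_ge0.
apply: (@le_trans _ _ (\int[P]_w (h ^+ q * 2 ^+ q * (1 + S w ^+ (2 * q)))%:E)%E).
  apply: le_intE; [by mfun|by mfun| |].
  - by move=> w; rewrite exprn_ge0// mulr_ge0// sqr1_ge0.
  - move=> w; rewrite exprMn -mulrA ler_wpM2l ?exprn_ge0//.
    apply: (le_trans (exprD_le q ler01 (sqr_ge0 _))).
    by rewrite expr1n -exprM.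
rewrite intEZ; [|by mfun|by move=> w; rewrite addr_ge0|by rewrite mulr_ge0 ?exprn_ge0].
rewrite intED; [|by mfun|by mfun|by []|exact: S0].
rewrite intE_cst; last exact: probability_setT.
rewrite [in leRHS]mulrA [leRHS]EFinM lee_wpmul2l//; first by rewrite lee_fin mulr_ge0 ?exprn_ge0.
by rewrite EFinD leeD2l.
Qed.

Lemma rk_scheme_moment (T : R) : 0 <= T -> exists2 mom : R, 0 <= mom &
  forall h n, 0 < h <= 1 -> n%:R * h <= T ->
  (\int[P]_w (rk h n w ^+ (2 * q))%:E <= mom%:E)%E.
Proof.
move=> T0.
have q2odd : ~~ odd (2 * q) by rewrite oddM.
have q21 : (1 < 2 * q)%N by lia.
have [C C0 HC] := rk_step_moment Ha Hb q2odd q21.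
exists (expR (C * T) * x0 ^+ (2 * q)).
  by rewrite mulr_ge0 ?expR_ge0// exprn_even_ge0.
move=> h n h01 nT; case/andP: (h01) => h0 h1.
have mstep d' (T' : measurableType d') (f g : T' -> R) : measurable_fun [set: T'] f ->
    measurable_fun [set: T'] g -> measurable_fun [set: T'] (fun t => rk_step a b h (f t) (g t)).
  exact: (measurable_rk_step Ha Hb).
apply: (le_trans (scheme_moment HF HB x0 q2odd C0 h0 mstep (fun y => HC h y h01) n)).
rewrite lee_fin ler_wpM2r ?exprn_even_ge0// ler_expR ler_wpM2l//.
Qed.

Lemma xp_scheme_moment (T : R) : 0 <= T -> exists2 mom : R, 0 <= mom &
  forall h n, 0 < h <= 1 -> 4 * L ^+ 2 * Num.sqrt h <= (8 * (2 * q)%:R)^-1 -> n%:R * h <= T ->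
  (\int[P]_w (xp h n w ^+ (2 * q))%:E <= mom%:E)%E.
Proof.
move=> T0.
have q2odd : ~~ odd (2 * q) by rewrite oddM.
have q21 : (1 < 2 * q)%N by lia.
have [C C0 HC] := exp_step_moment Ha Hb q2odd q21.
exists (expR (C * T) * x0 ^+ (2 * q)).
  by rewrite mulr_ge0 ?expR_ge0// exprn_even_ge0.
move=> h n h01 hM nT; case/andP: (h01) => h0 h1.
have mstep d' (T' : measurableType d') (f g : T' -> R) : measurable_fun [set: T'] f ->
    measurable_fun [set: T'] g -> measurable_fun [set: T'] (fun t => exp_step a b b' h (f t) (g t)).
  exact: (measurable_exp_step Ha Hb).
apply: (le_trans (scheme_moment HF HB x0 q2odd C0 h0 mstep (fun y => HC h y h01 hM) n)).
rewrite lee_fin ler_wpM2r ?exprn_even_ge0// ler_expR ler_wpM2l//.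
Qed.

(** The q-th power of the local error, of order [h ^+ q], enters each step with weight [C * h];
    accumulated over at most [T / h] steps it keeps its order. *)
Lemma rk_scheme_doubling (T : R) : 0 <= T -> exists2 K : R, 0 <= K &
  forall h n, 0 < h -> 2 * h <= 1 -> n%:R * (2 * h) <= T ->
  (\int[P]_w ((rk (2 * h) n w - rk h n.*2 w) ^+ q)%:E <= (K * h ^+ q)%:E)%E.
Proof.
move=> T0; have [mom mom0 Hmom] := rk_scheme_moment T0.
have [C C0 HC] := rk_doubling_step Ha Hb qodd q1.
pose K2 := 2 ^+ q * (1 + mom).
have K20 : 0 <= K2 by rewrite mulr_ge0 ?exprn_ge0 ?addr_ge0.
exists (expR (C * T) * K2); first by rewrite mulr_ge0 ?expR_ge0.
move=> h N h0 h2 NT.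
have h1 : h <= 1 by apply: le_trans h2; rewrite ler_peMl ?ler1n// ltW.
have h20 : 0 < 2 * h by rewrite mulr_gt0.
have n2E n : n%:R * (2 * h) = n.*2%:R * h by rewrite -mul2n natrM; ring.
pose E n := (\int[P]_w ((rk (2 * h) n w - rk h n.*2 w) ^+ q)%:E)%E.
have H := @discrete_gronwall _ E N (C * h) 0 (h ^+ q * K2).
apply: (@le_trans _ _ (expR (N%:R * (C * h)) * (0 + h ^+ q * K2))%:E); last first.
  rewrite lee_fin add0r -mulrA (mulrC (h ^+ q)) ler_wpM2r//.
    by rewrite mulr_ge0 ?exprn_ge0 ?(ltW h0).
  rewrite ler_expR mulrCA ler_wpM2l//; apply: le_trans NT.
  by rewrite ler_wpM2l// ler_peMl ?ler1n// ltW.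
apply: H => //.
- by rewrite mulr_ge0// ltW.
- by rewrite mulr_ge0 ?exprn_ge0// ltW.
- rewrite /E /= (_ : (fun w : Omega => _) = cst 0%E); last first.
    by apply/funext => w /=; rewrite subrr expr0n gtn_eqF// ltnW.
  by rewrite integral0.
move=> n nN; rewrite /E.
have t0 : 0 <= n.*2%:R * h by exact: time_ge0.
pose Z w := (rk (2 * h) n w, rk h n.*2 w).
have mZ : Fmeas Filt (n.*2%:R * h) Z.
  apply: measurable_fun_pair; last exact: (rk_scheme_Fmeas HF HB Ha Hb).
  by have := rk_scheme_Fmeas HF HB Ha Hb x0 (n := n) h20; rewrite n2E.
pose Psi (x : R * R * R * R) := (rk_step a b (2 * h) x.1.1.1 (x.1.2 + x.2) -
  rk_step a b h (rk_step a b h x.1.1.2 x.1.2) x.2) ^+ q.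
pose Kf (z : R * R) := (1 + C * h) * (z.1 - z.2) ^+ q + C * h * (h * (1 + z.2 ^+ 2)) ^+ q.
have m1 : measurable_fun [set: R * R * R * R] (fun x : R * R * R * R => x.1.1.1).
  exact (measurableT_comp measurable_fst (measurableT_comp measurable_fst measurable_fst)).
have m2 : measurable_fun [set: R * R * R * R] (fun x : R * R * R * R => x.1.1.2).
  exact (measurableT_comp measurable_snd (measurableT_comp measurable_fst measurable_fst)).
have m3 : measurable_fun [set: R * R * R * R] (fun x : R * R * R * R => x.1.2).
  exact (measurableT_comp measurable_snd measurable_fst).
have m4 : measurable_fun [set: R * R * R * R] (fun x : R * R * R * R => x.2) by exact: measurable_snd.
have mPsi : measurable_fun [set: R * R * R * R] Psi.
  apply: measurable_funX; apply: measurable_funB.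
    by apply: (measurable_rk_step Ha Hb) => //; mfun.
  by do 2!(apply: (measurable_rk_step Ha Hb) => //).
have mKf : measurable_fun [set: R * R] Kf by rewrite /Kf; mfun.
have HK (z : R * R) : (\int[normal_prob 0 1 \x normal_prob 0 1]_x
     (Psi (z, Num.sqrt h * x.1, Num.sqrt h * x.2))%:E <= (Kf z)%:E)%E.
  exact: (HC h z.2 z.1 h0 h2).
have tE1 : n.*2.+1%:R * h = n.*2%:R * h + h by rewrite -natr1 mulrDl mul1r.
have tE2 : n.*2.+2%:R * h = n.*2.+1%:R * h + h by rewrite -natr1 mulrDl mul1r.
have Psi0 x : 0 <= Psi x by rewrite exprn_even_ge0.
have := expect_two_wiener_increments_le HF HB t0 h0 tE1 tE2 mZ mPsi Psi0 mKf HK.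
have -> : (\int[P]_w (Psi (Z w, B (n.*2.+1%:R * h) w - B (n.*2%:R * h) w,
    B (n.*2.+2%:R * h) w - B (n.*2.+1%:R * h) w))%:E =
    \int[P]_w ((rk (2 * h) n.+1 w - rk h (n.+1).*2 w) ^+ q)%:E)%E.
  apply: eq_integral => w _; congr EFin; rewrite /Psi /Z /= doubleS.
  rewrite /rk_scheme /= /dB; congr ((rk_step _ _ _ _ _ - _) ^+ q).
  by rewrite !n2E doubleS; ring.
move=> H2; apply: (le_trans H2).
have mA := mrk (n) h20; have mB := mrk (n.*2) h0.
have Ch : 0 <= C * h by rewrite mulr_ge0// ltW.
have e1 w : 0 <= (rk (2 * h) n w - rk h n.*2 w) ^+ q by rewrite exprn_even_ge0.
have e2 w : 0 <= (h * (1 + rk h n.*2 w ^+ 2)) ^+ q.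
  by rewrite exprn_ge0// mulr_ge0 ?sqr1_ge0 ?(ltW h0).
rewrite /Kf /Z /= intED; [|by mfun|by mfun| |]; last 2 first.
- by move=> w; rewrite mulr_ge0 ?addr_ge0.
- by move=> w; rewrite mulr_ge0.
rewrite intEZ; [|by mfun|by []|by rewrite addr_ge0].
rewrite intEZ; [|by mfun|by []|by []].
rewrite leeD2l// [leRHS]EFinM lee_wpmul2l//.
apply: sqr1_moment_le => //; first exact: ltW.
apply: Hmom; first by rewrite h0.
rewrite -n2E; apply: le_trans NT; rewrite ler_wpM2r ?(ltW h20)// ler_nat ltnW//.
Qed.

(** The same [K] serves for every number of halvings. The first halving and, by induction from step
    [h / 2], all the others each contribute [K * (h / 2) ^+ q]; by convexity the total is
    [2 ^+ q.-1 * 2 * K * (h / 2) ^+ q], that is [K * h ^+ q]. *)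
Lemma rk_scheme_refine (T : R) : 0 <= T -> exists2 K : R, 0 <= K &
  forall m h n, 0 < h <= 1 -> n%:R * h <= T ->
  (\int[P]_w ((rk h n w - rk (h / 2 ^+ m) (n * 2 ^ m) w) ^+ q)%:E <= (K * h ^+ q)%:E)%E.
Proof.
move=> T0; have [K K0 HK] := rk_scheme_doubling T0.
exists K => // m; elim: m => [|m IH] h n /andP[h0 h1] nT.
  rewrite expr0 invr1 mulr1 expn0 muln1.
  under eq_integral do rewrite subrr expr0n gtn_eqF ?(ltnW q1)//.
  by rewrite integral0 lee_fin mulr_ge0// exprn_ge0// ltW.
have hh0 : 0 < h / 2 by rewrite divr_gt0.
have hE : 2 * (h / 2) = h by rewrite mulrC divfK.
have h2m : 0 < h / 2 / 2 ^+ m by rewrite divr_gt0// exprn_gt0.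
have H1 := HK (h / 2) n hh0; rewrite hE in H1; have {}H1 := H1 h1 nT.
have H2 := IH (h / 2) n.*2.
have {}H2 : (\int[P]_w ((rk (h / 2) n.*2 w - rk (h / 2 / 2 ^+ m) (n.*2 * 2 ^ m) w) ^+ q)%:E <=
   (K * (h / 2) ^+ q)%:E)%E.
  apply: H2; first by rewrite hh0/= (le_trans _ h1)// ler_pdivrMr// ler_peMr ?(ltW h0)// ler1n.
  by rewrite (_ : n.*2%:R * (h / 2) = n%:R * h)// -mul2n natrM; field.
have -> : h / 2 ^+ m.+1 = h / 2 / 2 ^+ m by rewrite exprS invfM mulrA.
have -> : (n * 2 ^ m.+1 = n.*2 * 2 ^ m)%N by rewrite expnS mulnA muln2.
have mA := mrk (n) h0; have mB := mrk (n.*2) hh0.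
have mC := mrk (n.*2 * 2 ^ m) h2m.
set A := rk h n in mA H1 *; set D := rk (h / 2) n.*2 in mB H1 H2 *.
set F := rk _ (n.*2 * 2 ^ m) in mC H2 *.
apply: (@le_trans _ _ (\int[P]_w (2 ^+ q.-1 * ((A w - D w) ^+ q + (D w - F w) ^+ q))%:E)%E).
  apply: le_intE; [by mfun|by mfun|by move=> w; rewrite exprn_even_ge0|].
  move=> w; have -> : A w - F w = (A w - D w) + (D w - F w) by ring.
  by apply: exprD_even_le_convex => //; exact: ltnW.
rewrite intEZ; [|by mfun|by move=> w; rewrite addr_ge0 ?exprn_even_ge0|by rewrite exprn_ge0].
rewrite intED; [|by mfun|by mfun|by move=> w; rewrite exprn_even_ge0..].
apply: (@le_trans _ _ ((2 ^+ q.-1)%:E * ((K * (h / 2) ^+ q)%:E + (K * (h / 2) ^+ q)%:E))%E).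
  by rewrite lee_wpmul2l ?lee_fin ?exprn_ge0// leeD.
rewrite -EFinD -EFinM lee_fin.
have -> : 2 ^+ q.-1 * (K * (h / 2) ^+ q + K * (h / 2) ^+ q) = K * (2 ^+ q.-1.+1 * (h / 2) ^+ q).
  by rewrite (exprS 2); ring.
by rewrite prednK ?(ltnW q1)// -exprMn hE.
Qed.

Lemma xp_rk_scheme_error (T : R) : 0 <= T -> exists2 K : R, 0 <= K &
  forall h n, 0 < h <= 1 -> 4 * L ^+ 2 * Num.sqrt h <= (8 * (2 * q)%:R)^-1 -> n%:R * h <= T ->
  (\int[P]_w ((xp h n w - rk h n w) ^+ q)%:E <= (K * h ^+ q)%:E)%E.
Proof.
move=> T0; have [mom mom0 Hmom] := xp_scheme_moment T0.
have [C C0 HC] := exp_step_error Ha Hb qodd q1.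
pose K2 := 2 ^+ q * (1 + mom).
have K20 : 0 <= K2 by rewrite mulr_ge0 ?exprn_ge0 ?addr_ge0.
exists (expR (C * T) * K2); first by rewrite mulr_ge0 ?expR_ge0.
move=> h N h01 hM NT; case/andP: (h01) => h0 h1.
(* The threshold is stated for the moments of order [2 * q], which bound the local errors; it
   implies the one for the errors of order [q]. *)
have hM' : 4 * L ^+ 2 * Num.sqrt h <= (8 * q%:R)^-1.
  apply: (le_trans hM).
  have q0 : 0 < q%:R :> R by rewrite ltr0n ltnW.
  have c1 : 0 < 8 * q%:R :> R by rewrite mulr_gt0.
  have c2 : 0 < 8 * (2 * q)%:R :> R by rewrite natrM mulr_gt0// mulr_gt0.
  by rewrite lef_pV2 ?posrE// ler_wpM2l// ler_nat leq_pmull.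
pose E n := (\int[P]_w ((xp h n w - rk h n w) ^+ q)%:E)%E.
have H := @discrete_gronwall _ E N (C * h) 0 (h ^+ q * K2).
apply: (@le_trans _ _ (expR (N%:R * (C * h)) * (0 + h ^+ q * K2))%:E); last first.
  rewrite lee_fin add0r -mulrA (mulrC (h ^+ q)) ler_wpM2r//.
    by rewrite mulr_ge0 ?exprn_ge0 ?(ltW h0).
  by rewrite ler_expR mulrCA ler_wpM2l.
apply: H => //.
- by rewrite mulr_ge0// ltW.
- by rewrite mulr_ge0 ?exprn_ge0// ltW.
- rewrite /E /= (_ : (fun w : Omega => _) = cst 0%E); last first.
    by apply/funext => w /=; rewrite subrr expr0n gtn_eqF// ltnW.
  by rewrite integral0.
move=> n nN; rewrite /E.
pose Z w := (xp h n w, rk h n w).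
have mZ : Fmeas Filt (n%:R * h) Z.
  apply: measurable_fun_pair; last exact: (rk_scheme_Fmeas HF HB Ha Hb).
  exact: (xp_scheme_Fmeas HF HB Ha Hb).
pose Psi (x : R * R * R) := (exp_step a b b' h x.1.1 x.2 - rk_step a b h x.1.2 x.2) ^+ q.
pose Kf (z : R * R) := (1 + C * h) * (z.1 - z.2) ^+ q + C * h * (h * (1 + z.1 ^+ 2)) ^+ q.
have m1 : measurable_fun [set: R * R * R] (fun x : R * R * R => x.1.1).
  exact (measurableT_comp measurable_fst measurable_fst).
have m2 : measurable_fun [set: R * R * R] (fun x : R * R * R => x.1.2).
  exact (measurableT_comp measurable_snd measurable_fst).
have m3 : measurable_fun [set: R * R * R] (fun x : R * R * R => x.2) by exact: measurable_snd.
have mPsi : measurable_fun [set: R * R * R] Psi.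
  apply: measurable_funX; apply: measurable_funB.
    exact: (measurable_exp_step Ha Hb).
  exact: (measurable_rk_step Ha Hb).
have mKf : measurable_fun [set: R * R] Kf by rewrite /Kf; mfun.
have HK (z : R * R) : (\int[normal_prob 0 1]_x
     (Psi (z, Num.sqrt h * x))%:E <= (Kf z)%:E)%E.
  exact: (HC h z.1 z.2 h01 hM').
have Psi0 x : 0 <= Psi x by rewrite exprn_even_ge0.
have H2 := expect_scheme_le HF HB h0 mZ mPsi Psi0 mKf HK.
apply: (le_trans H2).
have mA := mxp (n) h0; have mB := mrk (n) h0.
have Ch : 0 <= C * h by rewrite mulr_ge0// ltW.
have e1 w : 0 <= (xp h n w - rk h n w) ^+ q by rewrite exprn_even_ge0.
have e2 w : 0 <= (h * (1 + xp h n w ^+ 2)) ^+ q.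
  by rewrite exprn_ge0// mulr_ge0 ?sqr1_ge0 ?(ltW h0).
rewrite /Kf /Z /= intED; [|by mfun|by mfun| |]; last 2 first.
- by move=> w; rewrite mulr_ge0 ?addr_ge0.
- by move=> w; rewrite mulr_ge0.
rewrite intEZ; [|by mfun|by []|by rewrite addr_ge0].
rewrite intEZ; [|by mfun|by []|by []].
rewrite leeD2l// [leRHS]EFinM lee_wpmul2l//.
apply: sqr1_moment_le => //; first exact: ltW.
apply: Hmom => //.
by apply: le_trans NT; rewrite ler_wpM2r ?(ltW h0)// ler_nat ltnW.
Qed.

End scheme_comparison.

(** * Estimates outside events of small probability *)

Lemma cvg_ereal0_le {R : realType} (u : nat -> \bar R) (eta : R) : 0 < eta ->
  u n @[n --> \oo] --> 0%E -> exists N, forall n, (N <= n)%N -> (u n <= eta%:E)%E.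
Proof.
move=> eta0 cu.
have : \forall n \near \oo, (u n < eta%:E)%E.
  apply: (cu [set y | (y < eta%:E)%E]).
  by apply: open_nbhs_nbhs; split; [exact: open_ereal_lt_ereal|rewrite /= lte_fin].
move=> [N _ HN]; exists N => n Nn; apply: ltW; exact: HN.
Qed.

Section likely.
Context {R : realType} {d : measure_display} {Omega : measurableType d}.
Variable P : probability Omega R.

(* Q holds outside an event of probability at most eta; Q need not be measurable *)
Definition likely (eta : R) (Q : Omega -> Prop) : Prop :=
  exists A, [/\ measurable A, (P A <= eta%:E)%E & forall w, ~ A w -> Q w].

Lemma likely_mono eta eta' (Q Q' : Omega -> Prop) : eta <= eta' ->
  (forall w, Q w -> Q' w) -> likely eta Q -> likely eta' Q'.
Proof.
move=> ee QQ [A [mA PA HA]]; exists A; split => // [|w Aw]; last exact/QQ/HA.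
by apply: (le_trans PA); rewrite lee_fin.
Qed.

Lemma likelyI eta eta' (Q Q' : Omega -> Prop) : likely eta Q -> likely eta' Q' ->
  likely (eta + eta') (fun w => Q w /\ Q' w).
Proof.
move=> [A [mA PA HA]] [A' [mA' PA' HA']]; exists (A `|` A'); split.
- exact: measurableU.
- apply: (@le_trans _ _ (P A + P A')%E); first exact: measureU2.
  by rewrite EFinD leeD.
- by move=> w /not_orP[Aw A'w]; split; [exact: HA|exact: HA'].
Qed.

Lemma likely_ae eta (Q : Omega -> Prop) : 0 <= eta -> {ae P, forall w, Q w} -> likely eta Q.
Proof.
move=> eta0 [A [mA A0 HA]]; exists A; split => //; first by rewrite [X in (X <= _)%E]A0 lee_fin.
by move=> w Aw; apply: contrapT => Qw; apply: Aw; exact: HA.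
Qed.

Lemma likely_forall (n : nat) eta (Q : nat -> Omega -> Prop) : 0 <= eta ->
  (forall i, (i < n)%N -> likely eta (Q i)) ->
  likely (n%:R * eta) (fun w => forall i, (i < n)%N -> Q i w).
Proof.
move=> eta0; elim: n => [|n IH] H.
  exists set0; split => //; first by rewrite measure0 mul0r.
have h1 := IH (fun i im => H i (ltnW im)); have h2 := H n (ltnSn n).
apply: likely_mono (likelyI h1 h2); first by rewrite -natr1 mulrDl mul1r.
by move=> w [Ha Hb] i; rewrite ltnS leq_eqVlt => /predU1P[->//|]; exact: Ha.
Qed.

Lemma likely_cvg0 (Y : nat -> Omega -> \bar R) (e eta : R) : 0 < e -> 0 < eta ->
  cvg0_in_probability P Y -> exists N, forall n, (N <= n)%N ->
    likely eta (fun w => (Y n w < e%:E)%E).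
Proof.
move=> e0 eta0 /(_ e e0)[A [mA YA cA]].
have [N HN] := cvg_ereal0_le eta0 cA.
exists N => n Nn; exists (A n); split => //; first exact: HN.
by move=> w Aw; rewrite ltNge; apply/negP => H; apply: Aw; exact: YA.
Qed.

Lemma chebyshev_sqr (f : Omega -> R) (e D : R) : 0 < e ->
  measurable_fun [set: Omega] f ->
  (\int[P]_w (f w ^+ 2)%:E <= D%:E)%E ->
  likely (D / e ^+ 2) (fun w => `|f w| <= e).
Proof.
move=> e0 mf HD; pose A := [set w | e < `|f w|].
have mA : measurable A by exact: measurable_norm_gt.
exists A; split => //; last by move=> w /= /negP; rewrite -leNgt.
rewrite EFinM lee_pdivlMr ?exprn_gt0//.
rewrite muleC -(setIT A) -integral_indic//.
rewrite -intEZ; [|exact: measurable_indic|by []|by rewrite exprn_ge0// ltW].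
apply: le_trans HD; apply: le_intE.
- by apply: measurable_funM => //; exact: measurable_indic.
- by mfun.
- by move=> w; rewrite mulr_ge0// exprn_ge0// ltW.
move=> w; rewrite indicE; case: (boolP (w \in A)) => [/set_mem/= wA|_].
  by rewrite mulr1 -[leRHS]real_normK ?num_real// lerXn2r ?nnegrE// ltW.
by rewrite mulr0 sqr_ge0.
Qed.

End likely.

Lemma fine_mesh {R : realType} (T r : R) : 0 < T -> 0 < r ->
  exists M0 : nat, forall M, (M0 <= M)%N -> (0 < M)%N /\ 0 < T / M%:R < r.
Proof.
move=> T0 r0; have [k Hk] := ltr_add_invr (divr_gt0 r0 T0); rewrite add0r in Hk.
exists k.+1 => M kM; have M0 : (0 < M)%N by exact: leq_trans kM.
split => //; rewrite divr_gt0 ?ltr0n//= -ltr_pdivlMl// mulrC; apply: le_lt_trans Hk.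
by rewrite lef_pV2 ?posrE ?ltr0n// ler_nat.
Qed.

(** * A Lenglart inequality for discrete stochastic sums *)

Section lenglart.
Context {R : realType} {d : measure_display} {Omega : measurableType d}.
Variables (P : probability Omega R) (Filt : R -> set (set Omega)).
Variable (B : R -> Omega -> R).
Hypothesis HF : is_filtration Filt.
Hypothesis HB : is_wiener P Filt B.

Variables (m : nat) (l : nat -> R) (v : nat -> Omega -> R) (D e : R).
Hypothesis (l0 : forall i, (i < m)%N -> 0 <= l i).
Hypothesis (lS : forall i, (i < m)%N -> l i < l i.+1).
Hypothesis (mv : forall i, (i < m)%N -> Fmeas Filt (l i) (v i)).
Hypotheses (D0 : 0 <= D) (e0 : 0 < e).

Let S k w := \sum_(i < k) v i w * (B (l i.+1) w - B (l i) w).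
Let Q k w := \sum_(i < k) v i w ^+ 2 * (l i.+1 - l i).

Let keep (x : R * R) : R := \1_(`[- e, e] `*` `]-oo, D]) x.

Let mkeep : measurable_fun [set: R * R] keep.
Proof. by apply: measurable_indic; apply: measurableX. Qed.

Let keep01 x : keep x = 0 \/ keep x = 1.
Proof. by rewrite /keep indicE; case: (_ \in _); [right|left]. Qed.

Let keepE s q : `|s| <= e -> q <= D -> keep (s, q) = 1.
Proof.
move=> se qD; rewrite /keep indicE mem_set//=; split => /=.
  by rewrite in_itv/= -ler_norml.
by rewrite in_itv/=.
Qed.

Let keep_out s q : e < `|s| -> keep (s, q) = 0.
Proof.
move=> se; rewrite /keep indicE memNset//= => -[] /=.
by rewrite in_itv/= -ler_norml leNgt se.
Qed.

Let keepQ s q : D < q -> keep (s, q) = 0.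
Proof.
move=> se; rewrite /keep indicE memNset//= => -[] /= _.
by rewrite in_itv/= leNgt se.
Qed.

(* the sum S, frozen as soon as it leaves [-e, e] or its bracket exceeds D *)
Fixpoint stopped_sum k w : R := if k is k'.+1 then
  stopped_sum k' w + keep (stopped_sum k' w, Q k'.+1 w) * v k' w * (B (l k'.+1) w - B (l k') w)
  else 0.
Let vt k w := keep (stopped_sum k w, Q k.+1 w) * v k w.
Let Qt k w := \sum_(i < k) vt i w ^+ 2 * (l i.+1 - l i).

Let l_le i j : (i <= j)%N -> (j <= m)%N -> l i <= l j.
Proof.
elim: j => [|j IH]; first by rewrite leqn0 => /eqP ->.
rewrite leq_eqVlt => /predU1P[-> //|ij jm].
by apply: (le_trans (IH ij (ltnW jm))); rewrite ltW// lS.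
Qed.

Let Fl i j (Z : Omega -> R) : (i < m)%N -> (i <= j)%N -> (j <= m)%N ->
  Fmeas Filt (l i) Z -> Fmeas Filt (l j) Z.
Proof. by move=> im ij jm; apply: (Fmeas_le HF); [exact: l0|exact: l_le]. Qed.

Let mQ k j : (k <= j)%N -> (j <= m)%N -> (k <= m)%N -> Fmeas Filt (l j) (Q k).
Proof.
move=> kj jm km; elim: k kj km => [|k IH] kj km.
  by rewrite (_ : Q 0 = cst 0); [exact: measurable_cst|apply/funext => w; rewrite /Q big_ord0].
rewrite (_ : Q k.+1 = fun w => Q k w + v k w ^+ 2 * (l k.+1 - l k)); last first.
  by apply/funext => w; rewrite /Q big_ord_recr.
apply: measurable_funD; first by apply: IH; exact: ltnW.
apply: measurable_funM; last exact: measurable_cst.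
by apply: measurable_funX; apply: (Fl (i := k)) => //; [exact: ltnW|exact: mv].
Qed.

Let mQS k : (k < m)%N -> Fmeas Filt (l k) (Q k.+1).
Proof.
move=> km.
rewrite (_ : Q k.+1 = fun w => Q k w + v k w ^+ 2 * (l k.+1 - l k)); last first.
  by apply/funext => w; rewrite /Q big_ord_recr.
apply: measurable_funD.
  by apply: mQ => //; exact: ltnW.
apply: measurable_funM; last exact: measurable_cst.
by apply: measurable_funX; exact: mv.
Qed.

Let mS k : (k <= m)%N -> Fmeas Filt (l k) (stopped_sum k).
Proof.
elim: k => [|k IH] km /=; first exact: measurable_cst.
have lk0 := l0 km; have lkS := lS km.
apply: measurable_funD; first by apply: (Fl (i := k)) => //; exact: IH (ltnW km).
apply: measurable_funM; last first.
  exact: (wiener_increment_Fmeas HF HB lk0 (ltW lkS)).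
apply: (Fl (i := k)) => //; apply: measurable_funM; last exact: mv.
apply: (measurableT_comp mkeep); apply: measurable_fun_pair.
  exact: IH (ltnW km).
exact: mQS.
Qed.

Let mvt k : (k < m)%N -> Fmeas Filt (l k) (vt k).
Proof.
move=> km; apply: measurable_funM; last exact: mv.
apply: (measurableT_comp mkeep); apply: measurable_fun_pair.
  exact: mS (ltnW km).
exact: mQS.
Qed.

Let dl0 i : (i < m)%N -> 0 <= l i.+1 - l i.
Proof. by move=> im; rewrite subr_ge0 ltW// lS. Qed.

Let vt2 k w : vt k w ^+ 2 <= v k w ^+ 2.
Proof.
rewrite /vt exprMn; case: (keep01 (stopped_sum k w, Q k.+1 w)) => ->.
  by rewrite expr0n/= mul0r sqr_ge0.
by rewrite expr1n mul1r.
Qed.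

Let Q_le i j w : (i <= j)%N -> (j <= m)%N -> Q i w <= Q j w.
Proof.
elim: j => [|j IH]; first by rewrite leqn0 => /eqP ->.
rewrite leq_eqVlt => /predU1P[-> //|ij jm].
apply: (le_trans (IH ij (ltnW jm))); rewrite /Q big_ord_recr/= lerDl.
by rewrite mulr_ge0 ?sqr_ge0 ?dl0.
Qed.

Let Qt_le k w : (k <= m)%N -> Qt k w <= D.
Proof.
elim: k => [|k IH] km; first by rewrite /Qt big_ord0.
rewrite /Qt big_ord_recr/=; have [QD|QD] := leP (Q k.+1 w) D.
  apply: le_trans QD; rewrite /Q big_ord_recr/= lerD//.
    apply: ler_sum => i _; rewrite ler_wpM2r ?vt2// dl0//.
    by apply: leq_trans km; rewrite ltnS ltnW.
  by rewrite ler_wpM2r ?vt2// dl0.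
rewrite {2}/vt keepQ// mul0r expr0n/= mul0r addr0.
by apply: IH; exact: ltnW.
Qed.

(** A discrete Ito isometry, one inequality of which is enough: integrating the next increment kills
    the cross term. *)
Let ES k : (k <= m)%N ->
  (\int[P]_w (stopped_sum k w ^+ 2)%:E <= \int[P]_w (Qt k w)%:E)%E.
Proof.
elim: k => [|k IH] km.
  rewrite le_eqVlt; apply/orP; left; apply/eqP; apply: eq_integral => w _.
  by rewrite /Qt big_ord0 /= expr0n.
have lk0 := l0 km; have lkS := lS km.
have mSk := mS (ltnW km); have mvk := mvt km.
have mSm := Fmeas_measurable HF lk0 mSk; have mvm := Fmeas_measurable HF lk0 mvk.
have mQt : measurable_fun [set: Omega] (Qt k).
  rewrite /Qt; apply: measurable_sum => i.
  apply: measurable_funM; last exact: measurable_cst.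
  apply: measurable_funX.
  have im : (i < m)%N by apply: leq_trans km; rewrite ltnS ltnW.
  exact: (Fmeas_measurable HF (l0 im) (mvt im)).
pose Psi (x : R * R * R) := (x.1.1 + x.1.2 * x.2) ^+ 2.
pose K (z : R * R) := z.1 ^+ 2 + z.2 ^+ 2 * (l k.+1 - l k).
have mPsi : measurable_fun [set: R * R * R] Psi.
  have m1 : measurable_fun [set: R * R * R] (fun x : R * R * R => x.1.1).
    exact (measurableT_comp measurable_fst measurable_fst).
  have m2 : measurable_fun [set: R * R * R] (fun x : R * R * R => x.1.2).
    exact (measurableT_comp measurable_snd measurable_fst).
  have m3 : measurable_fun [set: R * R * R] (fun x : R * R * R => x.2) by exact: measurable_snd.
  by rewrite /Psi; mfun.
have mK : measurable_fun [set: R * R] K by rewrite /K; mfun.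
have mZ : Fmeas Filt (l k) (fun w => (stopped_sum k w, vt k w)) by exact: measurable_fun_pair.
have HK (z : R * R) : (\int[normal_prob 0 1]_x (Psi (z, Num.sqrt (l k.+1 - l k) * x))%:E <= (K z)%:E)%E.
  rewrite -(gauss_cubic (K z) (2 * z.1 * z.2 * Num.sqrt (l k.+1 - l k)) (z.2 ^+ 2 * (l k.+1 - l k)) 0).
  rewrite le_eqVlt; apply/orP; left; apply/eqP; apply: eq_integral => x _; congr EFin.
  have sE : Num.sqrt (l k.+1 - l k) ^+ 2 = l k.+1 - l k by rewrite sqr_sqrtr// dl0.
  rewrite /Psi /K /=; move: (Num.sqrt _) sE => s0 sE; rewrite -sE; ring.
have H := expect_wiener_increment_le HF HB lk0 lkS mZ mPsi (fun x => sqr_ge0 _) mK HK.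
apply: (le_trans H); rewrite /K /=.
rewrite intED; [|by mfun|by mfun|by move=> w; exact: sqr_ge0|by move=> w; rewrite mulr_ge0 ?sqr_ge0 ?dl0].
apply: (@le_trans _ _ (\int[P]_w (Qt k w)%:E + \int[P]_w (vt k w ^+ 2 * (l k.+1 - l k))%:E)%E).
  by rewrite leeD2r// IH// ltnW.
rewrite -intED; [|by mfun|by mfun| |]; last 2 first.
- move=> w; apply: sumr_ge0 => i _; rewrite mulr_ge0 ?sqr_ge0// dl0//.
  by apply: leq_trans km; rewrite ltnS ltnW.
- by move=> w; rewrite mulr_ge0 ?sqr_ge0 ?dl0.
rewrite le_eqVlt; apply/orP; left; apply/eqP; apply: eq_integral => x _; congr EFin.
by rewrite /Qt big_ord_recr.
Qed.

Let stay k j w : e < `|stopped_sum k w| -> (k <= j)%N -> e < `|stopped_sum j w|.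
Proof.
move=> He; elim: j => [|j IH]; first by rewrite leqn0 => /eqP <-.
rewrite leq_eqVlt => /predU1P[<- //|kj]; have Hj := IH kj.
by rewrite /= keep_out// !mul0r addr0.
Qed.

Lemma lenglart : likely P (D / e ^+ 2) (fun w =>
  \sum_(i < m) v i w ^+ 2 * (l i.+1 - l i) <= D ->
  forall k, (k <= m)%N -> `|\sum_(i < k) v i w * (B (l i.+1) w - B (l i) w)| <= e).
Proof.
have mSm : measurable_fun [set: Omega] (stopped_sum m).
  case: (posnP m) => [->|m0]; first exact: measurable_cst.
  have lm0 : 0 <= l m by apply: le_trans (l0 m0) _; exact: l_le.
  exact: (Fmeas_measurable HF lm0 (mS (leqnn m))).
have ESD : (\int[P]_w (stopped_sum m w ^+ 2)%:E <= D%:E)%E.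
  apply: (le_trans (ES (leqnn m))).
  have -> : D%:E = (\int[P]_(w in [set: Omega]) D%:E)%E.
    by rewrite intE_cst//; exact: probability_setT.
  apply: le_intE => //.
  + rewrite /Qt; apply: measurable_sum => i.
    apply: measurable_funM; last exact: measurable_cst.
    by apply: measurable_funX; exact: (Fmeas_measurable HF (l0 (ltn_ord i)) (mvt (ltn_ord i))).
  + by move=> w; apply: sumr_ge0 => i _; rewrite mulr_ge0 ?sqr_ge0// dl0.
  + by move=> w; exact: Qt_le.
apply: likely_mono (chebyshev_sqr e0 mSm ESD) => // w He QD k km.
have inside j : (j <= m)%N -> `|stopped_sum j w| <= e.
  by move=> jm; rewrite leNgt; apply/negP => /stay/(_ jm); rewrite ltNge He.
suff E : stopped_sum k w = S k w by have := inside k km; rewrite E.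
elim: k km => [|k IH] km; first by rewrite /S big_ord0.
rewrite /= keepE; last 2 first.
- exact: inside (ltnW km).
- by apply: le_trans QD; exact: (@Q_le k.+1 m).
by rewrite mul1r IH ?(ltnW km)// /S big_ord_recr.
Qed.

End lenglart.

(** * Common grids for finite families of intervals *)

Section grids.
Context {R : realType}.

(** The guard [0 < m] in the last clause covers the empty sequence, for which [l 0] is a default
    value outside [s]. *)
Lemma increasing_grid (s : seq R) : exists m (l : nat -> R),
  [/\ forall i, (i < m)%N -> l i < l i.+1,
      forall x, x \in s -> exists2 i, (i <= m)%N & l i = x &
      forall i, (0 < m)%N -> (i <= m)%N -> l i \in s].
Proof.
pose L := sort <=%O (undup s).
have sL : sorted <%O L by rewrite sort_lt_sorted undup_uniq.
have memL x : (x \in L) = (x \in s) by rewrite mem_sort mem_undup.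
exists (size L).-1, (nth 0 L); split.
- move=> i im; have iL : (i.+1 < size L)%N by rewrite -ltn_predRL.
  by rewrite (lt_sorted_ltn_nth 0 sL) ?inE// ltnW.
- move=> x; rewrite -memL => xL; exists (index x L); last exact: nth_index.
  by rewrite -ltnS prednK ?index_mem// (leq_ltn_trans (leq0n (index x L)))// index_mem.
- move=> i m0 im; have Lp : (0 < size L)%N by case: (size L) m0.
  by rewrite -memL mem_nth// -[X in (_ < X)%N](prednK Lp) ltnS.
Qed.

Variables (m : nat) (l : nat -> R).
Hypothesis lS : forall i, (i < m)%N -> l i < l i.+1.

Lemma grid_lt i j : (i < j)%N -> (j <= m)%N -> l i < l j.
Proof.
elim: j => // j IH; rewrite ltnS leq_eqVlt => /predU1P[->|ij] jm; first exact: lS.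
by apply: lt_trans (lS jm); apply: IH => //; exact: ltnW.
Qed.

Lemma grid_leE i j : (i <= m)%N -> (j <= m)%N -> (l i <= l j) = (i <= j)%N.
Proof.
move=> im jm; case: (ltngtP i j) => [ij|ji|->]; last exact: lexx.
- by apply/ltW; exact: grid_lt.
- by apply/negbTE; rewrite -ltNge; exact: grid_lt.
Qed.

Lemma grid_ltE i j : (i <= m)%N -> (j <= m)%N -> (l i < l j) = (i < j)%N.
Proof. by move=> im jm; rewrite ltNge grid_leE// -ltnNge. Qed.

Lemma grid_telescope (f : R -> R) i j : (i <= j)%N -> (j <= m)%N ->
  \sum_(k < m) ((l i <= l k) && (l k < l j))%:R * (f (l k.+1) - f (l k)) = f (l j) - f (l i).
Proof.
move=> ij jm; have im := leq_trans ij jm.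
rewrite -(telescope_sumr (fun k => f (l k)) ij).
rewrite -(big_mkord xpredT (fun k => ((l i <= l k) && (l k < l j))%:R * (f (l k.+1) - f (l k)))).
rewrite (big_cat_nat (n := i))//= (big_cat_nat (n := j) (m := i))//=.
rewrite big_nat [X in X + _]big1 ?add0r; last first.
  move=> k /andP[_ ki]; rewrite grid_leE ?(leq_trans (ltnW ki))// leqNgt ki/= mul0r//.
rewrite [X in _ + X]big_nat [X in _ + X]big1 ?addr0; last first.
  by move=> k /andP[jk km]; rewrite grid_ltE ?(ltnW km)// ltnNge jk andbF mul0r.
rewrite !big_nat; apply: eq_bigr => k /andP[ik kj].
have km : (k <= m)%N by apply: leq_trans jm; exact: ltnW.
by rewrite grid_leE// grid_ltE// ik kj mul1r.
Qed.

(* on a grid interval, a step function with breakpoints on the grid is constant *)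
Lemma grid_indic i j k x : (i <= j)%N -> (j <= m)%N -> (k < m)%N ->
  l k < x <= l k.+1 -> (l i < x <= l j) = (l i <= l k) && (l k < l j).
Proof.
move=> ij jm km /andP[kx xk]; have im := leq_trans ij jm.
rewrite grid_leE ?(ltnW km)// grid_ltE ?(ltnW km)//.
have -> : (l i < x) = (i <= k)%N.
  apply/idP/idP => [ix|ik]; last first.
    by apply: le_lt_trans kx; rewrite grid_leE// ltnW.
  by rewrite -ltnS -grid_ltE//; exact: lt_le_trans xk.
have -> // : (x <= l j) = (k < j)%N.
apply/idP/idP => [xj|kj]; last by apply: (le_trans xk); rewrite grid_leE.
by rewrite -grid_ltE ?(ltnW km)//; exact: lt_le_trans xj.
Qed.

End grids.

Section step_processes.
Context {R : realType} {d : measure_display} {Omega : measurableType d}.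
Variables (P : probability Omega R) (Filt : R -> set (set Omega)).
Variable (B : R -> Omega -> R).
Hypothesis HF : is_filtration Filt.
Hypothesis HB : is_wiener P Filt B.
Local Notation mu := (@lebesgue_measure R).

Lemma step_integral_le (m : nat) (l : nat -> R) (c : nat -> R) (phi : R -> R) (t : R) :
  (forall i, (i < m)%N -> l i < l i.+1) -> (forall i, (i < m)%N -> 0 <= l i) ->
  (forall i, (i < m)%N -> l i.+1 <= t) -> (forall i, 0 <= c i) ->
  measurable_fun [set: R] phi -> (forall s, 0 <= phi s) ->
  (forall i s, (i < m)%N -> l i < s <= l i.+1 -> phi s = c i) ->
  ((\sum_(i < m) c i * (l i.+1 - l i))%:E <= \int[mu]_(s in `]0%R, t]) (phi s)%:E)%E.
Proof.
move=> lS l0 lt c0 mphi phi0 H.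
have disj i j s : (i < m)%N -> (j < m)%N -> l i < s <= l i.+1 -> l j < s <= l j.+1 -> i = j.
  move=> im jm /andP[is_ si] /andP[js sj].
  have h1 := lt_le_trans is_ sj; have h2 := lt_le_trans js si.
  rewrite (grid_ltE lS) ?(ltnW im)// in h1; rewrite (grid_ltE lS) ?(ltnW jm)// in h2.
  by apply/eqP; rewrite eqn_leq -ltnS h1 -ltnS h2.
pose psi (i : 'I_m) (s : R) := (c i * \1_(`]l i, l i.+1]) s)%:E.
have mpsi i : measurable_fun [set: R] (psi i).
  by apply/measurable_EFinP; apply: measurable_funM => //; exact: measurable_indic.
have psi0 i s : (0 <= psi i s)%E by rewrite lee_fin mulr_ge0.
apply: (@le_trans _ _ (\int[mu]_(s in `]0%R, t]) \sum_(i < m) psi i s)%E); last first.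
  apply: ge0_le_integral => //.
  - by move=> s _; apply: sume_ge0.
  - by apply: measurable_funTS; apply: emeasurable_sum.
  - by apply: measurable_funTS; exact/measurable_EFinP.
  move=> s _; rewrite /psi sumEFin lee_fin.
  have [[i isl]|no] := pselect (exists i : 'I_m, l i < s <= l i.+1).
    rewrite (bigD1 i)//= big1 ?addr0; last first.
      move=> j ji; rewrite indicE memNset ?mulr0//= in_itv/= => js.
      by move/eqP : ji; apply; apply: val_inj; exact: (disj _ _ s (ltn_ord j) (ltn_ord i) js isl).
    by rewrite (H i s)// indicE mem_set ?mulr1//= in_itv.
  rewrite big1 ?phi0// => i _; rewrite indicE memNset ?mulr0//= in_itv/= => is_.
  by apply: no; exists i.
rewrite ge0_integral_sum//; last by move=> i; exact (measurable_funTS (mpsi i)).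
rewrite -sumEFin lee_sum// => i _.
rewrite /psi; under eq_integral do rewrite EFinM.
rewrite ge0_integralZl_EFin//; last first.
  by apply: measurable_funTS; apply/measurable_EFinP; exact: measurable_indic.
rewrite integral_indic// EFinM lee_wpmul2l ?lee_fin//.
rewrite (_ : _ `&` _ = `]l i, l i.+1]%classic).
  by rewrite /= lebesgue_measure_itv/= lte_fin lS// EFinB.
apply/seteqP; split => s /=; rewrite !in_itv/=; first by case.
move=> /andP[is_ si]; split; rewrite ?is_ ?si//.
by rewrite (le_lt_trans (l0 i _) is_)//= (le_trans si)// lt.
Qed.

(** The intervals may overlap in any way; rewritten on a grid containing all their endpoints, the
    sum falls under [lenglart]. A general index type allows the difference of a simple process and a
    Riemann sum to be a single family. *)
Lemma step_process_bound (J : finType) (u v : J -> R) (V : J -> Omega -> R) (t D e : R) :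
  (forall j, 0 <= u j) -> (forall j, u j <= v j) -> (forall j, v j <= t) ->
  (forall j, u j < v j -> Fmeas Filt (u j) (V j)) -> 0 <= D -> 0 < e ->
  likely P (D / e ^+ 2) (fun w =>
    (\int[mu]_(s in `]0%R, t]) ((\sum_j V j w * \1_(`]u j, v j]) s) ^+ 2)%:E <= D%:E)%E ->
    `|\sum_j V j w * (B (v j) w - B (u j) w)| <= e).
Proof.
move=> u0 uv vt mV D0 e0.
have [m [l [lS lmem lin]]] := increasing_grid ([seq u j | j : J] ++ [seq v j | j : J]).
have ui j : exists2 i, (i <= m)%N & l i = u j.
  by apply: lmem; rewrite mem_cat map_f ?mem_enum.
have vi j : exists2 i, (i <= m)%N & l i = v j.
  by apply: lmem; rewrite mem_cat [X in _ || X]map_f ?mem_enum ?orbT.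
have l0t i : (i < m)%N -> 0 <= l i.
  move=> im; have := lin i (leq_ltn_trans (leq0n i) im) (ltnW im); rewrite mem_cat => /orP[] /mapP[j _ ->//].
  exact: le_trans (uv j).
have lt i : (i < m)%N -> l i.+1 <= t.
  move=> im; have := lin i.+1 (leq_ltn_trans (leq0n i) im) im.
  rewrite mem_cat => /orP[] /mapP[j _ ->//].
  exact: le_trans (uv j) (vt j).
pose c (i : nat) (j : J) : R := ((u j <= l i) && (l i < v j))%:R.
pose Vg i w := \sum_j V j w * c i j.
have mVg i : (i < m)%N -> Fmeas Filt (l i) (Vg i).
  move=> im; apply: measurable_sum => j; rewrite /c.
  have [/andP[ul lv]|_] := boolP ((u j <= l i) && (l i < v j)).
    apply: measurable_funM; last exact: measurable_cst.
    by apply: (Fmeas_le HF (u0 j) ul); apply: mV; exact: le_lt_trans lv.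
  rewrite (_ : (fun w => _) = cst 0); first exact: measurable_cst.
  by apply/funext => w; rewrite mulr0.
apply: likely_mono (lenglart HF HB l0t lS mVg D0 e0) => // w HA HI.
have E : \sum_j V j w * (B (v j) w - B (u j) w) =
   \sum_(i < m) Vg i w * (B (l i.+1) w - B (l i) w).
  under [RHS]eq_bigr do rewrite mulr_suml.
  rewrite exchange_big/=; apply: eq_bigr => j _.
  have [p pm pE] := ui j; have [r rm rE] := vi j.
  have pr : (p <= r)%N by rewrite -(grid_leE lS)// pE rE.
  rewrite -pE -rE -(grid_telescope lS (fun s => B s w) pr rm) mulr_sumr.
  by apply: eq_bigr => i _; rewrite /c -pE -rE mulrA.
rewrite E; apply: (HA _ m (leqnn m)).
rewrite -lee_fin; apply: le_trans HI.
apply: (step_integral_le (c := fun i => Vg i w ^+ 2) (phi := fun s => (\sum_j V j w * \1_(`]u j, v j]) s) ^+ 2)) => //.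
- by move=> i; exact: sqr_ge0.
- apply: measurable_funX; apply: measurable_sum => j.
  by apply: measurable_funM => //; exact: measurable_indic.
- by move=> s; exact: sqr_ge0.
move=> i s im isl; congr (_ ^+ 2); rewrite /Vg; apply: eq_bigr => j _; congr (_ * _).
have [p pm pE] := ui j; have [r rm rE] := vi j.
have pr : (p <= r)%N by rewrite -(grid_leE lS)// pE rE.
rewrite /c indicE -pE -rE -(grid_indic lS pr rm im isl).
by rewrite mem_setE in_itv.
Qed.

End step_processes.

(** * Moduli of continuity of almost surely continuous paths *)

Section path_oscillation.
Context {R : realType}.

Lemma uniformly_continuous_segment (f : R -> R) (T e : R) : continuous f -> 0 < e ->
  exists2 r : R, 0 < r & forall x y, 0 <= x <= T -> 0 <= y <= T -> `|x - y| < r ->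
    `|f x - f y| <= e.
Proof.
move=> cf e0.
have cT : compact `[0, T] by exact: segment_compact.
pose Pr (r : R) (x : R) := forall y, 0 <= y <= T -> `|x - y| < r -> `|f x - f y| <= e.
have H0 : forall x, `[0, T]%classic x -> \forall x' \near x & i \near 0^'+, Pr i x'.
  move=> x _; have e20 : 0 < e / 2 by rewrite divr_gt0.
  have /cvgrPdist_lt/(_ _ e20)/nbhs_ballP[r /= r0 Hr] := cf x.
  have r20 : 0 < r / 2 by rewrite divr_gt0.
  exists (ball x (r / 2), [set i | i < r / 2]) => /=.
    split; first exact: nbhsx_ballx.
    exact: nbhs_right_lt.
  move=> [x' i] /= [xx' ir] y yT xy'.
  have -> : f x' - f y = (f x - f y) - (f x - f x') by ring.
  apply: (le_trans (ler_normB _ _)).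
  have Hy : `|f x - f y| < e / 2.
    apply: Hr; rewrite /ball/=; rewrite /ball/= in xx'.
    have -> : x - y = (x - x') + (x' - y) by ring.
    by apply: (le_lt_trans (ler_normD _ _)); lra.
  have Hx' : `|f x - f x'| < e / 2.
    by apply: Hr; rewrite /ball/=; rewrite /ball/= in xx'; lra.
  lra.
have H1 := (compact_near_coveringP _).1 cT R (0^'+) Pr _ H0.
have H2 : \forall r \near (0 : R)^'+, `[0, T]%classic `<=` Pr r /\ 0 < r.
  near=> r; split; first by near: r; exact: H1.
  by near: r; exact: nbhs_right_gt.
have [r [Hr r0]] := @filter_ex _ _ (at_right_proper_filter (0 : R)) _ H2.
exists r => // x y xT yT xy; apply: Hr => //=.
Unshelve. all: by end_near. Qed.

Lemma continuous_half_ext (f : R -> R) : {within `[0, +oo[, continuous f} ->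
  continuous (fun s : R => f (Num.max s 0)).
Proof.
move=> /subspace_continuousP cf x.
have m0 (y : R) : 0 <= Num.max y 0 by rewrite le_max lexx orbT.
have mx : `[0, +oo[%classic (Num.max x 0) by rewrite /= in_itv/= m0.
apply/cvgrPdist_lt => /= e e0.
have /cvgrPdist_lt/(_ e e0) := cf _ mx.
rewrite /prop_near1 /within /= => /nbhs_ballP[r /= r0 H].
apply/nbhs_ballP; exists r => //= y xy; apply: H; last by rewrite /= in_itv/= m0.
rewrite /ball/=; apply: le_lt_trans xy.
have := ler_norm (x - y); have := ler_norm (y - x); rewrite (distrC y x) => h1 h2.
by rewrite ler_norml; case: (leP x 0) => ?; case: (leP y 0) => ?; lra.
Qed.

Context {d : measure_display} {Omega : measurableType d} (P : probability Omega R).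

(** The event of a large oscillation need not be measurable. It is replaced by its restriction to
    rational times, a countable union that decreases to a null set; continuity recovers all real
    times. *)
Lemma path_oscillation (X : R -> Omega -> R) (T e eta : R) :
  (forall t, 0 <= t -> measurable_fun [set: Omega] (X t)) ->
  continuous_paths P X -> 0 < e -> 0 < eta ->
  exists2 r : R, 0 < r & likely P eta (fun w =>
    {within `[0, +oo[, continuous (fun t : R => X t w)} /\
      forall s s', 0 <= s <= T -> 0 <= s' <= T -> `|s - s'| < r -> `|X s w - X s' w| <= e).
Proof.
move=> mX [N [mN N0 Ncont]] e0 eta0.
have contN w : ~ N w -> {within `[0, +oo[, continuous (fun t : R => X t w)}.
  by move=> Nw; apply: contrapT => H; apply: Nw; apply: Ncont.
(* Times up to [T] will be approximated by rationals from the right, which may exceed [T]. *)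
pose inT (q : rat) := 0 <= (ratr q : R) <= T + 1.
pose U (k : nat) : set Omega := \bigcup_(q : rat) \bigcup_(q' : rat)
  [set w | [/\ inT q, inT q', `|ratr q - ratr q'| < k.+1%:R^-1 :> R &
    e < `|X (ratr q) w - X (ratr q') w|]].
have mU k : measurable (U k).
  apply: bigcupT_measurable_rat => q; apply: bigcupT_measurable_rat => q'.
  have [qT|qT] := boolP (inT q); last by rewrite (_ : [set w | _] = set0)// -subset0 => w /= -[].
  have [qT'|qT'] := boolP (inT q'); last by rewrite (_ : [set w | _] = set0)// -subset0 => w /= -[].
  have [qq|qq] := boolP (`|ratr q - ratr q'| < k.+1%:R^-1 :> R); last first.
    by rewrite (_ : [set w | _] = set0)// -subset0 => w /= -[].
  rewrite (_ : [set w | _] = [set w | e < `|X (ratr q) w - X (ratr q') w|]).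
    apply: measurable_norm_gt; apply: measurable_funB; apply: mX; first by case/andP: qT.
    by case/andP: qT'.
  by apply/seteqP; split => w //= [].
have niU : nonincreasing_seq U.
  move=> k k' kk'; apply/subsetPset => w [q _ [q' _ [h1 h2 h3 h4]]].
  exists q => //; exists q' => //; split => //; apply: (lt_le_trans h3).
  by rewrite lef_pV2 ?posrE// ler_nat ltnS.
have mI : measurable (\bigcap_k U k) by apply: bigcapT_measurable.
have I0 : P (\bigcap_k U k) = 0%E.
  apply/eqP; rewrite -measure_le0 -N0; apply: le_measure; rewrite ?inE//.
  move=> w Uw; apply: contrapT => /contN/continuous_half_ext cf.
  have [r r0 Hr] := uniformly_continuous_segment (T + 1) cf e0.
  have [k Hk] := ltr_add_invr r0; rewrite add0r in Hk.
  have [q _ [q' _ [/andP[q0 qT] /andP[q'0 q'T] qq']]] := Uw k I.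
  rewrite ltNge; apply/negP; rewrite negbK.
  have := Hr (ratr q) (ratr q'); rewrite !max_l//.
  by apply; rewrite ?q0 ?q'0//; exact: lt_trans Hk.
have cvU : (P \o U) k @[k --> \oo] --> 0%E.
  rewrite -I0; apply: nonincreasing_cvg_mu => //.
  by rewrite (le_lt_trans (probability_le1 _ _))// ltry.
have [k0 Hk0] := cvg_ereal0_le eta0 cvU.
exists (k0.+1%:R^-1); first by rewrite invr_gt0.
exists (N `|` U k0); split; first exact: measurableU.
  apply: (@le_trans _ _ (P N + P (U k0))%E); first exact: measureU2.
  have -> : P N = 0%E by exact: N0.
  by rewrite add0e; exact: Hk0.
move=> w /not_orP[Nw Uw]; have cX := contN w Nw; split => // s s' /andP[s0 sT] /andP[s'0 s'T] ss'.
rewrite leNgt; apply/negP => He; apply: Uw.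
pose f t := X (Num.max t 0) w.
have cf : continuous f by exact: (continuous_half_ext cX).
have fE t : 0 <= t -> f t = X t w by move=> t0; rewrite /f max_l.
pose g := `|X s w - X s' w| - e.
have g0 : 0 < g / 2 by rewrite divr_gt0// subr_gt0.
(* The two strict inequalities leave margins [gap] in time and [g] in space; rationals within half
   of each still witness [U k0]. *)
pose gap := k0.+1%:R^-1 - `|s - s'|.
have gap0 : 0 < gap by rewrite subr_gt0.
have near_rat t : 0 <= t <= T -> exists q, [/\ inT q, t <= ratr q < t + gap / 2 & `|X t w - X (ratr q) w| < g / 2].
  move=> /andP[t0 tT].
  have /cvgrPdist_lt/(_ _ g0)/nbhs_ballP[r /= r0 Hr] := cf t.
  pose r' := Num.min (Num.min r 1) (gap / 2).
  have r'0 : 0 < r' by rewrite !lt_min r0 ltr01/= divr_gt0.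
  have r'r : r' <= r by rewrite /r' !ge_min lexx.
  have r'1 : r' <= 1 by rewrite /r' !ge_min lexx !orbT.
  have r'g : r' <= gap / 2 by rewrite /r' !ge_min lexx !orbT.
  have /rat_in_itvoo[q] : t < t + r' by rewrite ltrDl.
  rewrite in_itv/= => /andP[tq qt].
  exists q; split.
  - by rewrite /inT; lra.
  - by lra.
  - rewrite -!fE//; last by lra.
    by apply: Hr; rewrite /ball/= distrC ger0_norm; lra.
have [q [qT /andP[sq qs] Xq]] := near_rat s (introT andP (conj s0 sT)).
have [q' [q'T' /andP[sq' qs'] Xq']] := near_rat s' (introT andP (conj s'0 s'T)).
exists q => //; exists q' => //; split => //.
- have : `|s - s'| = k0.+1%:R^-1 - gap by rewrite /gap; ring.
  move=> Hss; have h1 := ler_norm (s - s'); have h2 := ler_norm (s' - s); rewrite (distrC s' s) in h2.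
  move: (k0.+1%:R^-1) Hss sq qs sq' qs' gap0 => i Hss sq qs sq' qs' gap0.
  by rewrite ltr_norml; apply/andP; split; lra.
- have : `|X s w - X s' w| <= `|X s w - X (ratr q) w| + `|X (ratr q) w - X (ratr q') w| + `|X s' w - X (ratr q') w|.
    have -> : X s w - X s' w = (X s w - X (ratr q) w) + (X (ratr q) w - X (ratr q') w) - (X s' w - X (ratr q') w) by ring.
    by apply: (le_trans (ler_normB _ _)); rewrite lerD2r ler_normD.
  have : `|X s w - X s' w| = g + e by rewrite /g; ring.
  lra.
Qed.

End path_oscillation.

Lemma grid_find {R : realType} (l : nat -> R) (m : nat) (s : R) : l 0%N < s <= l m ->
  exists2 i, (i < m)%N & l i < s <= l i.+1.
Proof.
elim: m => [|m IH] /andP[ls sl]; first by have := lt_le_trans ls sl; rewrite ltxx.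
have [sm|ms] := leP s (l m); last by exists m => //; rewrite ms.
have [|i im H] := IH; first by rewrite ls.
by exists i => //; exact: ltnW.
Qed.

(** * Riemann sums converge to the Ito integral *)

Section riemann.
Context {R : realType} {d : measure_display} {Omega : measurableType d}.
Variables (P : probability Omega R) (Filt : R -> set (set Omega)).
Variable (B : R -> Omega -> R).
Hypothesis HF : is_filtration Filt.
Hypothesis HB : is_wiener P Filt B.
Local Notation mu := (@lebesgue_measure R).

Variables (X H : R -> Omega -> R) (b : R -> R) (L : R).
Hypothesis aX : adapted Filt X.
Hypothesis cX : continuous_paths P X.
Hypothesis L1 : 1 <= L.
Hypothesis bL : forall x y, `|b x - b y| <= L * `|x - y|.
Hypothesis mb : measurable_fun [set: R] b.
Hypothesis HE : forall s w, 0 <= s -> H s w = b (X s w).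

Let mX s : 0 <= s -> measurable_fun [set: Omega] (X s).
Proof.
by move=> s0; apply: (Fmeas_measurable HF s0); apply/(FmeasP HF _ s0); exact: aX.
Qed.

Let FbX s : 0 <= s -> Fmeas Filt s (fun w => - b (X s w)).
Proof.
move=> s0; apply: measurable_fun_opp; apply: (measurableT_comp mb).
by apply/(FmeasP HF _ s0); exact: aX.
Qed.

(** The definition of the integral offers some approximating simple processes [S n], not those of
    the Riemann sums. One of them is compared with a Riemann sum: both integrands are close to [H]
    in L^2 in time with high probability, and [step_process_bound] transfers this to the
    integrals. *)
Lemma riemann_sums_cvg (t : R) (I : Omega -> R) (eps eta : R) : 0 < t ->
  is_ito_integral P Filt B H t I -> 0 < eps -> 0 < eta ->
  exists M0 : nat, forall M, (M0 <= M)%N -> (0 < M)%N /\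
  likely P eta (fun w =>
    `|\sum_(i < M) b (X (i%:R * (t / M%:R)) w) * dB B (t / M%:R) i w - I w| <= eps).
Proof.
move=> t0 [S [S1 S2]] eps0 eta0.
have e0 : 0 < eps / 2 by rewrite divr_gt0.
have eta4 : 0 < eta / 4 by rewrite divr_gt0.
(* [D / (eps / 2) ^+ 2 = eta / 4] is the probability lost in [step_process_bound]. Of the squared
   distance [D], one half is [2 * (D / 4)], due to [S n], and the other [2 * (D / (4 * t)) * t], due
   to the oscillation of the path; this fixes [om]. *)
pose D := eta / 4 * (eps / 2) ^+ 2.
have D0 : 0 < D by rewrite /D mulr_gt0// exprn_gt0.
have D4 : 0 < D / 4 by rewrite divr_gt0.
pose om := Num.sqrt (D / (4 * t)) / L.
have L0 : 0 < L by apply: lt_le_trans L1.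
have om0 : 0 < om by rewrite divr_gt0// sqrtr_gt0 divr_gt0// mulr_gt0.
have Lom : (L * om) ^+ 2 = D / (4 * t).
  rewrite /om mulrCA divff ?gt_eqF// mulr1 sqr_sqrtr// divr_ge0 ?(ltW D0)//.
  by rewrite mulr_ge0// ltW.
have [r r0 osc] := path_oscillation t mX cX om0 eta4.
have [N1 HN1] := likely_cvg0 D4 eta4 S1.
have [N2 HN2] := likely_cvg0 e0 eta4 S2.
pose n := maxn N1 N2.
have h1 := HN1 n (leq_maxl _ _); have h2 := HN2 n (leq_maxr _ _).
have [M1 HM1] := fine_mesh t0 r0.
exists M1 => M /HM1[M0 /andP[hh0 hhr]]; split => //.
have MR : 0 < M%:R :> R by rewrite ltr0n.
set hh := t / M%:R in hh0 hhr *.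
have Mhh : M%:R * hh = t by rewrite /hh mulrC divfK// gt_eqF.
pose J := ('I_(sp_size (S n)) + 'I_M)%type.
pose u (j : J) := match j with inl i => Num.min (sp_time (S n) i) t | inr i => i%:R * hh end.
pose v (j : J) := match j with inl i => Num.min (sp_time (S n) i.+1) t | inr i => i.+1%:R * hh end.
pose V (j : J) w := match j with inl i => sp_val (S n) i w | inr i => - b (X (i%:R * hh) w) end.
have u0 j : 0 <= u j.
  case: j => i /=; last exact: time_ge0.
  by rewrite le_min sp_time_ge0 ltW.
have uv j : u j <= v j.
  case: j => i /=; last by apply: ltW; exact: time_lt.
  by rewrite le_min !ge_min sp_time_mono lexx !orbT.
have vt j : v j <= t.
  case: j => i /=; first by rewrite ge_min lexx orbT.
  by rewrite -Mhh ler_pM2r// ler_nat.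
(* A simple process may jump after [t]; truncation moves such a jump back to [t], where its value is
   not yet measurable. The interval is then empty, which is why only nonempty ones are
   constrained. *)
have mV j : u j < v j -> Fmeas Filt (u j) (V j).
  case: j => i /=; last by move=> _; apply: FbX; exact: time_ge0.
  have ti := sp_time_ge0 (S n) i.
  case: (leP (sp_time (S n) i) t) => ht; last by rewrite lt_min ltxx andbF.
  by move=> _; apply/(FmeasP HF _ ti); exact: sp_val_meas.
have h3 := step_process_bound HF HB u0 uv vt mV (ltW D0) e0.
have {}h3 : likely P (eta / 4) (fun w => (\int[mu]_(s in `]0%R, t]) ((\sum_j V j w * \1_(`]u j, v j]) s) ^+ 2)%:E <= D%:E)%E ->
    `|\sum_j V j w * (B (v j) w - B (u j) w)| <= eps / 2).
  have -> : eta / 4 = D / (eps / 2) ^+ 2 by rewrite /D mulfK// expf_neq0// gt_eqF.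
  exact: h3.
apply: likely_mono (likelyI (likelyI osc h1) (likelyI h2 h3)); first lra.
move=> w [[[cw osw] I1] [I2 I3]].
have EV (F : R -> R -> R) : \sum_j V j w * F (u j) (v j) =
    \sum_(i < sp_size (S n)) sp_val (S n) i w * F (Num.min (sp_time (S n) i) t) (Num.min (sp_time (S n) i.+1) t)
    - \sum_(i < M) b (X (i%:R * hh) w) * F (i%:R * hh) (i.+1%:R * hh).
  rewrite big_sumType/= -sumrN; congr (_ + _).
  by apply: eq_bigr => i _; rewrite mulNr.
have I4 : `|sp_integral (S n) B t w - \sum_(i < M) b (X (i%:R * hh) w) * dB B hh i w| <= eps / 2.
  rewrite -(EV (fun x y => B y w - B x w)); apply: I3.
  (* [H] is specified at nonnegative times only; [Hs] agrees with it there and is measurable on the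
     whole line. *)
  pose Hs s := b (X (Num.max s 0) w).
  have mHs : measurable_fun [set: R] Hs.
    apply: (measurableT_comp mb); apply: continuous_measurable_fun.
    exact: (continuous_half_ext cw).
  have mS : measurable_fun [set: R] (fun s => sp_eval (S n) s w).
    rewrite /sp_eval; apply: measurable_sum => i.
    by apply: measurable_funM => //; exact: measurable_indic.
  have pw s : 0 < s <= t -> (\sum_j V j w * \1_(`]u j, v j]) s) ^+ 2 <=
      2 * (sp_eval (S n) s w - Hs s) ^+ 2 + 2 * (D / (4 * t)).
    move=> /andP[s0 st]; rewrite (EV (fun x y => \1_(`]x, y]) s)).
    have [|i iM /andP[is_ si]] := @grid_find R (fun i => i%:R * hh) M s; first by rewrite mul0r s0 Mhh.
    have gS j : (j < M)%N -> j%:R * hh < j.+1%:R * hh by move=> _; exact: time_lt.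
    have -> : \sum_(i < M) b (X (i%:R * hh) w) * \1_(`]i%:R * hh, i.+1%:R * hh]) s = b (X (i%:R * hh) w).
      rewrite (bigD1 (Ordinal iM))//= indicE mem_set ?mulr1; last by rewrite /= in_itv/= is_.
      rewrite big1 ?addr0// => j ji; rewrite indicE memNset ?mulr0//= in_itv/= => /andP[js sj].
      move/eqP : ji; apply; apply: val_inj => /=.
      have h5 := lt_le_trans is_ sj; have h6 := lt_le_trans js si.
      rewrite ltr_pM2r// ltr_nat in h5; rewrite ltr_pM2r// ltr_nat in h6.
      by apply/eqP; rewrite eqn_leq -ltnS h6 -ltnS h5.
    have -> : \sum_(i < sp_size (S n)) sp_val (S n) i w *
       \1_(`](Num.min (sp_time (S n) i) t), (Num.min (sp_time (S n) i.+1) t)]) s = sp_eval (S n) s w.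
      apply: eq_bigr => j _; congr (_ * _); rewrite !indicE; congr (_%:R).
      by rewrite !mem_setE !in_itv/= gt_min le_min st andbT (ltNge t) st orbF.
    have HsE : Hs s = b (X s w) by rewrite /Hs max_l// ltW.
    set p := sp_eval _ _ _; rewrite HsE.
    have hq : `|b (X s w) - b (X (i%:R * hh) w)| <= L * om.
      apply: (le_trans (bL _ _)); rewrite ler_pM2l//.
      have ist : i%:R * hh <= t by apply: le_trans st; exact: ltW.
      apply: osw; rewrite ?(ltW s0) ?time_ge0//.
      rewrite ger0_norm ?subr_ge0 ?(ltW is_)//; apply: le_lt_trans hhr.
      by rewrite lerBlDr (le_trans si)// -natr1 mulrDl mul1r addrC.
    have hq2 : (b (X s w) - b (X (i%:R * hh) w)) ^+ 2 <= D / (4 * t).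
      rewrite -Lom -real_normK ?num_real// lerXn2r ?nnegrE//.
      by rewrite mulr_ge0// ltW.
    move: hq2; set y := b (X s w); set z := b _ => hq2.
    have -> : p - z = (p - y) + (y - z) by ring.
    apply: (@le_trans _ _ (2 * (p - y) ^+ 2 + 2 * (y - z) ^+ 2)); last by lra.
    have := sqr_ge0 ((p - y) - (y - z)); lra.
  apply: (@le_trans _ _ (\int[mu]_(s in `]0%R, t]) (2 * (sp_eval (S n) s w - Hs s) ^+ 2 + 2 * (D / (4 * t)))%:E)%E).
    apply: ge0_le_integral; [by []| | | |].
    - by move=> s _; rewrite lee_fin sqr_ge0.
    - apply/measurable_EFinP; apply: measurable_funTS.
      apply: measurable_funX; apply: measurable_sum => j.
      by apply: measurable_funM => //; exact: measurable_indic.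
    - apply/measurable_EFinP; apply: measurable_funTS.
      by apply: measurable_funD => //; apply: measurable_funM => //; apply: measurable_funX; exact: measurable_funB.
    - move=> s; rewrite /= in_itv/= => hs; rewrite lee_fin; exact: pw.
  have D4t : 0 <= 2 * (D / (4 * t)) by rewrite mulr_ge0// divr_ge0 ?(ltW D0)// mulr_ge0// ltW.
  under eq_integral do rewrite EFinD.
  rewrite ge0_integralD//; last 2 first.
  - by move=> s _; rewrite lee_fin mulr_ge0// sqr_ge0.
  - apply/measurable_EFinP; apply: measurable_funTS.
    by apply: measurable_funM => //; apply: measurable_funX; exact: measurable_funB.
  under eq_integral do rewrite EFinM.
  rewrite ge0_integralZl_EFin//; last 2 first.
  - by move=> s _; rewrite lee_fin sqr_ge0.
  - apply/measurable_EFinP; apply: measurable_funTS.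
    by apply: measurable_funX; exact: measurable_funB.
  rewrite integral_cst//= lebesgue_measure_itv/= lte_fin t0 sube0.
  have Hle : (\int[mu]_(s in `]0%R, t]) ((sp_eval (S n) s w - Hs s) ^+ 2)%:E <= (D / 4)%:E)%E.
    apply: (@le_trans _ _ (\int[mu]_(s in `[0%R, t]) ((sp_eval (S n) s w - H s w) ^+ 2)%:E)%E); last exact: ltW.
    rewrite (_ : (\int[mu]_(s in `[0%R, t]) _)%E = (\int[mu]_(s in `[0%R, t]) ((sp_eval (S n) s w - Hs s) ^+ 2)%:E)%E); last first.
      apply: eq_integral => s; rewrite inE/= in_itv/= => /andP[s0 _].
      by rewrite HE// /Hs max_l.
    apply: ge0_subset_integral => //.
    - apply/measurable_EFinP; apply: measurable_funTS.
      by apply: measurable_funX; exact: measurable_funB.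
    - by move=> s _; rewrite lee_fin sqr_ge0.
    - by move=> s /=; rewrite !in_itv/= => /andP[/ltW -> ->].
  apply: (@le_trans _ _ (2%:E * (D / 4)%:E + (2 * (D / (4 * t)))%:E * t%:E)%E).
    by apply: leeD => //; apply: lee_wpmul2l.
  rewrite -!EFinM -EFinD lee_fin.
  have -> : 2 * (D / (4 * t)) * t = D / 2 by field; rewrite gt_eqF.
  lra.
rewrite lte_fin in I2.
have -> : \sum_(i < M) b (X (i%:R * hh) w) * dB B hh i w - I w = (sp_integral (S n) B t w - I w) -
  (sp_integral (S n) B t w - \sum_(i < M) b (X (i%:R * hh) w) * dB B hh i w) by ring.
apply: (le_trans (ler_normB _ _)); lra.
Qed.

End riemann.

(** * Convergence in probability to the solution *)

Section riemann_lebesgue.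
Context {R : realType}.
Local Notation mu := (@lebesgue_measure R).

Lemma continuous_itv_integrable (phi : R -> R) (i : interval R) (u v : R) :
  continuous phi -> [set` i] `<=` `[u, v] -> mu.-integrable [set` i] (EFin \o phi).
Proof.
move=> cphi iuv.
have I : mu.-integrable `[u, v] (EFin \o phi).
  apply: continuous_compact_integrable; first exact: segment_compact.
  exact: continuous_subspaceT.
exact (@integrableS _ (measurableTypeR R) R mu _ _ _ (measurable_itv `[u, v])
  (measurable_itv i) iuv I).
Qed.

Variable phi : R -> R.
Hypothesis cphi : continuous phi.

Lemma Rintegral_itv_approx (u v c e : R) : u <= v ->
  (forall s, u < s <= v -> `|phi s - c| <= e) ->
  `|\int[mu]_(s in `]u, v]) phi s - c * (v - u)| <= e * (v - u).
Proof.
move=> uv H.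
have uvS : `]u, v] `<=` `[u, v].
  by move=> s /=; rewrite !in_itv/= => /andP[/ltW -> ->].
have ifi := continuous_itv_integrable cphi uvS.
have muE : fine (mu `]u, v]%classic) = v - u.
  rewrite lebesgue_measure_itv/= lte_fin; case: ltP => //= vu.
  have -> : v = u by apply/eqP; rewrite eq_le uv vu.
  by rewrite subrr.
have icst k : mu.-integrable `]u, v] (EFin \o cst k).
  by apply: continuous_itv_integrable uvS => x; exact: cvg_cst.
have hc k : \int[mu]_(s in `]u, v]) k = k * (v - u) by rewrite Rintegral_cst// muE.
have lo : (c - e) * (v - u) <= \int[mu]_(s in `]u, v]) phi s.
  rewrite -hc; apply: le_Rintegral; [exact: measurable_itv|exact: icst|exact: ifi|].
  by move=> s /=; rewrite in_itv/= => /H; rewrite ler_norml => /andP[h _]; lra.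
have hi : \int[mu]_(s in `]u, v]) phi s <= (c + e) * (v - u).
  rewrite -hc; apply: le_Rintegral; [exact: measurable_itv|exact: ifi|exact: icst|].
  by move=> s /=; rewrite in_itv/= => /H; rewrite ler_norml => /andP[_ h]; lra.
move: (\int[mu]_(s in _) _) lo hi => J lo hi.
by rewrite ler_norml; apply/andP; split; lra.
Qed.

Lemma riemann_sum_approx (h e : R) (n : nat) (c : nat -> R) : 0 < h ->
  (forall i s, (i < n)%N -> i%:R * h < s <= i.+1%:R * h -> `|phi s - c i| <= e) ->
  `|\int[mu]_(s in `[0, n%:R * h]) phi s - \sum_(i < n) c i * h| <= n%:R * h * e.
Proof.
move=> h0; elim: n => [|n IH] H.
  by rewrite !mul0r big_ord0 subr0 set_itv1 Rintegral_set1 normr0.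
have nh := time_ge0 n h0; have nS := time_lt n h0.
have -> : \int[mu]_(s in `[0, n.+1%:R * h]) phi s =
   \int[mu]_(s in `[0, n%:R * h]) phi s + \int[mu]_(s in `]n%:R * h, n.+1%:R * h]) phi s.
  have ifi : mu.-integrable `[0, n.+1%:R * h] (EFin \o phi).
    exact: (continuous_itv_integrable cphi (u := 0) (v := n.+1%:R * h)).
  rewrite -(Rintegral_itvB (x := n%:R * h) ifi) ?bnd_simp//; last exact: ltW.
  by rewrite addrC subrK.
have h1 : `|\int[mu]_(s in `[0, n%:R * h]) phi s - \sum_(i < n) c i * h| <= n%:R * h * e.
  by apply: IH => i s im; apply: H; exact: ltnW.
have h2 := Rintegral_itv_approx (ltW nS) (fun s => H n s (ltnSn n)).
rewrite timeB in h2; rewrite big_ord_recr/=.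
move: h1 h2; set A := \int[mu]_(s in _) _; set A' := \int[mu]_(s in _) _; set Sg := \sum_(i < n) _.
move=> h1 h2.
have -> : A + A' - (Sg + c n * h) = (A - Sg) + (A' - c n * h) by ring.
apply: (le_trans (ler_normD _ _)); rewrite -natr1; lra.
Qed.

End riemann_lebesgue.

Lemma sum_coarsen {V : pzRingType} (c f : nat -> V) (l i : nat) : (0 < l)%N ->
  \sum_(j < i * l) c (j %/ l)%N * (f j.+1 - f j) =
  \sum_(j < i) c j * (f (j.+1 * l)%N - f (j * l)%N).
Proof.
move=> l0; elim: i => [|i IH]; first by rewrite mul0n !big_ord0.
rewrite mulSnr big_split_ord/= IH big_ord_recr/=; congr (_ + _).
under eq_bigr => j _ do rewrite divnMDl// divn_small// addn0.
rewrite -mulr_sumr; congr (_ * _).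
rewrite -(big_mkord xpredT (fun j => f (i * l + j).+1 - f (i * l + j)%N)).
under eq_bigr do rewrite -addnS.
by rewrite (telescope_sumr (fun j => f (i * l + j)%N))// addn0 mulSnr.
Qed.

(** * The solution as a perturbed Euler recursion *)

Section defect.
Context {R : realType} {d : measure_display} {Omega : measurableType d}.
Variables (P : probability Omega R) (Filt : R -> set (set Omega)).
Variable (B : R -> Omega -> R).
Hypothesis HF : is_filtration Filt.
Hypothesis HB : is_wiener P Filt B.
Local Notation mu := (@lebesgue_measure R).

Variables (X H K : R -> Omega -> R) (a b : R -> R) (L x0 : R).
Hypothesis aX : adapted Filt X.
Hypothesis cX : continuous_paths P X.
Hypothesis L1 : 1 <= L.
Hypothesis aL : forall x y, `|a x - a y| <= L * `|x - y|.
Hypothesis bL : forall x y, `|b x - b y| <= L * `|x - y|.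
Hypothesis ca : continuous a.
Hypothesis mb : measurable_fun [set: R] b.
Hypothesis HE : forall s w, 0 <= s -> H s w = b (X s w).
Hypothesis KE : forall s w, 0 <= s -> K s w = a (X s w).
Hypothesis X0 : {ae P, forall w, X 0 w = x0}.
Hypothesis HX : forall t : R, 0 <= t -> exists2 I : Omega -> R,
  is_ito_integral P Filt B H t I &
  {ae P, forall w, X t w = x0 + (\int[mu]_(s in `[0, t]) K s w) + I w}.

Let mX s : 0 <= s -> measurable_fun [set: Omega] (X s).
Proof.
by move=> s0; apply: (Fmeas_measurable HF s0); apply/(FmeasP HF _ s0); exact: aX.
Qed.

Let FbX s : 0 <= s -> Fmeas Filt s (fun w => b (X s w)).
Proof.
move=> s0; apply: (measurableT_comp mb).
by apply/(FmeasP HF _ s0); exact: aX.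
Qed.

(** Each time comes with its own version of the Ito integral, unrelated to the others. Replacing it
    by Riemann sums of mesh [h / l] makes the versions disappear and leaves sums that are comparable
    between times. *)
Lemma riemann_equation (h eps eta : R) (i : nat) : 0 < h -> 0 < eps -> 0 < eta ->
  exists N : nat, forall l, (N <= l)%N -> (0 < l)%N -> likely P eta (fun w =>
   `|X (i%:R * h) w - x0 - \int[mu]_(s in `[0, i%:R * h]) K s w -
     \sum_(j < i * l) b (X (j%:R * (h / l%:R)) w) * dB B (h / l%:R) j w| <= eps).
Proof.
move=> h0 e0 eta0; case: i => [|i].
  exists 0%N => l _ _; apply: (likely_ae (ltW eta0)).
  apply: filterS X0 => w Xw.
  by rewrite !mul0r mul0n big_ord0 set_itv1 Rintegral_set1 Xw !subr0 subrr normr0 ltW.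
have [I HI HXI] := HX (time_ge0 i.+1 h0).
have ih0 : 0 < i.+1%:R * h by rewrite mulr_gt0.
have eta2 : 0 < eta / 2 by rewrite divr_gt0.
have [N HN] := riemann_sums_cvg HF HB aX cX L1 bL mb HE ih0 HI e0 eta2.
exists N => l Nl l0.
have [il0 Hl] := HN (i.+1 * l)%N (leq_trans Nl (leq_pmull l (ltn0Sn i))).
have l2 := likely_ae (ltW eta2) HXI.
have hE : i.+1%:R * h / (i.+1 * l)%:R = h / l%:R.
  by rewrite natrM -mulf_div divff ?mul1r// pnatr_eq0.
rewrite hE in Hl.
apply: likely_mono (likelyI Hl l2); first lra.
move=> w [H1 ->]; rewrite distrC in H1; apply: le_trans H1.
rewrite le_eqVlt; apply/orP; left; apply/eqP; congr (`| _ |); ring.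
Qed.

(** The mesh [h] is dictated by the modulus of continuity alone. The equation is used at [M.+1]
    times, so that the mesh [h / l] making all Riemann sums accurate can only be chosen after [M].
    Fine and coarse sums differ by a stochastic sum with small integrand, which [lenglart] bounds at
    all times simultaneously. *)
Lemma euler_defect (T eps eta : R) : 0 < T -> 0 < eps -> 0 < eta ->
  exists M0 : nat, forall M, (M0 <= M)%N -> (0 < M)%N /\
  likely P eta (fun w => forall i, (i <= M)%N ->
    `|X (i%:R * (T / M%:R)) w - (x0 + \sum_(j < i) (a (X (j%:R * (T / M%:R)) w) * (T / M%:R) +
       b (X (j%:R * (T / M%:R)) w) * dB B (T / M%:R) j w))| <= eps).
Proof.
move=> T0 eps0 eta0.
have e0 : 0 < eps / 4 by rewrite divr_gt0.
have eta4 : 0 < eta / 4 by rewrite divr_gt0.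
pose D := eta / 4 * (eps / 4) ^+ 2.
have D0 : 0 < D by rewrite /D mulr_gt0// exprn_gt0.
have L0 : 0 < L by apply: lt_le_trans L1.
(* The oscillation [Lom] of the coefficients must satisfy [T * Lom ^+ 2 <= D], for the bracket in
   [lenglart], and [T * Lom <= eps / 4], for the drift. *)
pose k1 := Num.sqrt (D / T); pose k2 := eps / (4 * T).
have k10 : 0 < k1 by rewrite sqrtr_gt0 divr_gt0.
have k20 : 0 < k2 by rewrite divr_gt0// mulr_gt0.
pose Lom := Num.min k1 k2.
have Lom0 : 0 < Lom by rewrite lt_min k10.
pose om := Lom / L.
have om0 : 0 < om by rewrite divr_gt0.
have LomE : L * om = Lom by rewrite /om mulrCA divff ?gt_eqF// mulr1.
have Lom2 : T * Lom ^+ 2 <= D.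
  have -> : D = T * k1 ^+ 2.
    by rewrite /k1 sqr_sqrtr ?divr_ge0 ?(ltW D0) ?(ltW T0)// mulrCA divff ?gt_eqF// mulr1.
  by rewrite ler_pM2l// lerXn2r ?nnegrE ?(ltW Lom0) ?(ltW k10)// ge_min lexx.
have Lom1 : T * Lom <= eps / 4.
  have -> : eps / 4 = T * k2 by rewrite /k2; field; rewrite gt_eqF.
  by rewrite ler_pM2l// ge_min lexx orbT.
have [r r0 osc] := path_oscillation T mX cX om0 eta4.
have [M1 HM1] := fine_mesh T0 r0.
exists M1 => M /HM1[M0 /andP[h0 hr]]; split => //.
have MR : 0 < M%:R :> R by rewrite ltr0n.
set h := T / M%:R in h0 hr *.
have Mh : M%:R * h = T by rewrite /h mulrC divfK// gt_eqF.
have le_h i : (i <= M)%N -> i%:R * h <= T by move=> iM; rewrite -Mh ler_pM2r// ler_nat.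
have eta_i : 0 < eta / 4 / M.+1%:R by rewrite divr_gt0.
have /choice[N HN] i := riemann_equation i h0 e0 eta_i.
pose l := (\max_(i < M.+1) N i).+1.
have l0 : (0 < l)%N by [].
have lR : 0 < l%:R :> R by rewrite ltr0n.
set kk := h / l%:R in HN *.
have kk0 : 0 < kk by rewrite divr_gt0.
have lkk : l%:R * kk = h by rewrite /kk mulrC divfK// gt_eqF.
have Hl := likely_forall (P := P) (n := M.+1) (ltW eta_i) (fun i iM => HN i l
  (leq_trans (leq_bigmax (F := fun i : 'I_M.+1 => N i) (Ordinal iM)) (leqnSn _)) l0).
(* The last coarse time before the j-th fine time; it is at distance less than [h], and values at
   [tj j] are adapted at the fine time. *)
pose tj (j : nat) := (j %/ l)%:R * h.
have tjE j : tj j = (j %/ l * l)%:R * kk by rewrite /tj natrM -mulrA lkk.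
have tj0 j : 0 <= tj j by exact: time_ge0.
have tj_le j : tj j <= j%:R * kk by rewrite tjE ler_pM2r// ler_nat leq_trunc_div.
have tj_near j : j%:R * kk - tj j < h.
  rewrite tjE -mulrBl -natrB ?leq_trunc_div// -lkk ltr_pM2r// ltr_nat.
  by rewrite {1}(divn_eq j l) addKn ltn_mod.
have jT j : (j <= M * l)%N -> j%:R * kk <= T.
  by move=> jM; rewrite -Mh -lkk mulrA -natrM ler_pM2r// ler_nat.
pose v j w := b (X (j%:R * kk) w) - b (X (tj j) w).
have mv j : (j < M * l)%N -> Fmeas Filt (j%:R * kk) (v j).
  move=> _; apply: measurable_funB; first by apply: FbX; exact: time_ge0.
  by apply: (Fmeas_le HF (tj0 j) (tj_le j)); exact: FbX.
have len := lenglart HF HB (m := (M * l)%N) (l := fun j => j%:R * kk) (v := v) (D := D) (e := eps / 4)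
  (fun j _ => time_ge0 j kk0) (fun j _ => time_lt j kk0) mv (ltW D0) e0.
have {}len : likely P (eta / 4) (fun w => \sum_(i < M * l) v i w ^+ 2 * (i.+1%:R * kk - i%:R * kk) <= D ->
   forall n, (n <= M * l)%N -> `|\sum_(i < n) v i w * (B (i.+1%:R * kk) w - B (i%:R * kk) w)| <= eps / 4).
  have -> : eta / 4 = D / (eps / 4) ^+ 2 by rewrite /D mulfK// expf_neq0// gt_eqF.
  exact: len.
have etaE : M.+1%:R * (eta / 4 / M.+1%:R) = eta / 4 by rewrite mulrC divfK// pnatr_eq0.
rewrite etaE in Hl.
apply: likely_mono (likelyI osc (likelyI len Hl)); first lra.
move=> w [[cw osw] [H3 HL]] i iM.
have h1 := HL i iM.
have vle j : (j < M * l)%N -> `|v j w| <= Lom.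
  move=> jM; rewrite /v (le_trans (bL _ _))// -LomE ler_pM2l//.
  have h5 := jT _ (ltnW jM); have h6 := tj_le j.
  apply: osw; rewrite ?time_ge0//= ?tj0/= ?(le_trans h6 h5)//.
  by rewrite ger0_norm ?subr_ge0//; exact: lt_trans (tj_near j) hr.
have Q : \sum_(i < M * l) v i w ^+ 2 * (i.+1%:R * kk - i%:R * kk) <= D.
  apply: le_trans Lom2.
  apply: (@le_trans _ _ (\sum_(i < M * l) Lom ^+ 2 * kk)).
    apply: ler_sum => j _; rewrite timeB ler_pM2r//.
    by rewrite -[leLHS]real_normK ?num_real// lerXn2r ?nnegrE ?(ltW Lom0)// vle.
  rewrite sumr_const card_ord -mulr_natl natrM -Mh -lkk.
  by rewrite le_eqVlt; apply/orP; left; apply/eqP; ring.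
have h2 := H3 Q (i * l)%N (leq_mul iM (leqnn l)).
have h3 : `|\int[mu]_(s in `[0, i%:R * h]) K s w - \sum_(j < i) a (X (j%:R * h) w) * h| <= eps / 4.
  pose phi s := a (X (Num.max s 0) w).
  have cphi : continuous phi.
    move=> s; exact (@continuous_comp R R R (fun s : R => X (Num.max s 0) w) a s
      (@continuous_half_ext R _ cw s) (@ca _)).
  have phiE s : 0 <= s -> phi s = K s w by move=> s0; rewrite /phi max_l// KE.
  rewrite (@eq_Rintegral _ _ _ mu _ phi); last first.
    by move=> s; rewrite inE/= in_itv/= => /andP[s0 _]; rewrite phiE.
  apply: (@le_trans _ _ (i%:R * h * Lom)); last first.
    by apply: le_trans Lom1; rewrite ler_pM2r// le_h.
  apply: (riemann_sum_approx (c := fun j => a (X (j%:R * h) w)) cphi h0) => j s ji /andP[js sj].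
  have s0 : 0 <= s by apply: le_trans (ltW js); exact: time_ge0.
  rewrite phiE// KE// (le_trans (aL _ _))// -LomE ler_pM2l//.
  have sT : s <= T by apply: (le_trans sj); apply: le_h; exact: leq_trans iM.
  apply: osw; rewrite ?s0 ?sT ?time_ge0//=; first exact: le_trans (ltW js) sT.
  rewrite ger0_norm ?subr_ge0 ?(ltW js)//; apply: le_lt_trans hr.
  by rewrite lerBlDr (le_trans sj)// -natr1 mulrDl mul1r addrC.
have h4 : \sum_(j < i * l) v j w * (B (j.+1%:R * kk) w - B (j%:R * kk) w) =
   \sum_(j < i * l) b (X (j%:R * kk) w) * dB B kk j w - \sum_(j < i) b (X (j%:R * h) w) * dB B h j w.
  have E : \sum_(j < i) b (X (j%:R * h) w) * dB B h j w =
      \sum_(j < i * l) b (X (tj j) w) * dB B kk j w.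
    rewrite /tj /dB (sum_coarsen (fun j => b (X (j%:R * h) w)) (fun j => B (j%:R * kk) w))//.
    by apply: eq_bigr => j _; rewrite !natrM -!mulrA lkk.
  by rewrite E -sumrB; apply: eq_bigr => j _; rewrite /v -mulrBl.
rewrite h4 in h2; rewrite big_split/=.
move: h1 h2 h3; rewrite -/kk.
set I := \int[mu]_(s in _) _; set S1 := \sum_(j < i * l) _; set S2 := \sum_(j < i) b _ * _.
set S3 := \sum_(j < i) _; set x := X _ w => h1 h2 h3.
have -> : x - (x0 + (S3 + S2)) = (x - x0 - I - S1) + (S1 - S2) + (I - S3) by ring.
apply: (le_trans (ler_normD _ _)); have := ler_normD (x - x0 - I - S1) (S1 - S2); lra.
Qed.

End defect.

(** * Perturbed Euler recursions against the derivative-free Milstein scheme *)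

Section perturbed_euler_step.
Context {R : realType}.
Variables (a a' b b' : R -> R) (L : R).
Hypothesis (Ha : lipschitz_diff L a a') (Hb : lipschitz_diff L b b').

(** No rate is wanted here, so the whole Milstein correction is counted as a centred local error:
    [k = |e| + sqrt h * |y|] in [step_integral], with power [2]. *)
Lemma perturbed_euler_step : exists2 C : R, 0 <= C & forall h u y e, 0 < h <= 1 ->
  (\int[normal_prob 0 1]_x ((u + a (u + e) * h + b (u + e) * (Num.sqrt h * x) -
      rk_step a b h y (Num.sqrt h * x)) ^+ 2)%:E <=
    ((1 + C * h) * (u - y) ^+ 2 + C * h * (2 * e ^+ 2 + 2 * (h * y ^+ 2)))%:E)%E.
Proof.
have [C C0 HC] := gauss_sqr1_moment (R := R) 2.
pose K := 2 * L ^+ 2.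
have L1 := ld_ge1 Hb; have L0 : 0 <= L by apply: le_trans L1.
have K1 : 1 <= K by rewrite /K; nra.
have K0 : 0 <= K by apply: le_trans K1.
pose C' := 2 ^+ 2 * step_const 2 * (K ^+ 2 * C) : R.
have C'0 : 0 <= C' by rewrite !mulr_ge0 ?exprn_ge0 ?step_const_ge0.
exists C' => // h u y e h01; have [s0 s1 hs ss] := sqrt_le1 h01.
case/andP: (h01) => h0 h1.
pose w x := K * (1 + x ^+ 2).
pose m (x : R) := (a (u + e) - a y) * h.
pose z x := Num.sqrt h * (b (u + e) - b y) * x - 2^-1 * h * rk_slope b h y * (x ^+ 2 - 1).
pose k := `|e| + Num.sqrt h * `|y|.
have k0 : 0 <= k by rewrite addr_ge0// mulr_ge0// ltW.
have Ey x : (u + a (u + e) * h + b (u + e) * (Num.sqrt h * x) - rk_step a b h y (Num.sqrt h * x)) ^+ 2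
   = ((u - y) + (m x + z x)) ^+ 2.
  by rewrite rk_step_scaled ?(ltW h0)// /m /z; congr (_ ^+ 2); ring.
under eq_integral do rewrite Ey.
have w1 x : 1 <= w x.
  by rewrite /w -[leLHS]mulr1 ler_pM// ?sqr1_ge1.
have lip (c c' : R -> R) : lipschitz_diff L c c' -> `|c (u + e) - c y| <= L * (`|u - y| + `|e|).
  move=> Hc; apply: (le_trans (ld_lip Hc _ _)); rewrite ler_wpM2l//.
  by rewrite (_ : u + e - y = (u - y) + e) ?ler_normD//; ring.
have sy0 : 0 <= Num.sqrt h * `|y| by rewrite mulr_ge0// ltW.
have LK : L <= K by rewrite /K; nra.
have H : (\int[normal_prob 0 1]_x (((u - y) + (m x + z x)) ^+ 2)%:E <=
   ((1 + C' * h) * (u - y) ^+ 2 + C' * h * k ^+ 2)%:E)%E.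
  apply: (@step_integral R _ (measurableTypeR R) (normal_prob 0 1) 2 h (u - y) k (K ^+ 2 * C) w m z) => //.
  - exact: probability_setT.
  - by rewrite (ltW h0).
  - move=> x; rewrite /m mulrC normrM (gtr0_norm h0) -mulrA ler_wpM2l// ?(ltW h0)//.
    apply: (le_trans (lip _ _ Ha)); rewrite mulrC ler_pM ?addr_ge0//; first by rewrite /k; lra.
    by apply: (le_trans LK); rewrite /w ler_peMr// sqr1_ge1.
  - move=> x; rewrite /z /w.
    have B1 : `|Num.sqrt h * (b (u + e) - b y) * x| <= Num.sqrt h * (L * (`|u - y| + `|e|)) * (1 + x ^+ 2).
      apply: norm_leM; last exact: norm_le_sqr1.
      by rewrite normrM (gtr0_norm s0) ler_wpM2l ?(ltW s0)//; exact: lip Hb.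
    have B2 : `|2^-1 * h * rk_slope b h y * (x ^+ 2 - 1)| <=
        2^-1 * h * (L ^+ 2 * `|y|) * (1 + x ^+ 2).
      apply: norm_leM; last exact: normB1_le_sqr1.
      apply: norm_leM; last exact: (rk_slope_bound Hb).
      by rewrite ger0_norm ?mulr_ge0 ?(ltW h0).
    apply: (le_trans (norm_leD B1 (norm_leN B2))).
    rewrite -mulrDl [leRHS]mulrA ler_wpM2r ?sqr1_ge0//.
    have -> : 2^-1 * h * (L ^+ 2 * `|y|) = Num.sqrt h * (2^-1 * L ^+ 2 * (Num.sqrt h * `|y|)).
      by rewrite -[X in _ * X * _ = _]ss; ring.
    rewrite -mulrDr -[leRHS]mulrA ler_wpM2l ?(ltW s0)// [leRHS]mulrC.
    have ue0 : 0 <= `|u - y| + `|e| by rewrite addr_ge0.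
    have h5 := ler_wpM2r ue0 LK.
    have h6 : 2^-1 * L ^+ 2 * (Num.sqrt h * `|y|) <= K * (Num.sqrt h * `|y|).
      by rewrite ler_wpM2r// /K; have := exprn_ge0 2 L0; lra.
    by rewrite /k; lra.
  - by rewrite /w; mfun.
  - by rewrite /m; mfun.
  - by rewrite /z; mfun.
  - rewrite /w; under eq_integral do rewrite exprMn.
    rewrite intEZ; [|by mfun|by move=> x; rewrite exprn_ge0 ?sqr1_ge0|by rewrite exprn_ge0].
    by rewrite [leRHS]EFinM lee_wpmul2l// lee_fin exprn_ge0.
  - rewrite -[RHS](gauss_cubic 0 (Num.sqrt h * (b (u + e) - b y)) (- (2^-1 * h * rk_slope b h y)) 0).
    by apply: eq_integral => x _; rewrite /z mul0r addr0 add0r mulNr.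
apply: (le_trans H); rewrite lee_fin lerD2l (ler_wpM2l (mulr_ge0 C'0 (ltW h0)))//.
have nE (t : R) : t ^+ 2 = `|t| ^+ 2 by rewrite real_normK ?num_real.
rewrite (nE e) (nE y).
have -> : h * `|y| ^+ 2 = (Num.sqrt h * `|y|) ^+ 2 by rewrite -[X in X * _ = _]ss; ring.
by rewrite /k; have := sqr_ge0 (`|e| - Num.sqrt h * `|y|); lra.
Qed.

End perturbed_euler_step.

Section rk_convergence.
Context {R : realType} {d : measure_display} {Omega : measurableType d}.
Variables (P : probability Omega R) (Filt : R -> set (set Omega)).
Variable (B : R -> Omega -> R).
Hypothesis HF : is_filtration Filt.
Hypothesis HB : is_wiener P Filt B.
Variables (a a' b b' : R -> R) (L : R).
Hypothesis (Ha : lipschitz_diff L a a') (Hb : lipschitz_diff L b b').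
Variable x0 : R.
Local Notation rk := (rk_scheme B a b x0).

(** When [v] is the defect of the solution, [u + v m w] is the solution itself and the recursion
    produces the Euler sums along it. *)
Fixpoint perturbed_euler (v : nat -> Omega -> R) (h : R) (n : nat) (w : Omega) : R :=
  if n is m.+1 then
    let u := perturbed_euler v h m w in
    u + a (u + v m w) * h + b (u + v m w) * dB B h m w
  else x0.

Lemma perturbed_euler_Fmeas v h n : 0 < h ->
  (forall i, (i < n)%N -> Fmeas Filt (i%:R * h) (v i)) ->
  Fmeas Filt (n%:R * h) (perturbed_euler v h n).
Proof.
move=> h0; elim: n => [|n IH] mv; first exact: measurable_cst.
have hn := time_ge0 n h0; have hS := ltW (time_lt n h0).
have mU := Fmeas_le HF hn hS (IH (fun i im => mv i (ltnW im))).
have mvn := Fmeas_le HF hn hS (mv n (ltnSn n)).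
have mdB := dB_Fmeas HF HB (n := n) h0.
have ma := measurable_lipschitz (ld_lip Ha); have mb := measurable_lipschitz (ld_lip Hb).
rewrite /=; apply: measurable_funD; first apply: measurable_funD.
- exact: mU.
- apply: measurable_funM; last exact: measurable_cst.
  by apply: (measurableT_comp ma); exact: measurable_funD.
- apply: measurable_funM; last exact: mdB.
  by apply: (measurableT_comp mb); exact: measurable_funD.
Qed.

Lemma perturbed_euler_rk_error (T : R) : 0 <= T -> exists2 K : R, 0 <= K &
  forall h n eps (v : nat -> Omega -> R), 0 < h <= 1 -> n%:R * h <= T ->
  (forall i, (i < n)%N -> Fmeas Filt (i%:R * h) (v i)) ->
  (forall i w, (i < n)%N -> `|v i w| <= eps) ->
  (\int[P]_w ((perturbed_euler v h n w - rk h n w) ^+ 2)%:E <= (K * (eps ^+ 2 + h))%:E)%E.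
Proof.
move=> T0.
have [mom mom0 Hmom] := rk_scheme_moment HF HB Ha Hb x0 (isT : ~~ odd 2) (isT : (1 < 2)%N) T0.
have [C C0 HC] := perturbed_euler_step Ha Hb.
exists (expR (C * T) * (2 * (1 + mom))); first by rewrite !mulr_ge0 ?expR_ge0 ?addr_ge0.
move=> h N eps v h01 NT mv veps; case/andP: (h01) => h0 h1.
pose E n := (\int[P]_w ((perturbed_euler v h n w - rk h n w) ^+ 2)%:E)%E.
pose K := 2 * eps ^+ 2 + 2 * (h * (1 + mom)).
have K0 : 0 <= K by rewrite addr_ge0// mulr_ge0 ?sqr_ge0 ?mulr_ge0 ?(ltW h0) ?addr_ge0.
have H := @discrete_gronwall _ E N (C * h) 0 K.
apply: (@le_trans _ _ (expR (N%:R * (C * h)) * (0 + K))%:E); last first.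
  rewrite lee_fin add0r -mulrA ler_pM ?expR_ge0//.
    by rewrite ler_expR mulrCA ler_wpM2l.
  have := mulr_ge0 mom0 (sqr_ge0 eps); rewrite /K; lra.
apply: H => //.
- by rewrite mulr_ge0// ltW.
- rewrite /E /= (_ : (fun w : Omega => _) = cst 0%E); last first.
    by apply/funext => w /=; rewrite subrr expr0n.
  by rewrite integral0.
move=> n nN; rewrite /E.
pose Z w := (perturbed_euler v h n w, v n w, rk h n w).
have mU := perturbed_euler_Fmeas h0 (fun i im => mv i (ltn_trans im nN)).
have mvn := mv n nN.
have mrkF := rk_scheme_Fmeas HF HB Ha Hb x0 (n := n) h0.
have mZ : Fmeas Filt (n%:R * h) Z.
  by apply: measurable_fun_pair; [apply: measurable_fun_pair|].
pose Psi (x : R * R * R * R) := (x.1.1.1 + a (x.1.1.1 + x.1.1.2) * h + b (x.1.1.1 + x.1.1.2) * x.2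
   - rk_step a b h x.1.2 x.2) ^+ 2.
pose Kf (z : R * R * R) := (1 + C * h) * (z.1.1 - z.2) ^+ 2 + C * h * (2 * z.1.2 ^+ 2 + 2 * (h * z.2 ^+ 2)).
have m1 : measurable_fun [set: R * R * R * R] (fun x : R * R * R * R => x.1.1.1).
  exact (measurableT_comp measurable_fst (measurableT_comp measurable_fst measurable_fst)).
have m2 : measurable_fun [set: R * R * R * R] (fun x : R * R * R * R => x.1.1.2).
  exact (measurableT_comp measurable_snd (measurableT_comp measurable_fst measurable_fst)).
have m3 : measurable_fun [set: R * R * R * R] (fun x : R * R * R * R => x.1.2).
  exact (measurableT_comp measurable_snd measurable_fst).
have m4 : measurable_fun [set: R * R * R * R] (fun x : R * R * R * R => x.2) by exact: measurable_snd.
have ma := measurable_lipschitz (ld_lip Ha); have mb := measurable_lipschitz (ld_lip Hb).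
have mPsi : measurable_fun [set: R * R * R * R] Psi.
  have m12 := measurable_funD m1 m2.
  have mac := measurableT_comp ma m12; have mbc := measurableT_comp mb m12.
  apply: measurable_funX; apply: measurable_funB.
    apply: measurable_funD; first apply: measurable_funD => //.
      by apply: measurable_funM; [exact: mac|exact: measurable_cst].
    by apply: measurable_funM; [exact: mbc|].
  by apply: (measurable_rk_step Ha Hb).
have n1 : measurable_fun [set: R * R * R] (fun x : R * R * R => x.1.1).
  exact (measurableT_comp measurable_fst measurable_fst).
have n2 : measurable_fun [set: R * R * R] (fun x : R * R * R => x.1.2).
  exact (measurableT_comp measurable_snd measurable_fst).
have n3 : measurable_fun [set: R * R * R] (fun x : R * R * R => x.2) by exact: measurable_snd.
have mKf : measurable_fun [set: R * R * R] Kf by rewrite /Kf; mfun.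
have HK (z : R * R * R) : (\int[normal_prob 0 1]_x
     (Psi (z, Num.sqrt h * x))%:E <= (Kf z)%:E)%E.
  exact: (HC h z.1.1 z.2 z.1.2 h01).
have H2 := expect_scheme_le HF HB h0 mZ mPsi (fun x => sqr_ge0 _) mKf HK.
apply: (le_trans H2).
have mA := Fmeas_measurable HF (time_ge0 n h0) mU.
have mV := Fmeas_measurable HF (time_ge0 n h0) mvn.
have mB := Fmeas_measurable HF (time_ge0 n h0) mrkF.
have Ch : 0 <= C * h by rewrite mulr_ge0// ltW.
have e1 w : 0 <= (perturbed_euler v h n w - rk h n w) ^+ 2 by exact: sqr_ge0.
have e3 w : 0 <= h * rk h n w ^+ 2 by exact: mulr_ge0 (ltW h0) (sqr_ge0 _).
have e2 w : 0 <= 2 * v n w ^+ 2 + 2 * (h * rk h n w ^+ 2).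
  by have := e3 w; have := sqr_ge0 (v n w); lra.
rewrite /Kf /Z /= intED; [|by mfun|by mfun| |]; last 2 first.
- by move=> w; exact: mulr_ge0 (addr_ge0 ler01 Ch) (e1 w).
- by move=> w; exact: mulr_ge0 Ch (e2 w).
rewrite intEZ; [|by mfun|by []|by rewrite addr_ge0].
rewrite intEZ; [|by mfun|by []|by []].
rewrite leeD2l// [leRHS]EFinM lee_wpmul2l//.
have mom4 : (\int[P]_w (rk h n w ^+ 4)%:E <= mom%:E)%E.
  by apply: (Hmom h n h01); apply: le_trans NT; rewrite ler_wpM2r ?(ltW h0)// ler_nat ltnW.
apply: (@le_trans _ _ (\int[P]_w (2 * eps ^+ 2 + 2 * h * (1 + rk h n w ^+ 4))%:E)%E).
  apply: le_intE; [by mfun|by mfun|by []|].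
  move=> w; rewrite -mulrA; apply: lerD; rewrite ler_wpM2l//.
    rewrite -[leLHS]real_normK ?num_real// lerXn2r ?nnegrE//; last exact: veps.
    exact: le_trans (veps n w nN).
  rewrite ler_wpM2l ?(ltW h0)//; have := sqr_ge0 (rk h n w ^+ 2 - 2^-1).
  have := sqr_ge0 (rk h n w); rewrite (_ : rk h n w ^+ 4 = (rk h n w ^+ 2) ^+ 2); last by rewrite -exprM.
  nra.
have e4 w : 0 <= rk h n w ^+ 4 by rewrite exprn_even_ge0.
have h20 : 0 <= 2 * h by rewrite mulr_ge0// ltW.
rewrite intED; [|by mfun|by mfun|by move=> w; rewrite mulr_ge0 ?sqr_ge0|]; last first.
  by move=> w; rewrite mulr_ge0// addr_ge0.
rewrite intE_cst; last exact: probability_setT.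
rewrite intEZ; [|by mfun|by move=> w; rewrite addr_ge0|by []].
rewrite intED; [|by mfun|by mfun|by []|by []].
rewrite intE_cst; last exact: probability_setT.
rewrite /K EFinD leeD2l// mulrA [leRHS]EFinM lee_wpmul2l//.
by rewrite EFinD leeD2l.
Qed.

Local Notation mu := (@lebesgue_measure R).
Variables (X H K : R -> Omega -> R).
Hypothesis aX : adapted Filt X.
Hypothesis cX : continuous_paths P X.
Hypothesis HE : forall s w, 0 <= s -> H s w = b (X s w).
Hypothesis KE : forall s w, 0 <= s -> K s w = a (X s w).
Hypothesis X0 : {ae P, forall w, X 0 w = x0}.
Hypothesis HX : forall t : R, 0 <= t -> exists2 I : Omega -> R,
  is_ito_integral P Filt B H t I &
  {ae P, forall w, X t w = x0 + (\int[mu]_(s in `[0, t]) K s w) + I w}.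

Lemma rk_scheme_cvg (T lam eta : R) : 0 < T -> 0 < lam -> 0 < eta ->
  exists M0 : nat, forall M, (M0 <= M)%N -> (0 < M)%N /\
  likely P eta (fun w => `|X T w - rk (T / M%:R) M w| <= lam).
Proof.
move=> T0 lam0 eta0.
have [C C0 HC] := perturbed_euler_rk_error (ltW T0).
have lam2 : 0 < lam / 2 by rewrite divr_gt0.
have eta2 : 0 < eta / 2 by rewrite divr_gt0.
have C1 : 0 < C + 1 by rewrite ltr_wpDl.
(* Chosen so that [eps ^+ 2 <= c] and [h <= c] give [C * (eps ^+ 2 + h) <= eta / 2 * (lam / 2) ^+
   2], as Chebyshev requires. *)
pose c := eta / 2 * (lam / 2) ^+ 2 / (2 * (C + 1)).
have c0 : 0 < c by rewrite divr_gt0 ?mulr_gt0 ?exprn_gt0.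
pose eps := Num.min (lam / 2) (Num.sqrt c).
have sc0 : 0 < Num.sqrt c by rewrite sqrtr_gt0.
have eps0 : 0 < eps by rewrite lt_min lam2.
have eps2 : eps ^+ 2 <= c.
  rewrite -[leRHS]sqr_sqrtr ?(ltW c0)// lerXn2r ?nnegrE ?(ltW eps0) ?(ltW sc0)//.
  by rewrite ge_min lexx orbT.
have ma := measurable_lipschitz (ld_lip Ha); have mb := measurable_lipschitz (ld_lip Hb).
have ca := continuous_lipschitz (ld_lip Ha).
have [M1 HM1] := euler_defect HF HB aX cX (ld_ge1 Hb) (ld_lip Ha) (ld_lip Hb) ca mb HE KE X0 HX
  T0 eps0 eta2.
pose c1 := Num.min c 1.
have c10 : 0 < c1 by rewrite lt_min c0 ltr01.
have [M2 HM2] := fine_mesh T0 c10.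
exists (maxn M1 M2) => M; rewrite geq_max => /andP[M1M /HM2[M0 /andP[h0 /ltW hc1]]].
have [_ HD] := HM1 M M1M; split => //.
have MR : 0 < M%:R :> R by rewrite ltr0n.
set h := T / M%:R in h0 hc1 HD *.
have hc : h <= c by apply: (le_trans hc1); rewrite ge_min lexx.
have h1 : h <= 1 by apply: (le_trans hc1); rewrite ge_min lexx orbT.
have Mh : M%:R * h = T by rewrite /h mulrC divfK// gt_eqF.
pose S i w := x0 + \sum_(j < i) (a (X (j%:R * h) w) * h + b (X (j%:R * h) w) * dB B h j w).
pose D i w := X (i%:R * h) w - S i w.
(* The defect is small only with high probability, while the L^2 comparison needs a bound
   everywhere. Truncation provides it, keeps [v] adapted, and changes nothing on the likely
   event. *)
pose v i w := Num.max (- eps) (Num.min (D i w) eps).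
have FX i : Fmeas Filt (i%:R * h) (X (i%:R * h)).
  by apply/(FmeasP HF _ (time_ge0 i h0)); apply: aX; exact: time_ge0.
have mS i : Fmeas Filt (i%:R * h) (S i).
  apply: measurable_funD; first exact: measurable_cst.
  apply: measurable_sum => j.
  have ji : j.+1%:R * h <= i%:R * h by rewrite ler_pM2r// ler_nat.
  have FXj : Fmeas Filt (i%:R * h) (X (j%:R * h)).
    by apply: (Fmeas_le HF (time_ge0 j h0) _ (FX j)); apply: le_trans ji; apply: ltW; exact: time_lt.
  have FB := Fmeas_le HF (time_ge0 j.+1 h0) ji (dB_Fmeas HF HB (n := j) h0).
  apply: measurable_funD; apply: measurable_funM.
  - exact: (measurableT_comp ma).
  - exact: measurable_cst.
  - exact: (measurableT_comp mb).
  - exact: FB.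
have mv i : Fmeas Filt (i%:R * h) (v i).
  apply: measurable_maxr; first exact: measurable_cst.
  apply: measurable_minr; last exact: measurable_cst.
  exact (measurable_funB (FX i) (mS i)).
have veps i w : `|v i w| <= eps.
  by rewrite ler_norml /v le_max lexx/= ge_max ge_min lexx orbT andbT ge0_cp// ltW.
have h01 : 0 < h <= 1 by rewrite h0.
have MT : M%:R * h <= T by rewrite Mh.
have HU := HC h M eps v h01 MT (fun i _ => mv i) (fun i w _ => veps i w).
have mU : measurable_fun [set: Omega] (fun w => perturbed_euler v h M w - rk h M w).
  apply: measurable_funB; last exact: (measurable_rk_scheme HF HB Ha Hb).
  exact: (Fmeas_measurable HF (time_ge0 M h0) (perturbed_euler_Fmeas h0 (fun i _ => mv i))).
have PU := chebyshev_sqr lam2 mU HU.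
have ceta : C * (eps ^+ 2 + h) / (lam / 2) ^+ 2 <= eta / 2.
  rewrite ler_pdivrMr ?exprn_gt0//.
  have -> : eta / 2 * (lam / 2) ^+ 2 = (C + 1) * (c + c) by rewrite /c; field; rewrite gt_eqF.
  apply: ler_pM => //; [|by rewrite lerDl|exact: lerD].
  by rewrite addr_ge0 ?sqr_ge0// ltW.
have L2 := likely_mono ceta (fun w Uw => Uw) PU.
apply: likely_mono (likelyI HD L2); first lra.
move=> w [Dw Uw].
have vE i : (i <= M)%N -> v i w = D i w.
  move=> iM; have := Dw i iM; rewrite -/(S i w) -/(D i w) ler_norml => /andP[d1 d2].
  by rewrite /v min_l// max_r.
have UE i : (i <= M)%N -> perturbed_euler v h i w = S i w.
  elim: i => [|i IH] iM; first by rewrite /S big_ord0 addr0.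
  rewrite /= IH ?(ltnW iM)// vE ?(ltnW iM)// /D (addrC (S i w) (_ - _)) subrK /S big_ord_recr/=.
  by rewrite !addrA.
have := Dw M (leqnn M); rewrite -/(S M w) -UE// Mh => d1.
have -> : X T w - rk h M w = (X T w - perturbed_euler v h M w) + (perturbed_euler v h M w - rk h M w) by ring.
apply: (le_trans (ler_normD _ _)).
have el : eps <= lam / 2 by rewrite ge_min lexx.
lra.
Qed.

End rk_convergence.

(** * Differentiation on the half-line *)

Section half_derivatives.
Context {R : realType}.
Implicit Types (h k : R -> R).

Let HL (x : R) : set_system R := within `[0, +oo[ x^'.

Let HLfilter x : Filter (HL x).
Proof. exact: within_filter. Qed.

Let HLproper (x : R) : 0 <= x -> ProperFilter (HL x).
Proof.
move=> x0; apply: (Build_ProperFilter _ (HLfilter x)).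
rewrite /HL /within/= => /nbhs_ballP[r /= r0 H].
apply: (H (x + r / 2)).
- rewrite /ball/= opprD addrA subrr sub0r normrN gtr0_norm ?divr_gt0//.
  by rewrite ltr_pdivrMr// ltr_pMr// ltr1n.
- by rewrite -subr_eq0 addrC addKr gt_eqF// divr_gt0.
- by rewrite in_itv/= andbT addr_ge0// divr_ge0// ltW.
Qed.

Lemma derive_halfP h x l : 0 <= x -> half_quotient_at h x --> l ->
  derivable_half h x /\ derive_half h x = l.
Proof.
move=> x0 hl; split; first by apply/cvg_ex; exists l.
have Hp := HLproper x0.
exact: (cvg_lim (@norm_hausdorff _ _) hl).
Qed.

Lemma derive_half_expansion h x : derivable_half h x -> forall e, 0 < e ->
  exists2 r : R, 0 < r & forall y, 0 <= y -> `|y - x| < r ->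
    `|h y - h x - derive_half h x * (y - x)| <= e * `|y - x|.
Proof.
move=> dh e e0.
have /cvgrPdist_lt/(_ e e0) : half_quotient_at h x --> derive_half h x by exact: dh.
rewrite /prop_near1 /within /= => /nbhs_ballP[r /= r0 H].
exists r => // y y0 yx; have [->|yNx] := eqVneq y x.
  by rewrite !subrr mulr0 subrr normr0 mulr0.
have yx0 : y - x != 0 by rewrite subr_eq0.
have := H y; rewrite /ball/= distrC => /(_ yx yNx); rewrite in_itv/= andbT => /(_ y0) Hy.
have -> : h y - h x - derive_half h x * (y - x) =
    - (derive_half h x - (h y - h x) / (y - x)) * (y - x) by field.
by rewrite normrM normrN ler_pM// ltW.
Qed.

Lemma derive_halfB h c x : derivable_half h x ->
  derivable_half (fun y => h y - c) x /\ derive_half (fun y => h y - c) x = derive_half h x.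
Proof.
move=> dh; suff E : half_quotient_at (fun y => h y - c) x = half_quotient_at h x.
  by rewrite /derivable_half /derive_half E.
rewrite /half_quotient_at.
rewrite (_ : (fun y => (h y - c - (h x - c)) / (y - x)) = (fun y => (h y - h x) / (y - x)))//.
by apply/funext => y; congr (_ / _); ring.
Qed.

(** Given [h 0 = 0], oddness makes the derivative the even function [derive_half h |x|], which is
    continuous at [0] and inherits Lipschitz bounds from the half-line. *)
Definition odd_ext h x := if 0 <= x then h x else - h (- x).

Lemma odd_ext_ge0 h x : 0 <= x -> odd_ext h x = h x.
Proof. by rewrite /odd_ext => ->. Qed.

Lemma is_derive_expansion (f : R -> R) x l :
  (forall e, 0 < e -> exists2 r : R, 0 < r & forall y, `|y - x| < r ->
    `|f y - f x - l * (y - x)| <= e * `|y - x|) -> is_derive x 1 f l.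
Proof.
move=> H.
have C : (fun t => t^-1 *: (f (t *: (1 : R) + x) - f x)) @ 0^' --> l.
  apply/cvgrPdist_le => /= e e0; have [r r0 Hr] := H e e0.
  apply/nbhs_ballP; exists r => //= t tr t0; rewrite /ball/= sub0r normrN in tr.
  have E : t *: (1 : R) + x - x = t by rewrite addrK /GRing.scale/= mulr1.
  have := Hr (t *: (1 : R) + x); rewrite E => /(_ tr) Ht.
  have -> : l - t^-1 *: (f (t *: (1 : R) + x) - f x) = - (t^-1 * (f (t *: (1 : R) + x) - f x - l * t)).
    by rewrite [X in l - X]/GRing.scale/=; field.
  by rewrite normrN normrM normfV ler_pdivrMl ?normr_gt0// [leRHS]mulrC.
have dfx : derivable f x 1 by apply/cvg_ex; exists l; exact C.
have dvl : 'D_1 f x = l by exact (cvg_lim (@norm_hausdorff _ _) C).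
exact (DeriveDef dfx dvl).
Qed.

Lemma is_derive_odd_ext h : h 0 = 0 -> (forall x, 0 <= x -> derivable_half h x) ->
  forall x : R, is_derive x 1 (odd_ext h) (derive_half h `|x|).
Proof.
move=> h0 dh x; apply: is_derive_expansion => e e0.
have [r r0 Hr] := derive_half_expansion (dh _ (normr_ge0 x)) e0.
have [x0|x0|x0] := ltgtP 0 x.
- rewrite (gtr0_norm x0) in Hr *; exists (Num.min r x); first by rewrite lt_min r0.
  move=> y; rewrite lt_min => /andP[yr yx].
  have y0 : 0 <= y by move: yx; rewrite ltr_norml => /andP[h1 _]; lra.
  by rewrite !odd_ext_ge0 ?(ltW x0)//; exact: Hr.
- rewrite (ltr0_norm x0) in Hr *; exists (Num.min r (- x)); first by rewrite lt_min r0 oppr_gt0.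
  move=> y; rewrite lt_min => /andP[yr yx].
  have y0 : y < 0 by move: yx; rewrite ltr_norml => /andP[_ h1]; lra.
  have E : - y - - x = - (y - x) by ring.
  rewrite /odd_ext (leNgt 0 x) (leNgt 0 y) x0 y0/= -normrN -[`|y - x|]normrN -E.
  rewrite (_ : - (- h (- y) - - h (- x) - derive_half h (- x) * (y - x)) =
     h (- y) - h (- x) - derive_half h (- x) * (- y - - x)); last by ring.
  by apply: Hr; [rewrite oppr_ge0 ltW|rewrite E normrN].
- rewrite -x0 normr0 in Hr *; exists r => // y yr.
  have [y0|y0] := leP 0 y; first by rewrite !odd_ext_ge0//; exact: Hr.
  rewrite (odd_ext_ge0 _ (lexx 0)) /odd_ext (leNgt 0 y) y0/= h0 !subr0.
  have -> : - h (- y) - derive_half h 0 * y = - (h (- y) - derive_half h 0 * (- y)) by ring.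
  rewrite subr0 in yr; have := Hr (- y); rewrite h0 !subr0 !normrN; apply => //.
  by rewrite oppr_ge0 ltW.
Qed.

Lemma mean_value (f df : R -> R) x y : (forall z : R, is_derive z 1 f (df z)) ->
  exists2 c, `|c - x| <= `|y - x| & f y - f x = df c * (y - x).
Proof.
move=> H.
have cf : continuous f.
  by move=> z; apply/differentiable_continuous/derivable1_diffP; have [] := H z.
have M u v : u < v -> exists2 c, u < c < v & f v - f u = df c * (v - u).
  move=> uv; have [c] := MVT uv (fun z _ => H z) (continuous_subspaceT cf).
  by rewrite in_itv/= => cuv E; exists c.
have [xy|yx|->] := ltgtP x y; last by exists y; rewrite ?subrr ?mulr0.
- have [c /andP[xc cy] E] := M _ _ xy; exists c => //.
  by rewrite !ger0_norm ?subr_ge0 ?(ltW xy) ?(ltW xc)// lerB// ltW.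
- have [c /andP[yc cx] E] := M _ _ yx; exists c.
    by rewrite !ler0_norm ?subr_le0 ?(ltW yx) ?(ltW cx)// lerN2 lerB// ltW.
  by rewrite -opprB E; ring.
Qed.

Lemma lipschitz_derive (f df : R -> R) L : (forall z : R, is_derive z 1 f (df z)) ->
  (forall z, `|df z| <= L) -> forall x y, `|f x - f y| <= L * `|x - y|.
Proof.
by move=> H dfL x y; have [c _ ->] := mean_value y x H; rewrite normrM ler_wpM2r.
Qed.

Lemma lipschitz_diff_derive (f df : R -> R) L : 1 <= L -> f 0 = 0 ->
  (forall z : R, is_derive z 1 f (df z)) -> (forall z, `|df z| <= L) ->
  (forall x y, `|df x - df y| <= L * `|x - y|) -> lipschitz_diff L f df.
Proof.
move=> L1 f0 H dfL dfL'; split => //; first exact: lipschitz_derive dfL.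
move=> x y; have [c cx ->] := mean_value x y H.
have L0 : 0 <= L by apply: le_trans L1.
rewrite -mulrBl normrM -(real_normK (num_real (y - x))) expr2 mulrA ler_wpM2r//.
by apply: (le_trans (dfL' _ _)); rewrite ler_wpM2l.
Qed.

Lemma lipschitz_diff_odd_ext h (L : R) : C2_bounded_derivatives h -> h 0 = 0 ->
  (forall x, 0 <= x -> `|derive_half h x| <= L) ->
  (forall x, 0 <= x -> `|derive_half (derive_half h) x| <= L) -> 1 <= L ->
  lipschitz_diff L (odd_ext h) (fun x => derive_half h `|x|).
Proof.
move=> [dh ddh _ _ _] h0 B1 B2 L1; apply: lipschitz_diff_derive => //.
- by rewrite odd_ext_ge0.
- exact: is_derive_odd_ext.
- by move=> z; exact: B1.
(* Subtracting the value at [0] makes the first derivative eligible for an odd extension, whose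
   derivative is bounded by the second derivative of [h]; [|x|] then costs nothing, being
   1-Lipschitz. *)
move=> x y; pose k z := derive_half h z - derive_half h 0.
have dk z : 0 <= z -> derivable_half k z /\ derive_half k z = derive_half (derive_half h) z.
  by move=> z0; apply: derive_halfB; exact: ddh.
have k0 : k 0 = 0 by rewrite /k subrr.
have H := is_derive_odd_ext k0 (fun z z0 => (dk z z0).1).
have L0 : 0 <= L by apply: le_trans L1.
have kL := lipschitz_derive H (L := L).
have {}kL : forall x y, `|odd_ext k x - odd_ext k y| <= L * `|x - y|.
  by apply: kL => z; rewrite (dk _ (normr_ge0 z)).2; exact: B2.
have -> : derive_half h `|x| - derive_half h `|y| = odd_ext k `|x| - odd_ext k `|y|.
  by rewrite !odd_ext_ge0// /k; ring.
by apply: (le_trans (kL _ _)); rewrite ler_wpM2l// ler_dist_dist.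
Qed.

(** The fundamental theorem of calculus for [t -> h (t * x) / x] on [[0, 1]]. The function [phi] is
    a continuous extension of the derivative to the line, as the values at negative arguments are
    arbitrary. *)
Lemma mean_deriveE h phi x : h 0 = 0 -> (forall x, 0 <= x -> derivable_half h x) ->
  continuous phi -> (forall y, 0 <= y -> derive_half h y = phi y) -> 0 < x ->
  mean_derive h x = h x / x.
Proof.
move=> h0 dh cphi hphi x0.
pose f (t : R) := phi (t * x); pose F (t : R) := odd_ext h (t * x) / x.
have cf : continuous f.
  move=> t; apply: (@continuous_comp R R R (fun t => t * x) phi t); last exact: cphi.
  exact: mulrr_continuous.
have dF (t : R) : is_derive t 1 F (derive_half h `|t * x|).
  have d1 : is_derive t 1 (fun t : R => t * x) x.
    have : is_derive t 1 (fun t : R => x *: t) (x *: (1 : R)) by exact: is_deriveZ.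
    rewrite (_ : (fun t : R => x *: t) = (fun t => t * x)); last by apply/funext => u; rewrite mulrC.
    by rewrite /GRing.scale/= mulr1.
  have d2 := @is_derive1_comp R (odd_ext h) (fun t => t * x) t _ _ (is_derive_odd_ext h0 dh (t * x)) d1.
  have : is_derive t 1 (fun t => x^-1 *: odd_ext h (t * x)) (x^-1 *: (derive_half h `|t * x| * x)).
    exact: is_deriveZ.
  rewrite (_ : (fun t => x^-1 *: odd_ext h (t * x)) = F); last first.
    by apply/funext => u; rewrite /F [RHS]mulrC.
  by rewrite (_ : x^-1 *: (derive_half h `|t * x| * x) = derive_half h `|t * x|)// /GRing.scale/= mulrC mulfK// gt_eqF.
have cF : continuous F.
  by move=> z; apply/differentiable_continuous/derivable1_diffP; have [] := dF z.
rewrite /mean_derive (@eq_Rintegral _ _ _ (@lebesgue_measure R) _ f); last first.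
  move=> t; rewrite inE/= in_itv/= => /andP[t0 _].
  by rewrite /f hphi// mulr_ge0// ltW.
rewrite /Rintegral (@continuous_FTC2 R f F 0 1)//.
- by rewrite /F mul1r mul0r !odd_ext_ge0 ?(ltW x0)// h0 mul0r -EFinB subr0.
- exact: continuous_subspaceT.
- split.
  + by move=> t _; have [] := dF t.
  + by apply: cvg_at_right_filter; exact: cF.
  + by apply: cvg_at_left_filter; exact: cF.
- move=> t; rewrite in_itv/= => /andP[t0 _].
  rewrite derive1E (@derive_val _ _ _ _ _ _ _ (dF t)) /f ger0_norm ?hphi//.
    by rewrite mulr_ge0// ltW.
  by rewrite mulr_ge0// ltW.
Qed.

(** For [y] near [x] and [q] the difference quotient of [h], that of [h y / y] is exactly
    [(q * x - h x) / (x * y)]; the limit is immediate. *)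
Lemma derive_half_rel h x : derivable_half h x -> 0 < x ->
  (forall y, 0 < y -> mean_derive h y = h y / y) ->
  derive_half (mean_derive h) x = (derive_half h x * x - h x) / x ^+ 2.
Proof.
move=> dh x0 mE; apply: (derive_halfP (ltW x0) _).2.
have qh : (fun y => (h y - h x) / (y - x)) @ HL x --> derive_half h x by exact: dh.
have idc : (fun y : R => y) @ HL x --> x.
  by apply: cvg_within_filter; exact: nbhs_dnbhs.
have xx0 : x * x != 0 by rewrite mulf_neq0// gt_eqF.
have C : (fun y => ((h y - h x) / (y - x) * x - h x) * (x * y)^-1) @ HL x -->
   (derive_half h x * x - h x) * (x * x)^-1.
  apply: cvgM; first by apply: cvgB; [apply: cvgM => //; exact: cvg_cst|exact: cvg_cst].
  by apply: cvgV => //; apply: cvgM => //; exact: cvg_cst.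
rewrite expr2; apply: cvg_trans C; apply: near_eq_cvg.
rewrite /prop_near1 /within/=; apply/nbhs_ballP; exists x => //= y yx yNx _.
rewrite /ball/= in yx.
have y0 : 0 < y by move: yx; rewrite ltr_norml => /andP[_ h1]; lra.
have yx0 : y - x != 0 by rewrite subr_eq0.
by rewrite !mE//; field; rewrite yx0 !gt_eqF.
Qed.

(** [G] is not assumed differentiable; it is recovered as the Ito drift minus [2^-1 * g' g], and the
    product rule for [g' g] uses the continuity of [g']. *)
Lemma derive_half_stratonovich_drift G g x : 0 <= x ->
  C2_bounded_derivatives (ito_drift G g) -> C2_bounded_derivatives g ->
  (derive_half g y @[y --> HL x] --> derive_half g x) ->
  derivable_half G x /\ derive_half G x = derive_half (ito_drift G g) x -
    2^-1 * (derive_half g x * derive_half g x + g x * derive_half (derive_half g) x).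
Proof.
move=> x0 [dI _ _ _ _] [dg ddg _ _ _] ck; apply: derive_halfP => //.
have qI : (fun y => (ito_drift G g y - ito_drift G g x) / (y - x)) @ HL x -->
   derive_half (ito_drift G g) x by exact: (dI x x0).
have qg : (fun y => (g y - g x) / (y - x)) @ HL x --> derive_half g x by exact: (dg x x0).
have qk : (fun y => (derive_half g y - derive_half g x) / (y - x)) @ HL x -->
   derive_half (derive_half g) x by exact: (ddg x x0).
have C : (fun y => (ito_drift G g y - ito_drift G g x) / (y - x) -
   2^-1 * (derive_half g y * ((g y - g x) / (y - x)) +
           g x * ((derive_half g y - derive_half g x) / (y - x)))) @ HL x -->
  derive_half (ito_drift G g) x -
    2^-1 * (derive_half g x * derive_half g x + g x * derive_half (derive_half g) x).
  apply: cvgB => //; apply: cvgM; first exact: cvg_cst.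
  apply: cvgD; first exact: cvgM.
  by apply: cvgM => //; exact: cvg_cst.
rewrite /half_quotient_at; apply: cvg_trans C; apply: near_eq_cvg; apply: nearW => y /=.
rewrite /ito_drift; ring.
Qed.

End half_derivatives.

(** * The coefficients of the equation and of the exponential scheme *)

Section coefficients.
Context {R : realType}.
Variables (G g : R -> R).
Hypotheses (HI : C2_bounded_derivatives (ito_drift G g)) (Hg : C2_bounded_derivatives g).
Hypotheses (I0 : ito_drift G g 0 = 0) (g0 : g 0 = 0).

Local Notation a := (odd_ext (ito_drift G g)).
Local Notation a' := (fun x : R => derive_half (ito_drift G g) `|x|).
Local Notation b := (odd_ext g).
Local Notation b' := (fun x : R => derive_half g `|x|).

Lemma coefficients_lipschitz_diff : exists2 L : R,
  lipschitz_diff L a a' & lipschitz_diff L b b'.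
Proof.
case: (HI) => _ _ _ [M1 H1] [M2 H2]; case: (Hg) => _ _ _ [M3 H3] [M4 H4].
pose L := 1 + `|M1| + `|M2| + `|M3| + `|M4|.
have n1 := normr_ge0 M1; have n2 := normr_ge0 M2; have n3 := normr_ge0 M3.
have n4 := normr_ge0 M4.
have m1 := ler_norm M1; have m2 := ler_norm M2; have m3 := ler_norm M3.
have m4 := ler_norm M4.
exists L; apply: lipschitz_diff_odd_ext => //.
- by move=> x /H1 h; rewrite /L; lra.
- by move=> x /H2 h; rewrite /L; lra.
- by rewrite /L; lra.
- by move=> x /H3 h; rewrite /L; lra.
- by move=> x /H4 h; rewrite /L; lra.
- by rewrite /L; lra.
Qed.

Lemma mean_derive_diffusion x : 0 < x -> mean_derive g x = g x / x.
Proof.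
have [L _ Hb] := coefficients_lipschitz_diff; case: (Hg) => dg _ _ _ _.
apply: (mean_deriveE (phi := b')) => //; first exact: continuous_lipschitz (ld_lip' Hb).
by move=> y y0; rewrite ger0_norm.
Qed.

(** The derivative of [G] contains [g * g''], so that its continuity, required by [mean_deriveE],
    rests on the continuity of the second derivative of [g]. *)
Lemma mean_derive_drift x : 0 < x -> mean_derive G x = G x / x.
Proof.
have [L Ha Hb] := coefficients_lipschitz_diff; case: (Hg) => _ _ cg2 _ _.
have ca' := continuous_lipschitz (ld_lip' Ha).
have cb' := continuous_lipschitz (ld_lip' Hb).
have cb := continuous_lipschitz (ld_lip Hb).
have cg := continuous_half_ext cg2.
pose phi (y : R) := a' y - 2^-1 * (b' y * b' y + b y * derive_half (derive_half g) (Num.max y 0)).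
have cphi : continuous phi.
  move=> y; apply: cvgB; first exact: ca'.
  apply: cvgM; first exact: cvg_cst.
  apply: cvgD; first by apply: cvgM; exact: cb'.
  by apply: cvgM; [exact: cb|exact: cg].
have D y : 0 <= y -> derivable_half G y /\ derive_half G y = phi y.
  move=> y0.
  have : derive_half g z @[z --> within `[0, +oo[ y^'] --> derive_half g y.
    have C : b' z @[z --> within `[0, +oo[ y^'] --> b' y.
      apply: cvg_within_filter; apply: cvg_trans (cb' y).
      by apply: cvg_app; exact: nbhs_dnbhs.
    rewrite /= (ger0_norm y0) in C.
    apply: cvg_trans C; apply: near_eq_cvg.
    rewrite /prop_near1 /within/=; apply/nbhs_ballP; exists 1 => //= z _ _.
    by rewrite in_itv/= andbT => z0; rewrite ger0_norm.
  move=> /(derive_half_stratonovich_drift y0 HI Hg)[dG ->]; split => //.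
  by rewrite /phi (ger0_norm y0) (max_l y0) odd_ext_ge0.
have G0 : G 0 = 0 by have := I0; rewrite /ito_drift g0 mulr0 mulr0 addr0.
apply: (mean_deriveE (phi := phi)) => // y y0; [exact: (D y y0).1|exact: (D y y0).2].
Qed.

(** The quotient formulas for the coefficients hold for positive states, so nonnegativity is carried
    along in the induction. At the state [0] the exponents may differ, but both steps return [0]. *)
Lemma exp_scheme_explicit (d : measure_display) (Omega : measurableType d) (B : R -> Omega -> R) (x0 tau : R) n w : 0 <= x0 ->
  exp_scheme B G g x0 tau n w = xp_scheme B a b b' x0 tau n w /\
  0 <= exp_scheme B G g x0 tau n w.
Proof.
move=> x00; elim: n => [//|n [IH pos]].
rewrite /xp_scheme /= -/(xp_scheme _ _ _ _ _ _) -IH.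
set x := exp_scheme B G g x0 tau n w in pos *; split; last first.
  by rewrite mulr_ge0// expR_ge0.
rewrite /exp_step; have [->|xN0] := eqVneq x 0; first by rewrite !mulr0.
have x0' : 0 < x by rewrite lt_neqAle eq_sym xN0.
case: (Hg) => dg _ _ _ _.
have -> : mean_derive G x = rel_drift a b b' x.
  rewrite mean_derive_drift// /rel_drift !odd_ext_ge0// ger0_norm// /ito_drift.
  by congr (_ / _); ring.
have fE : mean_derive g x = rel_diffusion b x.
  by rewrite mean_derive_diffusion// /rel_diffusion odd_ext_ge0.
rewrite fE (derive_half_rel (dg x pos) x0')//; last exact: mean_derive_diffusion.
suff -> : (derive_half g x * x - g x) / x ^+ 2 * g x = rel_correction b b' x by [].
rewrite /rel_correction /rel_diffusion odd_ext_ge0// ger0_norm//.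
by field.
Qed.

End coefficients.

(** * Passing to the limit in the moments *)

Section moments_in_the_limit.
Context {R : realType} {d : measure_display} {Omega : measurableType d}.
Variable P : probability Omega R.

Lemma truncated_moments (f : Omega -> R) (D : R) :
  measurable_fun [set: Omega] f -> (forall w, 0 <= f w) ->
  (forall k : nat, \int[P]_w (Num.min (f w) k%:R)%:E <= D%:E)%E ->
  (\int[P]_w (f w)%:E <= D%:E)%E.
Proof.
move=> mf f0 H.
pose g (k : nat) w := (Num.min (f w) k%:R)%:E.
have mg k : measurable_fun [set: Omega] (g k).
  by apply/measurable_EFinP; apply: measurable_minr => //; exact: measurable_cst.
have g0 k w : [set: Omega] w -> (0 <= g k w)%E by move=> _; rewrite lee_fin le_min f0 ler0n.
have gS w : [set: Omega] w -> {homo g^~ w : n m / (n <= m)%N >-> (n <= m)%E}.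
  by move=> _ n m nm; rewrite lee_fin le_min !ge_min lexx/= ler_nat nm orbT.
have E w : limn (g^~ w) = (f w)%:E.
  apply: (cvg_lim (@ereal_hausdorff _)).
  apply: (@cvg_near_cst _ _ _ _ _ (eventually_filter)).
  exists (Num.trunc (f w)).+1 => // n /= fn.
  rewrite /g min_l// ltW// (lt_le_trans (truncnS_gt _))// ler_nat//.
have M := @cvg_monotone_convergence _ _ _ P _ measurableT g mg g0 gS.
have -> : (\int[P]_w (f w)%:E = limn (fun k => \int[P]_w g k w))%E.
  rewrite -(monotone_convergence P measurableT mg g0 gS).
  by apply: eq_integral => w _; rewrite E.
apply: lime_le; first by apply/cvg_ex; eexists; exact: M.
by apply: nearW => k; exact: H.
Qed.

(** A Fatou argument for convergence in probability. With the power truncated at [k], the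
    exceptional event costs at most [k * eta], which vanishes with [eta] for fixed [k]; only
    afterwards does [k] grow. *)
Lemma likely_moment_le (Z X : Omega -> R) (q : nat) (c lam : R) : ~~ odd q -> (1 < q)%N ->
  0 <= c -> 0 <= lam -> measurable_fun [set: Omega] Z -> measurable_fun [set: Omega] X ->
  (forall eta, 0 < eta -> exists Y : Omega -> R, [/\ measurable_fun [set: Omega] Y,
    (\int[P]_w ((Z w - Y w) ^+ q)%:E <= c%:E)%E &
    likely P eta (fun w => `|X w - Y w| <= lam)]) ->
  (\int[P]_w ((Z w - X w) ^+ q)%:E <= (2 ^+ q.-1 * (c + lam ^+ q))%:E)%E.
Proof.
move=> qodd q1 c0 lam0 mZ mX H.
have p0 (x : R) : 0 <= x ^+ q by exact: exprn_even_ge0.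
have l0 : 0 <= lam ^+ q by exact: exprn_ge0.
have k20 : 0 <= 2 ^+ q.-1 :> R by exact: exprn_ge0.
apply: truncated_moments; [by mfun|by []|] => k.
set D := 2 ^+ q.-1 * _.
suff S eta : 0 < eta -> (\int[P]_w (Num.min ((Z w - X w) ^+ q) k%:R)%:E <= (D + k%:R * eta)%:E)%E.
  apply/lee_addgt0Pr => e e0.
  have k1 : 0 < k%:R + 1 :> R by rewrite ltr_wpDl.
  apply: (le_trans (S (e / (k%:R + 1)) (divr_gt0 e0 k1))).
  rewrite -EFinD lee_fin lerD2l mulrCA ler_piMr ?(ltW e0)// ler_pdivrMr// mul1r lerDl//.
move=> eta0; have [Y [mY HY [A [mA PA HA]]]] := H eta eta0.
have mI : measurable_fun [set: Omega] (\1_A : Omega -> R) by exact: measurable_indic.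
have I0 w : 0 <= \1_A w :> R by rewrite indicE.
apply: (@le_trans _ _ (\int[P]_w (2 ^+ q.-1 * ((Z w - Y w) ^+ q + lam ^+ q) + k%:R * \1_A w)%:E)%E).
  apply: le_intE.
  - by apply: measurable_minr; [mfun|exact: measurable_cst].
  - by mfun.
  - by move=> w; rewrite le_min p0 ler0n.
  move=> w; rewrite ge_min indicE; case: (boolP (w \in A)) => [_|/negP Aw].
    by rewrite mulr1 lerDr mulr_ge0 ?addr_ge0 ?orbT.
  rewrite mulr0 addr0; apply/orP; left.
  have wA : ~ A w by move=> wA; apply: Aw; rewrite inE.
  have -> : Z w - X w = (Z w - Y w) + - (X w - Y w) by ring.
  apply: (le_trans (exprD_even_le_convex _ _ qodd (ltnW q1))).
  rewrite ler_wpM2l// lerD2l -[leLHS]ger0_norm// normrX normrN lerXn2r ?nnegrE//.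
  exact: HA.
rewrite intED; [|by mfun|by mfun| |]; last 2 first.
- by move=> w; rewrite mulr_ge0// addr_ge0.
- by move=> w; rewrite mulr_ge0.
rewrite intEZ; [|by mfun|by move=> w; rewrite addr_ge0|by []].
rewrite intEZ; [|by []|by []|by []].
rewrite intED; [|by mfun|by mfun|by []|by []].
rewrite intE_cst; last exact: probability_setT.
rewrite integral_indic// setIT.
rewrite [leRHS]EFinD /D !EFinM EFinD; apply: leeD; apply: lee_wpmul2l => //.
by apply: leeD.
Qed.

(** In place of Jensen's inequality: [y ^ p <= 1 + y ^ q] for [y = |f| / t]. Normalizing by [t]
    keeps the order in [t], and the p-th root of [1 + D] is at most [1 + D]. *)
Lemma power_mean_le (f : Omega -> R) (p t D : R) (q : nat) : 0 < t -> 1 <= p -> p <= q%:R -> 0 <= D ->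
  measurable_fun [set: Omega] f ->
  (\int[P]_w (`|f w| ^+ q)%:E <= (D * t ^+ q)%:E)%E ->
  ('E_P[fun w => (`|f w| `^ p)%R] `^ (p^-1)%R <= ((1 + D) * t)%:E)%E.
Proof.
move=> t0 p1 pq D0 mf HD.
have p0 : 0 < p by apply: lt_le_trans p1.
have tp0 : 0 <= t `^ p by exact: powR_ge0.
have tq0 : 0 < t ^+ q by exact: exprn_gt0.
have E1 : ('E_P[fun w => (`|f w| `^ p)%R] <= (t `^ p * (1 + D))%:E)%E.
  rewrite unlock.
  apply: (@le_trans _ _ (\int[P]_w (t `^ p * (1 + (t ^+ q)^-1 * `|f w| ^+ q))%:E)%E).
    apply: le_intE.
    - exact (measurableT_comp (measurable_powR p) (measurable_fun_norm mf)).
    - by have mfn := measurable_fun_norm mf; mfun.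
    - by move=> w; exact: powR_ge0.
    move=> w; have -> : `|f w| = t * (`|f w| / t) by rewrite mulrC divfK// gt_eqF.
    set y := `|f w| / t; have y0 : 0 <= y by rewrite divr_ge0// ltW.
    rewrite powRM ?(ltW t0)// ler_wpM2l// exprMn mulKf ?gt_eqF//.
    have [y1|y1] := leP y 1.
      apply: (@le_trans _ _ 1); last by rewrite lerDl exprn_ge0.
      have -> : 1 = 1 `^ p :> R by rewrite powR1.
      by rewrite ge0_ler_powR ?nnegrE// ltW.
    rewrite -powR_mulrn//; apply: (@le_trans _ _ (y `^ q%:R)); last by rewrite lerDr.
    by apply: ler_powR => //; exact: ltW.
  have mfn := measurable_fun_norm mf.
  have ti : 0 <= (t ^+ q)^-1 by rewrite invr_ge0 ltW.
  rewrite intEZ; [|by mfun|by move=> w; rewrite addr_ge0// mulr_ge0// exprn_ge0|by []].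
  rewrite intED; [|by mfun|by mfun|by []|by move=> w; rewrite mulr_ge0// exprn_ge0].
  rewrite intE_cst; last exact: probability_setT.
  rewrite intEZ; [|by mfun|by move=> w; rewrite exprn_ge0|by []].
  rewrite [leRHS]EFinM lee_wpmul2l// EFinD leeD2l//.
  apply: (@le_trans _ _ ((t ^+ q)^-1%:E * (D * t ^+ q)%:E)%E); first by rewrite lee_wpmul2l.
  by rewrite -EFinM mulrC mulfK// gt_eqF.
have E0 : (0 <= 'E_P[fun w => (`|f w| `^ p)%R])%E.
  by rewrite unlock; apply: intE_ge0 => w; exact: powR_ge0.
have D1 : 1 <= 1 + D by rewrite lerDl.
apply: (@le_trans _ _ ((t `^ p * (1 + D))%:E `^ (p^-1)%R)%E).
  apply: gt0_ler_poweR => //; first by rewrite invr_ge0 ltW.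
  - by rewrite in_itv/= E0 leey.
  - by rewrite in_itv/= leey andbT lee_fin mulr_ge0// (le_trans ler01).
rewrite poweR_EFin lee_fin powRM ?(le_trans ler01 D1)//.
rewrite -powRrM divff ?gt_eqF// powRr1 ?(ltW t0)// mulrC ler_wpM2r ?(ltW t0)//.
by apply: ler1_powR => //; rewrite invf_le1.
Qed.

End moments_in_the_limit.

(** * The strong error of the exponential scheme *)

Section strong_error.
Context {R : realType} {d : measure_display} {Omega : measurableType d}.
Variables (P : probability Omega R) (Filt : R -> set (set Omega)).
Variable (B : R -> Omega -> R).
Hypothesis HF : is_filtration Filt.
Hypothesis HB : is_wiener P Filt B.
Local Notation mu := (@lebesgue_measure R).
Variables (a a' b b' : R -> R) (L : R).
Hypothesis (Ha : lipschitz_diff L a a') (Hb : lipschitz_diff L b b').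
Variable q : nat.
Hypotheses (qodd : ~~ odd q) (q1 : (1 < q)%N).

(** [D] is chosen before the solution: it depends on comparisons between schemes only. The
    additional [1] is the tolerance [lam = h] allowed in the limit in probability. *)
Lemma xp_scheme_strong_error (x0 T : R) : 0 <= T -> exists2 D : R, 0 <= D &
  forall (X H K : R -> Omega -> R), adapted Filt X -> continuous_paths P X ->
  (forall s w, 0 <= s -> H s w = b (X s w)) ->
  (forall s w, 0 <= s -> K s w = a (X s w)) ->
  {ae P, forall w, X 0 w = x0} ->
  (forall t : R, 0 <= t -> exists2 I : Omega -> R,
    is_ito_integral P Filt B H t I &
    {ae P, forall w, X t w = x0 + (\int[mu]_(s in `[0, t]) K s w) + I w}) ->
  forall h n, 0 < h <= 1 -> 4 * L ^+ 2 * Num.sqrt h <= (8 * (2 * q)%:R)^-1 -> n%:R * h <= T ->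
  (\int[P]_w ((xp_scheme B a b b' x0 h n w - X (n%:R * h) w) ^+ q)%:E <= (D * h ^+ q)%:E)%E.
Proof.
move=> T0.
have [K1 K10 HK1] := xp_rk_scheme_error HF HB Ha Hb x0 qodd q1 T0.
have [K2 K20 HK2] := rk_scheme_refine HF HB Ha Hb x0 qodd q1 T0.
pose D1 := 2 ^+ q.-1 * (K1 + K2).
have D10 : 0 <= D1 by rewrite mulr_ge0 ?exprn_ge0 ?addr_ge0.
exists (2 ^+ q.-1 * (D1 + 1)); first by rewrite mulr_ge0 ?exprn_ge0 ?addr_ge0.
move=> X H K aX cX HE KE X0 HX h n h01 hL nT; case/andP: (h01) => h0 h1.
have nh0 := time_ge0 n h0.
have mX : measurable_fun [set: Omega] (X (n%:R * h)).
  by apply: (Fmeas_measurable HF nh0); apply/(FmeasP HF _ nh0); exact: aX.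
have mZ := measurable_xp_scheme HF HB Ha Hb x0 n h0.
have hq0 : 0 <= h ^+ q by rewrite exprn_ge0// ltW.
have -> : 2 ^+ q.-1 * (D1 + 1) * h ^+ q = 2 ^+ q.-1 * (D1 * h ^+ q + h ^+ q) by ring.
apply: likely_moment_le => //; [by rewrite mulr_ge0|exact: ltW|] => eta eta0.
have main m : (\int[P]_w ((xp_scheme B a b b' x0 h n w -
    rk_scheme B a b x0 (h / 2 ^+ m) (n * 2 ^ m) w) ^+ q)%:E <= (D1 * h ^+ q)%:E)%E.
  have h2m : 0 < h / 2 ^+ m by rewrite divr_gt0// exprn_gt0.
  have m1 := measurable_rk_scheme HF HB Ha Hb x0 n h0.
  have m2 := measurable_rk_scheme HF HB Ha Hb x0 (n * 2 ^ m) h2m.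
  have i1 := HK1 h n h01 hL nT; have i2 := HK2 m h n h01 nT.
  set Z := xp_scheme _ _ _ _ _ _ _ in mZ i1 *; set Y := rk_scheme _ _ _ _ h n in m1 i1 i2.
  set W := rk_scheme _ _ _ _ _ _ in m2 i2 *.
  apply: (@le_trans _ _ (\int[P]_w (2 ^+ q.-1 * ((Z w - Y w) ^+ q + (Y w - W w) ^+ q))%:E)%E).
    apply: le_intE; [by mfun|by mfun|by move=> w; rewrite exprn_even_ge0|].
    move=> w; have -> : Z w - W w = (Z w - Y w) + (Y w - W w) by ring.
    by apply: exprD_even_le_convex => //; exact: ltnW.
  rewrite intEZ; [|by mfun|by move=> w; rewrite addr_ge0 ?exprn_even_ge0|by rewrite exprn_ge0].
  rewrite intED; [|by mfun|by mfun|by move=> w; rewrite exprn_even_ge0..].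
  rewrite /D1 -mulrA [leRHS]EFinM lee_wpmul2l ?lee_fin ?exprn_ge0//.
  by rewrite mulrDl EFinD leeD.
(* [rk_scheme_cvg] concerns positive times; at time [0] the initial conditions agree almost
   surely. *)
case: (posnP n) => [n0|n0].
  exists (rk_scheme B a b x0 (h / 2 ^+ 0) (n * 2 ^ 0)); split.
  - by apply: (measurable_rk_scheme HF HB Ha Hb); rewrite expr0 divr1.
  - exact: main.
  apply: (likely_ae (ltW eta0)); apply: filterS X0 => w Xw.
  by rewrite n0 mul0n mul0r Xw /= subrr normr0 ltW.
have nT0 : 0 < n%:R * h by rewrite mulr_gt0// ltr0n.
have [M0 HM0] := rk_scheme_cvg HF HB Ha Hb aX cX HE KE X0 HX nT0 h0 eta0.
have hE : n%:R * h / (n * 2 ^ M0)%:R = h / 2 ^+ M0.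
  by rewrite natrM natrX -mulf_div divff ?mul1r// pnatr_eq0 -lt0n.
(* With [n * 2 ^ M0] steps, at least [M0] of them, the step at time [n * h] is the dyadic refinement
   [h / 2 ^+ M0] reached by [rk_scheme_refine]. *)
have [_ HL] := HM0 (n * 2 ^ M0)%N (leq_trans (ltnW (ltn_expl M0 (ltnSn 1))) (leq_pmull _ n0)).
rewrite hE in HL.
exists (rk_scheme B a b x0 (h / 2 ^+ M0) (n * 2 ^ M0)); split => //.
by apply: (measurable_rk_scheme HF HB Ha Hb); rewrite divr_gt0// exprn_gt0.
Qed.

End strong_error.

Theorem corollary8 (R : realType) (d : measure_display)
    (Omega : measurableType d) (P : probability Omega R)
    (Filt : R -> set (set Omega)) (B : R -> Omega -> R)
    (G g : R -> R) :
  is_filtration Filt ->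
  is_wiener P Filt B ->
  C2_bounded_derivatives (ito_drift G g) ->
  C2_bounded_derivatives g ->
  ito_drift G g 0 = 0 ->
  g 0 = 0 ->
  forall p : R, 1 <= p ->
  exists2 tau_p : R, 0 < tau_p < 1 &
  forall x0 T : R, 0 <= x0 -> 0 < T ->
  exists2 C : R, 0 < C &
  forall X : R -> Omega -> R,
  stratonovich_solution P Filt B G g x0 X ->
  forall N : nat, (0 < N)%N ->
  let tau := T / N%:R in
  tau <= tau_p ->
  (ereal_sup [set ('E_P[fun w =>
       (`|exp_scheme B G g x0 tau n w - X (n%:R * tau) w| `^ (2 * p))%R]
         `^ ((2 * p)^-1)%R)%E | n in [set n | (n <= N)%N]]
     <= (C * tau)%:E)%E.
Proof.
move=> HF HB HI Hg I0 g0 p p1.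
have [L Ha Hb] := coefficients_lipschitz_diff HI Hg I0 g0.
have L0 : 0 < L by apply: lt_le_trans (ld_ge1 Ha).
pose q := (2 * (Num.trunc p).+1)%N.
have qodd : ~~ odd q by rewrite oddM.
have q1 : (1 < q)%N by rewrite /q mulnS.
have pq : 2 * p <= q%:R by rewrite /q natrM ler_wpM2l// ltW// truncnS_gt.
(* [tau <= c ^+ 2] is the smallness condition under which the exponential step has moments of order
   [2 * q]; it involves neither [x0] nor [T]. *)
pose c := (8 * (2 * q)%:R)^-1 / (4 * L ^+ 2) : R.
have L20 : 0 < 4 * L ^+ 2 by rewrite mulr_gt0// exprn_gt0.
have c0 : 0 < c.
  by rewrite divr_gt0// invr_gt0 mulr_gt0// ltr0n muln_gt0/= ltnW.
exists (Num.min 2^-1 (c ^+ 2)).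
  by rewrite lt_min invr_gt0 ltr0n exprn_gt0//= gt_min invf_lt1// ltr1n.
move=> x0 T x00 T0.
have [D D0 HD] := xp_scheme_strong_error HF HB Ha Hb qodd q1 x0 (ltW T0).
exists (1 + D); first by rewrite ltr_pwDl.
move=> X [Xpos aX cX X0 HX] N N0 tau; rewrite le_min => /andP[tau2 tauc].
have tau0 : 0 < tau by rewrite divr_gt0// ltr0n.
have tau1 : tau <= 1 by apply: (le_trans tau2); rewrite invf_le1// ler1n.
have tauL : 4 * L ^+ 2 * Num.sqrt tau <= (8 * (2 * q)%:R)^-1.
  have cE : Num.sqrt (c ^+ 2) = c by rewrite sqrtr_sqr gtr0_norm.
  by rewrite -ler_pdivlMl// mulrC -/c -cE ler_wsqrtr.
apply: ge_ereal_sup => _ [n /= nN <-].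
have nT : n%:R * tau <= T.
  by rewrite /tau mulrCA ler_piMr ?(ltW T0)// ler_pdivrMr ?ltr0n// mul1r ler_nat.
have xpE w := (exp_scheme_explicit HI Hg I0 g0 B tau n w x00).1.
under [X in ('E_P[X] `^ _)%E]boolp.eq_fun do rewrite xpE.
apply: (power_mean_le (q := q)) => //.
- by rewrite (le_trans p1)// ler_peMl ?ler1n// (le_trans ler01).
- apply: measurable_funB.
    exact: (measurable_xp_scheme HF HB Ha Hb).
  have nt0 := time_ge0 n tau0.
  by apply: (Fmeas_measurable HF nt0); apply/(FmeasP HF _ nt0); exact: aX.
under eq_integral do rewrite -normrX ger0_norm ?exprn_even_ge0//.
(* The solution is nonnegative at nonnegative times, where the odd extensions coincide with the
   original coefficients. *)
apply: (HD X (fun s w => g (X s w)) (fun s w => ito_drift G g (X s w))) => //.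
- by move=> s w s0; rewrite odd_ext_ge0// Xpos.
- by move=> s w s0; rewrite odd_ext_ge0// Xpos.
- by move=> t t0; have [I H1 H2] := HX t t0; exists I.
- by rewrite tau0.
Qed.
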